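(* Let $n\ge1$, $r>0$ and let $(\xi,\mathbf g)$ be a pair consisting of a $G$-invariant vector field and a $G$-invariant Riemannian metric on $T_r\mathbb{CP}^n=G/H$. Then $(\xi,\mathbf g)$ is a $G$-invariant contact metric structure of the type indicated if and only if the corresponding conditions hold (for $n=1$ the conditions on $a_{\varepsilon/2},b_{\varepsilon/2}$ are absent). Type AI: $\xi_{o_H}=\pm\frac1\kappa X$ and $a_0=\kappa^2$, $a_\varepsilon=\frac{\kappa}{2q_\varepsilon}$, $b_\varepsilon=\frac{q_\varepsilon}{2\kappa}(4\alpha^2+\kappa^2)$, $c_\varepsilon=\alpha$, $a_{0\varepsilon}=b_{0\varepsilon}=0$, $a_{\varepsilon/2}=\frac{\kappa}{4q_{\varepsilon/2}}$, $b_{\varepsilon/2}=\frac{\kappa q_{\varepsilon/2}}{4}$, for some $\kappa,q_\varepsilon,q_{\varepsilon/2}>0$, $\alpha\in\mathbb R$ (and all such values occur). Type AII: $\xi_{o_H}=\pm\frac1\kappa\mu_\varepsilon$ and $a_0=\frac{\kappa}{2q_\varepsilon}$, $a_\varepsilon=\kappa^2$, $b_\varepsilon=\frac{q_\varepsilon}{2\kappa}(4\alpha^2+\kappa^2)$, $a_{0\varepsilon}=c_\varepsilon=0$, $b_{0\varepsilon}=\alpha$, $a_{\varepsilon/2}=\frac{\kappa}{4q_{\varepsilon/2}}$, $b_{\varepsilon/2}=\frac{\kappa q_{\varepsilon/2}}{4}$, for some (any) $\kappa,q_\varepsilon,q_{\varepsilon/2}>0$, $\alpha\in\mathbb R$.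 Type AIII: $\xi_{o_H}=\pm\frac1\kappa\nu_\varepsilon$ and $a_0=\frac{\kappa}{2q_\varepsilon}$, $a_\varepsilon=\frac{q_\varepsilon}{2\kappa}(4\alpha^2+\kappa^2)$, $b_\varepsilon=\kappa^2$, $a_{0\varepsilon}=\alpha$, $b_{0\varepsilon}=c_\varepsilon=0$, $a_{\varepsilon/2}=b_{\varepsilon/2}=\frac\kappa4$, for some (any) $\kappa,q_\varepsilon>0$, $\alpha\in\mathbb R$. Type BI (with angle $\theta$): $\xi_{o_H}=\frac1\kappa\big(\epsilon_{\cos\theta}\frac{\varrho}{q_\varepsilon}X+\sin\theta\,\mu_\varepsilon\big)$, where $\epsilon_{\cos\theta}$ is the sign of $\cos\theta$ and $\varrho=\sqrt{q_\varepsilon(1-q_\varepsilon\sin^2\theta)}$, and $$a_0=\frac{\kappa^2\varrho^2}{\cos^2\theta},\quad a_\varepsilon=\frac{\kappa^2}{\cos^2\theta}\big(\cos^2\theta+(1-q_\varepsilon)^2\sin^2\theta\big),\quad b_\varepsilon=\frac{q_\varepsilon^2(\kappa^4\alpha^2\varrho^2+\sin^2\theta\cos^2\theta)}{4\varrho^2\sin^2\theta},$$ $$a_{0\varepsilon}=-\epsilon_{\cos\theta}\frac{\kappa^2\varrho}{\cos^2\theta}(1-q_\varepsilon)\sin\theta,\quad b_{0\varepsilon}=\epsilon_{\cos\theta}\frac{\alpha\kappa^3q_\varepsilon\varrho}{2\cos\theta},\quad c_\varepsilon=-\frac{\alpha\kappa^3\varrho^2}{2\sin\theta\cos\theta},$$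 $$a_{\varepsilon/2}=\frac{\kappa\sqrt{q_\varepsilon}}{4q_{\varepsilon/2}},\quad b_{\varepsilon/2}=\frac{\kappa\sqrt{q_\varepsilon}\,q_{\varepsilon/2}}{4},$$ for some (any) $\kappa,q_{\varepsilon/2}>0$, $q_\varepsilon\in\,]0,\frac1{\sin^2\theta}[$, $\alpha\in\mathbb R$. Type BII (with angle $\theta$): $\xi_{o_H}=\frac{q_\varepsilon}{2\kappa}\cos\theta X+\sin\theta(\alpha\mu_\varepsilon+\frac1\kappa\nu_\varepsilon)$ and $$a_0=\frac{4\kappa^2q_\varepsilon^2}{\varrho^2},\quad a_\varepsilon=\frac{1}{q_\varepsilon^2\varrho^2}(\varrho^2+16\alpha^2q_\varepsilon^2\kappa^4\tan^2\theta),\quad b_\varepsilon=\kappa^2\Big(1+\frac{(4-\varrho)^2}{\varrho^2}\tan^2\theta+\frac{\alpha^2}{q_\varepsilon^2}\Big),$$ $$a_{0\varepsilon}=\frac{8\alpha\kappa^3q_\varepsilon}{\varrho^2}\tan\theta,\quad b_{0\varepsilon}=\frac{2\kappa^2q_\varepsilon(4-\varrho)}{\varrho^2}\tan\theta,\quad c_\varepsilon=\frac{\kappa\alpha}{q_\varepsilon^2\varrho^2}\big(4\kappa^2q_\varepsilon^2(4-\varrho)\tan^2\theta-\varrho^2\big),\quad a_{\varepsilon/2}=b_{\varepsilon/2}=\frac{\kappa\sqrt\varrho}{2\varrho},$$ where $\varrho=q_\varepsilon^2\cos^2\theta+4(\alpha^2\kappa^2+1)\sin^2\theta$, for some (any)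 $\kappa,q_\varepsilon>0$, $\alpha\in\mathbb R$. Type BIII (with angle $\theta$): $\xi_{o_H}=\frac{1}{\kappa q_\varepsilon}(\cos\theta\,\mu_\varepsilon+q_\varepsilon\sin\theta\,\nu_\varepsilon)$ and $$a_0=\frac{q_\varepsilon^2}4,\quad a_\varepsilon=\frac{\kappa^2q_\varepsilon^2}{\varrho^2}(1+\alpha^2\varrho^2\tan^2\theta),\quad b_\varepsilon=\frac{\kappa^2}{\varrho^2}\big(\varrho^2\alpha^2+\varrho^2+(1-q_\varepsilon^2)^2\sin^2\theta\cos^2\theta\big),$$ $$a_{0\varepsilon}=-\frac{\alpha\kappa q_\varepsilon^2}{2}\tan\theta,\quad b_{0\varepsilon}=\frac{\alpha\kappa q_\varepsilon}{2},\quad c_\varepsilon=-\frac{q_\varepsilon\kappa^2}{\varrho^2}\big(\alpha^2\varrho^2\tan\theta+(1-q_\varepsilon^2)\sin\theta\cos\theta\big),\quad a_{\varepsilon/2}=b_{\varepsilon/2}=\frac{\kappa q_\varepsilon\sqrt\varrho}{4\varrho},$$ where $\varrho=\cos^2\theta+q_\varepsilon^2\sin^2\theta$, for some (any) $\kappa,q_\varepsilon>0$, $\alpha\in\mathbb R$. Type C (with angles $\theta,\phi$): $$\xi_{o_H}=\frac{1}{q_\varepsilon\delta}\big(\delta\cos\phi(\cos\theta+q_\varepsilon\alpha\sin\theta)+q_\varepsilon(\alpha\gamma_1-\gamma_2)\sin\phi\big)X+(\delta\sin\theta\cos\phi+\gamma_1\sin\phi)\mu_\varepsilon+\frac{\sin\phi}{\kappa}\nu_\varepsilon$$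 and $$a_0=q_\varepsilon^2,\quad a_\varepsilon=\frac{1+\alpha^2q_\varepsilon^2}{\delta^2},\quad b_\varepsilon=\frac{\kappa^2}{\delta^2}(\gamma_1^2+q_\varepsilon^2\gamma_2^2+\delta^2),$$ $$a_{0\varepsilon}=-\frac{\alpha q_\varepsilon^2}{\delta},\quad b_{0\varepsilon}=\frac{\kappa q_\varepsilon^2\gamma_2}{\delta},\quad c_\varepsilon=-\frac{\kappa}{\delta^2}(\gamma_1+\alpha q_\varepsilon^2\gamma_2),\quad a_{\varepsilon/2}^2=b_{\varepsilon/2}^2=\frac1{16\delta^2}(q_\varepsilon^2\delta^2\cos^2\theta\cos^2\phi+\varrho),$$ for some (any) $\kappa,q_\varepsilon>0$ and $\alpha\in\mathbb R$ such that $\varrho\cos^2\theta\cos^2\phi\le\kappa^2$, where $\varrho=\cos^2\phi(\sin\theta-q_\varepsilon\alpha\cos\theta)^2+4q_\varepsilon^2\sin^2\phi$, $$\gamma_1=\frac{\cot\phi}{\kappa^2\beta}\big((1-\kappa^2\beta\delta)\sin\theta-q_\varepsilon\alpha\cos\theta\big),\qquad \gamma_2=\frac{\cot\phi}{\kappa^2\beta q_\varepsilon}\big(q_\varepsilon\alpha\sin\theta+(\kappa^2\beta\delta-q_\varepsilon^2(\alpha^2+\delta^2))\cos\theta\big),$$ and $\delta$ is a positive number such that $(q_\varepsilon\cos\theta\cos\phi)^2\delta^2-\kappa^2\beta\delta+\varrho=0$, where $\beta^2=\frac{4q_\varepsilon^2}{\kappa^2}$.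
   Context: Setting. $\mathbb{CP}^n=G/K$ with $G=\mathrm{SU}(n+1)$, $K=\mathrm S(\mathrm U(1)\times\mathrm U(n))$. Let $E_{jk}$ be the elementary $(n+1)\times(n+1)$ matrices, $i=\sqrt{-1}$, $\langle U,V\rangle=-2\,\mathrm{trace}(UV)$ on $\mathfrak{su}(n+1)$, and $X=\frac12(E_{12}-E_{21})$, $\mu_\varepsilon=\frac i2(E_{12}+E_{21})$, $\nu_\varepsilon=-\frac i2(E_{11}-E_{22})$; $\overline{\mathfrak n}=\mathbb R\{X,\mu_\varepsilon,\nu_\varepsilon\}$; $\mathfrak m_{\varepsilon/2}=\mathbb R\{E_{1\,j+2}-E_{j+2\,1},\,i(E_{1\,j+2}+E_{j+2\,1}):1\le j\le n-1\}$; $\mathfrak k_{\varepsilon/2}=\mathbb R\{E_{2\,j+2}-E_{j+2\,2},\,i(E_{2\,j+2}+E_{j+2\,2}):1\le j\le n-1\}$ (both zero if $n=1$). $H=\{k\in K:\mathrm{Ad}_kX=X\}$ with Lie algebra $\mathfrak h$; $\overline{\mathfrak m}=\overline{\mathfrak n}\oplus\mathfrak m_{\varepsilon/2}\oplus\mathfrak k_{\varepsilon/2}\cong T_{o_H}(G/H)$, $o_H=\{H\}$, and $\mathfrak g=\mathfrak h\oplus\overline{\mathfrak m}$ is reductive. $\mathrm{Ad}(H)$ acts trivially on $\overline{\mathfrak n}$, which is the space of $\mathrm{Ad}(H)$-invariant vectors, so $G$-invariant vector fields on $G/H$ correspond to vectors $\xi_{o_H}\in\overline{\mathfrak n}$.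 $T_r\mathbb{CP}^n$ (tangent vectors of length $r$, for the metric on $G/K$ given by $\langle\cdot,\cdot\rangle$ on the orthogonal complement $\mathfrak m$ of $\mathfrak k$) is identified with $G/H$ by $aH\mapsto(\tau_a)_{*o}(rX)$, where $o=K$ is the origin of $G/K$ and $\tau_a$ is translation by $a$. Standing convention on invariant metrics. The $G$-invariant metrics on $G/H$ considered are those determined by $\mathbf g_{o_H}=\prec\cdot,\cdot\succ+a_{\varepsilon/2}\langle\cdot,\cdot\rangle_{\mathfrak m_{\varepsilon/2}}+b_{\varepsilon/2}\langle\cdot,\cdot\rangle_{\mathfrak k_{\varepsilon/2}}$, with $\prec\cdot,\cdot\succ$ an arbitrary inner product on $\overline{\mathfrak n}$, $a_{\varepsilon/2},b_{\varepsilon/2}>0$. Put $a_0=\prec X,X\succ$, $a_\varepsilon=\prec\mu_\varepsilon,\mu_\varepsilon\succ$, $b_\varepsilon=\prec\nu_\varepsilon,\nu_\varepsilon\succ$, $a_{0\varepsilon}=\prec X,\mu_\varepsilon\succ$, $b_{0\varepsilon}=\prec X,\nu_\varepsilon\succ$, $c_\varepsilon=\prec\mu_\varepsilon,\nu_\varepsilon\succ$. Types. Let $\{\xi_1,\xi_2,\xi_3\}$ be the unique $\prec\cdot,\cdot\succ$-orthonormal basis of $\overline{\mathfrak n}$ with $\xi_1=\frac1\rho X$ ($\rho>0$), $\xi_2\in\mathbb R\{X,\mu_\varepsilon\}$, and such that $\{\xi_1,\xi_2\}$ and $\{\xi_1,\xi_2,\xi_3\}$ have the same orientation as $\{X,\mu_\varepsilon\}$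 and $\{X,\mu_\varepsilon,\nu_\varepsilon\}$, respectively. A $G$-invariant contact metric structure $(\xi,\mathbf g)$ is of Type AI, AII or AIII if $\xi_{o_H}=\pm\xi_1$, $\pm\xi_2$ or $\pm\xi_3$; of Type BI, BII or BIII (with angle $\theta$) if $\xi_{o_H}=\cos\theta\,\xi_i+\sin\theta\,\xi_j$ for $(i,j)=(1,2),(1,3)$ or $(2,3)$, where $\theta\in\,]0,2\pi[\,\setminus\{\pi/2,\pi,3\pi/2\}$; of Type C (with angles $\theta,\phi$) if $\xi_{o_H}=\cos\theta\cos\phi\,\xi_1+\sin\theta\cos\phi\,\xi_2+\sin\phi\,\xi_3$, where $\theta\in\,]0,2\pi[\,\setminus\{\pi/2,\pi,3\pi/2\}$, $\phi\in\,]-\pi/2,\pi/2[\,\setminus\{0\}$. Contact metric structure. $2\,d\eta(U,V)=U\eta(V)-V\eta(U)-\eta([U,V])$. $(\xi,g)$ is a contact metric structure if, with $\eta=g(\xi,\cdot)$, there is a $(1,1)$-tensor $\varphi$ with $\varphi^2=-I+\eta\otimes\xi$, $\eta(\xi)=1$, $g(\varphi U,\varphi V)=g(U,V)-\eta(U)\eta(V)$ and $d\eta(U,V)=g(U,\varphi V)$. *)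

(* Defs.v *)
From HB Require Import structures.
From mathcomp Require Import all_boot all_order all_algebra.
From mathcomp Require Import all_classical all_reals all_analysis.
From mathcomp Require Import spectral complex.
Set Implicit Arguments.
Unset Strict Implicit.
Unset Printing Implicit Defensive.
Import Order.TTheory GRing.Theory Num.Theory.
Import numFieldNormedType.Exports.
Local Open Scope classical_set_scope.
Local Open Scope ring_scope.

(* The C^k maps between normed modules; they are only used below between
   finite-dimensional ones, where having directional derivatives that are C^k
   in every fixed direction is the usual notion. *)
Fixpoint class_C {R : realType} {V W : normedModType R} (k : nat)
    (f : V -> W) : Prop :=
  match k with
  | 0%N => continuous f
  | k'.+1 => (forall x, differentiable f x) /\
             (forall v, class_C k' (fun x => 'D_v f x))
  end.

Definition smooth {R : realType} {V W : normedModType R} (f : V -> W) : Prop :=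
  forall k, class_C k f.

(* Calculus on a closed embedded submanifold M of a finite-dimensional real
   vector space V. Functions and tensor fields on M are total functions on V of
   which only the values at points of M (and on vectors tangent to M) matter. *)
Section Submanifold.
Context {R : realType} {V : normedModType R} (M : set V).

Definition tangent (p v : V) : Prop :=
  exists c : R -> V,
    [/\ forall t, M (c t), c 0 = p & is_derive (0 : R) (1 : R) c v].

Definition extends {W : normedModType R} (f F : V -> W) : Prop :=
  smooth F /\ forall p, M p -> F p = f p.

Definition smooth_on {W : normedModType R} (f : V -> W) : Prop :=
  exists F : V -> W, extends f F.

(* Derivative at p of the smooth map f : M -> W along the tangent vector v; it
   does not depend on the chosen smooth extension of f. *)
Definition der {W : normedModType R} (f : V -> W) (p v : V) : W :=
  'D_v (xget f [set F | extends f F]) p.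

Definition vector_field (U : V -> V) : Prop :=
  (forall p, M p -> tangent p (U p)) /\ smooth_on U.

(* [U, W], computed in the linear coordinates of V. *)
Definition lie_bracket (U W : V -> V) (p : V) : V :=
  der W p (U p) - der U p (W p).

Definition riemannian_metric (g : V -> V -> V -> R) : Prop :=
  [/\ forall p u v, M p -> tangent p u -> tangent p v -> g p u v = g p v u,
      forall p (k : R) u v w, M p -> tangent p u -> tangent p v ->
        tangent p w -> g p u (k *: v + w) = k * g p u v + g p u w,
      forall p u, M p -> tangent p u -> u != 0 -> 0 < g p u u &
      forall U W, vector_field U -> vector_field W ->
        smooth_on (fun p => g p (U p) (W p))].

Definition tensor_1_1 (phi : V -> V -> V) : Prop :=
  [/\ forall p u, M p -> tangent p u -> tangent p (phi p u),
      forall p (k : R) u v, M p -> tangent p u -> tangent p v ->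
        phi p (k *: u + v) = k *: phi p u + phi p v &
      forall U, vector_field U -> vector_field (fun p => phi p (U p))].

(* d eta(U, W), with 2 d eta(U, W) = U eta(W) - W eta(U) - eta([U, W]). *)
Definition ext_der (eta : V -> V -> R) (U W : V -> V) (p : V) : R :=
  (der (fun q => eta q (W q)) p (U p) - der (fun q => eta q (U q)) p (W p)
   - eta p (lie_bracket U W p)) / 2.

Definition contact_metric (xi : V -> V) (g : V -> V -> V -> R) : Prop :=
  let eta := fun p v => g p (xi p) v in
  exists phi : V -> V -> V,
    [/\ tensor_1_1 phi,
        forall p u, M p -> tangent p u ->
          phi p (phi p u) = - u + eta p u *: xi p,
        forall p, M p -> eta p (xi p) = 1,
        forall p u v, M p -> tangent p u -> tangent p v ->
          g p (phi p u) (phi p v) = g p u v - eta p u * eta p v &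
        forall U W p, vector_field U -> vector_field W -> M p ->
          ext_der eta U W p = g p (U p) (phi p (W p))].

End Submanifold.

(* CP^n is modelled as the orbit of E_11 under conjugation by SU(n+1) (the
   projectors onto complex lines), aK corresponding to a E_11 a^-1. Then the
   tangent vector (tau_a)_* A at aK, for A in m, is a [A, E_11] a^-1, and
   T CP^n consists of pairs (point, tangent vector) of complex matrices. *)
Section SphereBundle.
Context {R : realType}.
Variable n : nat.

Notation C := (R[i]).
Notation matC := ('M[C]_n.+1).
Notation matR2 := (('M[R]_n.+1 * 'M[R]_n.+1)%type).

(* Pairs of complex matrices form a real normed space through their real and
   imaginary parts. *)
Definition ambient : normedModType R := (matR2 * matR2)%type.

Definition to_complex (Z : matR2) : matC :=
  \matrix_(j, k) (Z.1 j k +i* Z.2 j k)%C.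

Definition of_complex (Z : matC) : matR2 :=
  (map_mx (@complex.Re R) Z, map_mx (@complex.Im R) Z).

Definition map_pair (F : matC -> matC) (p : ambient) : ambient :=
  (of_complex (F (to_complex p.1)), of_complex (F (to_complex p.2))).

Definition brk (A B : matC) : matC := A *m B - B *m A.

Definition SU : set matC := [set a | a \is unitarymx /\ \det a = 1].

(* The action of G = SU(n+1) on T CP^n. It is the restriction of a linear map
   of the ambient space, hence coincides with its differential. *)
Definition act (a : matC) : ambient -> ambient :=
  map_pair (fun Z => a *m Z *m invmx a).

(* d/dt exp(tA) . p at t = 0 *)
Definition fundamental (A : matC) : ambient -> ambient := map_pair (brk A).

Definition rscale (x : R) (A : matC) : matC := x%:C%C *: A.

(* The indices of E_jk start from 1. *)
Definition E (j k : nat) : matC := delta_mx (inord j.-1) (inord k.-1).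

Definition ip (U W : matC) : R := - 2 * complex.Re (\tr (U *m W)).

Definition vX : matC := rscale (1 / 2) (E 1 2 - E 2 1).
Definition vmu : matC := rscale (1 / 2) ('i%C *: (E 1 2 + E 2 1)).
Definition vnu : matC := rscale (- (1 / 2)) ('i%C *: (E 1 1 - E 2 2)).

Definition nvec (x y z : R) : matC :=
  rscale x vX + rscale y vmu + rscale z vnu.

Definition n_bar : set matC := [set A | exists x y z, A = nvec x y z].

(* span_half 1 = m_(eps/2) and span_half 2 = k_(eps/2); both are zero if
   n = 1. *)
Definition span_half (l : nat) : set matC :=
  [set A | exists x y : 'I_n.-1 -> R,
     A = \sum_(j < n.-1) (rscale (x j) (E l j.+3 - E j.+3 l)
                          + rscale (y j) ('i%C *: (E l j.+3 + E j.+3 l)))].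

Definition m_half : set matC := span_half 1.
Definition k_half : set matC := span_half 2.

(* The point o_H of T_r CP^n, i.e. the tangent vector rX at the origin. *)
Definition o_H (r : R) : ambient :=
  (of_complex (E 1 1), of_complex (brk (rscale r vX) (E 1 1))).

(* T_r CP^n = G/H, as the image of aH |-> (tau_a)_* (rX); H is the stabilizer
   of o_H. *)
Definition TrCP (r : R) : set ambient := [set act a (o_H r) | a in SU].

(* The vector of T_(o_H)(G/H) that corresponds to A in m_bar. *)
Definition at_o (r : R) (A : matC) : ambient := fundamental A (o_H r).

Definition invariant_vector_field (r : R) (xi : ambient -> ambient) : Prop :=
  vector_field (TrCP r) xi /\
  forall a p, SU a -> TrCP r p -> xi (act a p) = act a (xi p).

Definition g_o (r : R) (g : ambient -> ambient -> ambient -> R)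
  (A B : matC) : R := g (o_H r) (at_o r A) (at_o r B).

(* G-invariant metrics of the family under consideration, with parameters a, b
   (irrelevant if n = 1). The inner product on n_bar is the restriction of
   g_o. *)
Definition invariant_metric (r : R) (g : ambient -> ambient -> ambient -> R)
    (a b : R) : Prop :=
  [/\ riemannian_metric (TrCP r) g,
      forall c p u v, SU c -> TrCP r p ->
        tangent (TrCP r) p u -> tangent (TrCP r) p v ->
        g (act c p) (act c u) (act c v) = g p u v,
      0 < a, 0 < b &
      forall A A' B B' D D', n_bar A -> n_bar A' -> m_half B -> m_half B' ->
        k_half D -> k_half D' ->
        g_o r g (A + B + D) (A' + B' + D') =
          g_o r g A A' + a * ip B B' + b * ip D D'].

Definition invariant_pair (r : R) (xi : ambient -> ambient)
    (g : ambient -> ambient -> ambient -> R) (a b : R) : Prop :=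
  invariant_vector_field r xi /\ invariant_metric r g a b.

(* Row i of B holds the coordinates of xi_(i+1) with respect to
   (X, mu, nu). *)
Definition xi_vec (B : 'M[R]_3) (i : 'I_3) : matC :=
  nvec (B i 0) (B i 1) (B i 2).

Definition adapted_basis (r : R) (g : ambient -> ambient -> ambient -> R)
    (B : 'M[R]_3) : Prop :=
  [/\ forall i j, g_o r g (xi_vec B i) (xi_vec B j) = (i == j)%:R,
      exists2 rho : R, 0 < rho & xi_vec B 0 = rscale rho^-1 vX,
      exists x y : R, xi_vec B 1 = nvec x y 0,
      0 < \det (ulsubmx (B : 'M[R]_(2 + 1))) &
      0 < \det B].

(* (xi, g) is a contact metric structure and
   xi_(o_H) = c1 xi_1 + c2 xi_2 + c3 xi_3. *)
Definition contact_with (r : R) (xi : ambient -> ambient)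
    (g : ambient -> ambient -> ambient -> R) (c1 c2 c3 : R) : Prop :=
  contact_metric (TrCP r) xi g /\
  exists2 B : 'M[R]_3, adapted_basis r g B &
    xi (o_H r) = at_o r (rscale c1 (xi_vec B 0) + rscale c2 (xi_vec B 1)
                         + rscale c3 (xi_vec B 2)).

(* a_0, a_eps, b_eps, a_0eps, b_0eps, c_eps *)
Definition inner_values (r : R) (g : ambient -> ambient -> ambient -> R)
    (a0 ae be a0e b0e ce : R) : Prop :=
  [/\ g_o r g vX vX = a0, g_o r g vmu vmu = ae & g_o r g vnu vnu = be] /\
  [/\ g_o r g vX vmu = a0e, g_o r g vX vnu = b0e & g_o r g vmu vnu = ce].

Definition generic_angle (theta : R) : Prop :=
  [/\ 0 < theta < 2 * pi, theta != pi / 2, theta != pi & theta != 3 * pi / 2].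

Definition generic_angle2 (phi : R) : Prop :=
  - (pi / 2) < phi < pi / 2 /\ phi != 0.

Section Types.
Variables (r : R) (xi : ambient -> ambient).
Variable g : ambient -> ambient -> ambient -> R.

Definition type_AI : Prop :=
  contact_with r xi g 1 0 0 \/ contact_with r xi g (-1) 0 0.
Definition type_AII : Prop :=
  contact_with r xi g 0 1 0 \/ contact_with r xi g 0 (-1) 0.
Definition type_AIII : Prop :=
  contact_with r xi g 0 0 1 \/ contact_with r xi g 0 0 (-1).
Definition type_BI (th : R) : Prop :=
  generic_angle th /\ contact_with r xi g (cos th) (sin th) 0.
Definition type_BII (th : R) : Prop :=
  generic_angle th /\ contact_with r xi g (cos th) 0 (sin th).
Definition type_BIII (th : R) : Prop :=
  generic_angle th /\ contact_with r xi g 0 (cos th) (sin th).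
Definition type_C (th ph : R) : Prop :=
  [/\ generic_angle th, generic_angle2 ph &
      contact_with r xi g (cos th * cos ph) (sin th * cos ph) (sin ph)].
End Types.

(* The conditions attached to each type. Below, (a, b) stands for
   (a_(eps/2), b_(eps/2)), (k, q, q', al) for (kappa, q_eps, q_(eps/2), alpha),
   and s for the sign in xi_(o_H) = +- ... *)
Section Conditions.
Variables (r : R) (xi : ambient -> ambient).
Variable g : ambient -> ambient -> ambient -> R.
Variables a b : R.

Definition xi_is (x y z : R) : Prop := xi (o_H r) = at_o r (nvec x y z).

Definition half_is (a' b' : R) : Prop := (1 < n)%N -> a = a' /\ b = b'.

Definition cond_AI (s k q q' al : R) : Prop :=
  [/\ xi_is (s * (1 / k)) 0 0,
      inner_values r g (k ^+ 2) (k / (2 * q))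
        (q / (2 * k) * (4 * al ^+ 2 + k ^+ 2)) 0 0 al &
      half_is (k / (4 * q')) (k * q' / 4)].

Definition cond_AII (s k q q' al : R) : Prop :=
  [/\ xi_is 0 (s * (1 / k)) 0,
      inner_values r g (k / (2 * q)) (k ^+ 2)
        (q / (2 * k) * (4 * al ^+ 2 + k ^+ 2)) 0 al 0 &
      half_is (k / (4 * q')) (k * q' / 4)].

Definition cond_AIII (s k q al : R) : Prop :=
  [/\ xi_is 0 0 (s * (1 / k)),
      inner_values r g (k / (2 * q))
        (q / (2 * k) * (4 * al ^+ 2 + k ^+ 2)) (k ^+ 2) al 0 0 &
      half_is (k / 4) (k / 4)].

Definition cond_BI (th k q q' al : R) : Prop :=
  let e := Num.sg (cos th) in
  let rho := Num.sqrt (q * (1 - q * sin th ^+ 2)) in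
  [/\ xi_is (1 / k * (e * (rho / q))) (1 / k * sin th) 0,
      inner_values r g
        (k ^+ 2 * rho ^+ 2 / cos th ^+ 2)
        (k ^+ 2 / cos th ^+ 2 * (cos th ^+ 2 + (1 - q) ^+ 2 * sin th ^+ 2))
        (q ^+ 2 * (k ^+ 4 * al ^+ 2 * rho ^+ 2 + sin th ^+ 2 * cos th ^+ 2)
           / (4 * rho ^+ 2 * sin th ^+ 2))
        (- e * (k ^+ 2 * rho / cos th ^+ 2) * (1 - q) * sin th)
        (e * (al * k ^+ 3 * q * rho / (2 * cos th)))
        (- (al * k ^+ 3 * rho ^+ 2 / (2 * sin th * cos th))) &
      half_is (k * Num.sqrt q / (4 * q')) (k * Num.sqrt q * q' / 4)].

Definition cond_BII (th k q al : R) : Prop :=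
  let rho := q ^+ 2 * cos th ^+ 2
             + 4 * (al ^+ 2 * k ^+ 2 + 1) * sin th ^+ 2 in
  [/\ xi_is (q / (2 * k) * cos th) (sin th * al) (sin th * (1 / k)),
      inner_values r g
        (4 * k ^+ 2 * q ^+ 2 / rho ^+ 2)
        (1 / (q ^+ 2 * rho ^+ 2)
           * (rho ^+ 2 + 16 * al ^+ 2 * q ^+ 2 * k ^+ 4 * tan th ^+ 2))
        (k ^+ 2 * (1 + (4 - rho) ^+ 2 / rho ^+ 2 * tan th ^+ 2
                   + al ^+ 2 / q ^+ 2))
        (8 * al * k ^+ 3 * q / rho ^+ 2 * tan th)
        (2 * k ^+ 2 * q * (4 - rho) / rho ^+ 2 * tan th)
        (k * al / (q ^+ 2 * rho ^+ 2)
           * (4 * k ^+ 2 * q ^+ 2 * (4 - rho) * tan th ^+ 2 - rho ^+ 2)) &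
      half_is (k * Num.sqrt rho / (2 * rho)) (k * Num.sqrt rho / (2 * rho))].

Definition cond_BIII (th k q al : R) : Prop :=
  let rho := cos th ^+ 2 + q ^+ 2 * sin th ^+ 2 in
  [/\ xi_is 0 (1 / (k * q) * cos th) (1 / (k * q) * (q * sin th)),
      inner_values r g
        (q ^+ 2 / 4)
        (k ^+ 2 * q ^+ 2 / rho ^+ 2
           * (1 + al ^+ 2 * rho ^+ 2 * tan th ^+ 2))
        (k ^+ 2 / rho ^+ 2
           * (rho ^+ 2 * al ^+ 2 + rho ^+ 2
              + (1 - q ^+ 2) ^+ 2 * sin th ^+ 2 * cos th ^+ 2))
        (- (al * k * q ^+ 2 / 2 * tan th))
        (al * k * q / 2)
        (- (q * k ^+ 2 / rho ^+ 2
              * (al ^+ 2 * rho ^+ 2 * tan th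
                 + (1 - q ^+ 2) * sin th * cos th))) &
      half_is (k * q * Num.sqrt rho / (4 * rho))
              (k * q * Num.sqrt rho / (4 * rho))].

Definition rho_C (th ph q al : R) : R :=
  cos ph ^+ 2 * (sin th - q * al * cos th) ^+ 2 + 4 * q ^+ 2 * sin ph ^+ 2.

Definition root_C (th ph k q al be de : R) : Prop :=
  [/\ be ^+ 2 = 4 * q ^+ 2 / k ^+ 2, 0 < de &
      (q * cos th * cos ph) ^+ 2 * de ^+ 2 - k ^+ 2 * be * de
        + rho_C th ph q al = 0].

Definition cond_C (th ph k q al be de : R) : Prop :=
  let cot := cos ph / sin ph in
  let ga1 := cot / (k ^+ 2 * be)
             * ((1 - k ^+ 2 * be * de) * sin th - q * al * cos th) in
  let ga2 := cot / (k ^+ 2 * be * q)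
             * (q * al * sin th
                + (k ^+ 2 * be * de - q ^+ 2 * (al ^+ 2 + de ^+ 2))
                  * cos th) in
  [/\ xi_is (1 / (q * de)
               * (de * cos ph * (cos th + q * al * sin th)
                  + q * (al * ga1 - ga2) * sin ph))
            (de * sin th * cos ph + ga1 * sin ph)
            (sin ph / k),
      inner_values r g
        (q ^+ 2)
        ((1 + al ^+ 2 * q ^+ 2) / de ^+ 2)
        (k ^+ 2 / de ^+ 2 * (ga1 ^+ 2 + q ^+ 2 * ga2 ^+ 2 + de ^+ 2))
        (- (al * q ^+ 2 / de))
        (k * q ^+ 2 * ga2 / de)
        (- (k / de ^+ 2 * (ga1 + al * q ^+ 2 * ga2))) &
      (1 < n)%N ->
        let c := 1 / (16 * de ^+ 2)
                 * (q ^+ 2 * de ^+ 2 * cos th ^+ 2 * cos ph ^+ 2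
                    + rho_C th ph q al) in
        a ^+ 2 = c /\ b ^+ 2 = c].

End Conditions.

End SphereBundle.

(* Main.v *)
Require Import Defs.
From HB Require Import structures.
From mathcomp Require Import all_boot all_order all_algebra.
From mathcomp Require Import all_classical all_reals all_analysis.
From mathcomp Require Import spectral complex.
From mathcomp Require Import ring lra.
Set Implicit Arguments.
Unset Strict Implicit.
Unset Printing Implicit Defensive.
Import Order.TTheory GRing.Theory Num.Theory.
Import numFieldNormedType.Exports.
Local Open Scope classical_set_scope.
Local Open Scope ring_scope.
Local Open Scope sesquilinear_scope.


(** Let M be T_r CP^n. Every condition involved is invariant under SU(n+1), so
    that it may be tested at o_H, where a tangent vector is the fundamental vector
    of a matrix mb x y z f h: x, y, z are its coordinates in X, mu, nu, while
    f and h are complex coordinates on m_half and k_half. Such vectors are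
    velocities, since the action of Cayley transforms gives curves in M
    (fundamental_tangent). No other vector is tangent, because the points (P, Z)
    of M satisfy P^2 = P, P Z + Z P = Z and Re tr Z^2 = r^2 / 2, and the
    linearised equations have no further solution (tangent_eqs_o). The same
    equations show that Lie brackets of vector fields on M are tangent to M.

    The form eta dual to xi is the restriction of a polynomial form eta_poly, and
    d eta is obtained by differentiating polynomials (ext_der_deta); on
    fundamental vectors it is - eta([A, B]) / 2, which gives its coordinates
    (deta_o). As g is nondegenerate, phi is determined by
    g(u, phi v) = d eta(u, v), and the structure is contact metric exactly if
    phi^2 = - id + eta xi and eta(xi) = 1 (contact_metric_phi).

    Let L be the Cholesky factor of the inner product on n_bar in the basis X, mu,
    nu. The rows of its inverse form the adapted basis (adapted_cholesky,
    cholesky_adapted), so that the type of (xi, g) prescribes the coordinates c of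
    xi in this basis, a unit vector. In these coordinates phi acts on n_bar as the
    vector product with L^T L c / (2 det L). The square of a vector product with
    kappa is - id + c c^T only for kappa = c and kappa = - c, and positivity of
    L^T L excludes the latter: the condition on n_bar is L^T L c = 2 (det L) c.
    On m_half + k_half, phi acts by 2 x 2 complex blocks whose squares are - 1
    exactly if 8 a b = det L and, for c3 <> 0, a = b (contact_metric_eqs).

    What remains is to solve these equations for each of the seven forms of c, by
    lower triangular L with positive diagonal; the solutions are the
    parametrised families (realized_AI, and so on up to realized_C). Conversely
    every L, c, a, b defines an invariant pair by formulas that are polynomial in
    the point (inv_field, inv_metric), so that all solutions occur
    (realizes_exists). *)

(** * Smooth maps and derivatives along a submanifold *)

Section SmoothMaps.
Context {R : realType} {V W : normedModType R}.

Lemma class_C_lower k (f : V -> W) : class_C k.+1 f -> class_C k f.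
Proof.
elim: k f => [|k IH] f [df Df]; first by move=> x; exact: differentiable_continuous.
by split=> // v; apply: IH; exact: Df.
Qed.

Lemma class_C_cst k (w : W) : class_C k (fun _ : V => w).
Proof.
elim: k w => [|k IH] w; first exact: cst_continuous.
split=> [x|v]; first exact: differentiable_cst.
rewrite (_ : (fun x => 'D_v _ x) = fun _ => 0); first exact: IH.
by apply/funext => x; exact: derive_cst.
Qed.

Lemma class_C_add k (f g : V -> W) :
  class_C k f -> class_C k g -> class_C k (fun x => f x + g x).
Proof.
elim: k f g => [|k IH] f g.
  by move=> cf cg x; apply: cvgD; [exact: cf|exact: cg].
move=> [df Df] [dg Dg]; split=> [x|v]; first exact: differentiableD.
rewrite (_ : (fun x => 'D_v _ x) = fun x => 'D_v f x + 'D_v g x).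
  by apply: IH; [exact: Df|exact: Dg].
by apply/funext => x; apply: deriveD; exact: diff_derivable.
Qed.

Lemma derive_linear_comp (W' : normedModType R) (L : {linear W -> W'})
    (f : V -> W) x v : continuous L -> differentiable f x ->
  'D_v (fun y => L (f y)) x = L ('D_v f x).
Proof.
move=> cL df; have dL y : differentiable L y by exact: linear_differentiable.
rewrite !deriveE //; last exact: (@differentiable_comp R V W W' f L).
by rewrite (@diff_comp R V W W' f L) //= diff_lin.
Qed.

Lemma class_C_linear_comp (W' : normedModType R) (L : {linear W -> W'}) k
    (f : V -> W) : continuous L -> class_C k f -> class_C k (fun y => L (f y)).
Proof.
move=> cL; elim: k f => [|k IH] f.
  by move=> cf x; apply: (@continuous_comp _ _ _ f L); [exact: cf|exact: cL].
move=> [df Df]; split=> [x|v].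
  by apply: (@differentiable_comp R V W W' f L) => //; exact: linear_differentiable.
rewrite (_ : (fun x => 'D_v _ x) = fun x => L ('D_v f x)); first by apply: IH; exact: Df.
by apply/funext => x; exact: derive_linear_comp.
Qed.

Lemma class_C_linear k (L : {linear V -> W}) : continuous L -> class_C k L.
Proof.
case: k => [//|k] cL; split=> [x|v]; first exact: linear_differentiable.
rewrite (_ : (fun x => 'D_v _ x) = fun _ => L v); first exact: class_C_cst.
by apply/funext => x; rewrite deriveE ?diff_lin //; exact: linear_differentiable.
Qed.

End SmoothMaps.

Section SmoothOperations.
Context {R : realType} {V W : normedModType R}.

(** class_C is defined by recursion on the order, so the product rule has to be
    applied at every order: the derivative of f g is again a sum of products. *)
Lemma class_C_mul k (f g : V -> R) :
  class_C k f -> class_C k g -> class_C k (fun x => f x * g x).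
Proof.
elim: k f g => [|k IH] f g.
  by move=> cf cg x; apply: cvgM; [exact: cf|exact: cg].
move=> Hf Hg; move: (class_C_lower Hf) (class_C_lower Hg) => lf lg.
case: Hf Hg => df Df [dg Dg]; split=> [x|v]; first exact: differentiableM.
rewrite (_ : (fun x => 'D_v _ x) = fun x => f x * 'D_v g x + g x * 'D_v f x).
  by apply: class_C_add; apply: IH => //; [exact: Dg|exact: Df].
by apply/funext => x; rewrite deriveM //; exact: diff_derivable.
Qed.

Lemma smooth_cst (w : W) : smooth (fun _ : V => w).
Proof. by move=> k; exact: class_C_cst. Qed.

Lemma smooth_add (f g : V -> W) : smooth f -> smooth g -> smooth (fun x => f x + g x).
Proof. by move=> sf sg k; exact: class_C_add. Qed.

Lemma smooth_linear_comp (W' : normedModType R) (L : {linear W -> W'}) (f : V -> W) :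
  continuous L -> smooth f -> smooth (fun y => L (f y)).
Proof. by move=> cL sf k; exact: class_C_linear_comp. Qed.

Lemma smooth_linear (L : {linear V -> W}) : continuous L -> smooth L.
Proof. by move=> cL k; exact: class_C_linear. Qed.

Lemma smooth_mul (f g : V -> R) : smooth f -> smooth g -> smooth (fun x => f x * g x).
Proof. by move=> sf sg k; exact: class_C_mul. Qed.

Lemma smooth_differentiable (f : V -> W) x : smooth f -> differentiable f x.
Proof. by move=> sf; case: (sf 1%N). Qed.

Lemma smooth_sum (I : Type) (s : seq I) (P : pred I) (f : I -> V -> W) :
  (forall i, P i -> smooth (f i)) -> smooth (fun x => \sum_(i <- s | P i) f i x).
Proof.
move=> sf; elim: s => [|i s IH].
  rewrite (_ : (fun x => \sum_(i <- _ | P i) _) = fun _ => 0); first exact: smooth_cst.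
  by apply/funext => x; rewrite big_nil.
case Pi : (P i).
  rewrite (_ : (fun x => \sum_(i <- _ | P i) _) = fun x => f i x + \sum_(j <- s | P j) f j x).
    by apply: smooth_add => //; exact: sf.
  by apply/funext => x; rewrite big_cons Pi.
rewrite (_ : (fun x => \sum_(i <- _ | P i) _) = fun x => \sum_(j <- s | P j) f j x) //.
by apply/funext => x; rewrite big_cons Pi.
Qed.

End SmoothOperations.

Section DerivativeOnSubmanifold.
Context {R : realType} {V : normedModType R} (M : set V).

(** A tangent vector is the velocity of a curve in M, and the chain rule sees
    only the values of F along that curve. *)
Lemma derive_tangent_eq {W : normedModType R} (F G : V -> W) p v :
  tangent M p v -> differentiable F p -> differentiable G p ->
  (forall q, M q -> F q = G q) -> 'D_v F p = 'D_v G p.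
Proof.
move=> [c [Mc c0 [dc cv]]] dF dG FG.
have dc0 : differentiable c 0 by apply/derivable1_diffP.
have chain (H : V -> W) : differentiable H p ->
    'd H p v = 'd (H \o c) 0 (1 : R).
  move=> dH; rewrite (@diff_comp _ _ _ _ c H 0 dc0) c0 //=.
  by rewrite -cv deriveE.
have FGc : F \o c = G \o c by apply/funext => t; exact: FG.
by rewrite (deriveE _ dF) (deriveE _ dG) (chain _ dF) (chain _ dG) FGc.
Qed.

(** der does not depend on the extension, so any convenient one computes it. *)
Lemma der_eq {W : normedModType R} (f F : V -> W) p v :
  extends M f F -> tangent M p v -> der M f p v = 'D_v F p.
Proof.
move=> fF tv; rewrite /der.
have [sG Gf] : [set F | extends M f F] (xget f [set F | extends M f F]).
  by apply: xgetPex; exists F.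
case: fF => sF Ff; apply: derive_tangent_eq => //; [exact: smooth_differentiable..|].
by move=> q Mq; rewrite Gf ?Ff.
Qed.

Lemma derive_vanishing {W : normedModType R} (F : V -> W) p v :
  smooth F -> (forall q, M q -> F q = 0) -> tangent M p v -> 'D_v F p = 0.
Proof.
move=> sF F0 tv; rewrite (@derive_tangent_eq _ F (cst 0)) //; first exact: derive_cst.
exact: smooth_differentiable.
Qed.

End DerivativeOnSubmanifold.

(** * Calculus of complex matrix valued maps *)

Section ComplexParts.
Context {R : realType}.
Implicit Types x y : R[i].

Lemma Re_add x y : complex.Re (x + y) = complex.Re x + complex.Re y.
Proof. exact: raddfD. Qed.
Lemma Im_add x y : complex.Im (x + y) = complex.Im x + complex.Im y.
Proof. exact: raddfD. Qed.
Lemma Re_opp x : complex.Re (- x) = - complex.Re x.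
Proof. exact: raddfN. Qed.
Lemma Im_opp x : complex.Im (- x) = - complex.Im x.
Proof. exact: raddfN. Qed.
Lemma Re_mul x y : complex.Re (x * y) =
  complex.Re x * complex.Re y - complex.Im x * complex.Im y.
Proof. by case: x => ? ?; case: y. Qed.
Lemma Im_mul x y : complex.Im (x * y) =
  complex.Re x * complex.Im y + complex.Im x * complex.Re y.
Proof. by case: x => ? ?; case: y. Qed.
Lemma Re_conjc x : complex.Re (Num.conj x) = complex.Re x.
Proof. by case: x. Qed.
Lemma Im_conjc x : complex.Im (Num.conj x) = - complex.Im x.
Proof. by case: x. Qed.
Lemma Re_sum (I : Type) (s : seq I) (P : pred I) (F : I -> R[i]) :
  complex.Re (\sum_(i <- s | P i) F i) = \sum_(i <- s | P i) complex.Re (F i).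
Proof. exact: raddf_sum. Qed.
Lemma Im_sum (I : Type) (s : seq I) (P : pred I) (F : I -> R[i]) :
  complex.Im (\sum_(i <- s | P i) F i) = \sum_(i <- s | P i) complex.Im (F i).
Proof. exact: raddf_sum. Qed.

Lemma complexP x y :
  complex.Re x = complex.Re y -> complex.Im x = complex.Im y -> x = y.
Proof. by case: x => ? ?; case: y => ? ? /= -> ->. Qed.

Lemma adjE m n (A : 'M[R[i]]_(m, n)) i j : (A ^t*) i j = Num.conj (A j i).
Proof. by rewrite !mxE. Qed.

Lemma adj_mul m n p (A : 'M[R[i]]_(m, n)) (B : 'M[R[i]]_(n, p)) :
  (A *m B) ^t* = B ^t* *m A ^t*.
Proof. by rewrite trmx_mul map_mxM. Qed.
Lemma adjD m n (A B : 'M[R[i]]_(m, n)) : (A + B) ^t* = A ^t* + B ^t*.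
Proof. by rewrite linearD /= map_mxD. Qed.
Lemma adjN m n (A : 'M[R[i]]_(m, n)) : (- A) ^t* = - A ^t*.
Proof. by rewrite linearN /= map_mxN. Qed.
Lemma adjZ m n c (A : 'M[R[i]]_(m, n)) : (c *: A) ^t* = Num.conj c *: A ^t*.
Proof. by rewrite linearZ /= map_mxZ. Qed.

End ComplexParts.

Section ComplexMatrixMaps.
Context {R : realType} {V : normedModType R} {n : nat}.
Notation mat := ('M[R[i]]_n.+1).
Implicit Types F G : V -> mat.

(** Matrices over R[i] carry no real norm, so smoothness and derivatives of
    maps into them are read on the real and imaginary parts of the entries. *)
Definition msmooth F := forall i j,
  smooth (fun q => complex.Re (F q i j)) /\ smooth (fun q => complex.Im (F q i j)).

Definition mderive v F (q : V) : mat := \matrix_(i, j)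
  ('D_v (fun q => complex.Re (F q i j)) q +i*
   'D_v (fun q => complex.Im (F q i j)) q)%C.

Lemma msmooth_cst A : msmooth (fun _ => A).
Proof. by move=> i j; split; exact: smooth_cst. Qed.

Lemma mderive_cst v A q : mderive v (fun _ => A) q = 0.
Proof. by apply/matrixP => i j; rewrite !mxE !derive_cst. Qed.

Lemma msmoothD F G : msmooth F -> msmooth G -> msmooth (fun q => F q + G q).
Proof.
move=> sF sG i j; have [rF iF] := sF i j; have [rG iG] := sG i j; split.
- under eq_fun do rewrite mxE Re_add; exact: smooth_add.
- under eq_fun do rewrite mxE Im_add; exact: smooth_add.
Qed.

Lemma mderiveD v F G q : msmooth F -> msmooth G ->
  mderive v (fun q => F q + G q) q = mderive v F q + mderive v G q.
Proof.
move=> sF sG; apply/matrixP => i j; have [rF iF] := sF i j; have [rG iG] := sG i j.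
rewrite !mxE; apply: complexP; rewrite /= ?Re_add ?Im_add /=.
- under eq_fun do rewrite mxE Re_add; apply: deriveD;
    exact/diff_derivable/smooth_differentiable.
- under eq_fun do rewrite mxE Im_add; apply: deriveD;
    exact/diff_derivable/smooth_differentiable.
Qed.

Lemma smooth_opp (f : V -> R) : smooth f -> smooth (fun q => - f q).
Proof.
move=> sf; under eq_fun do rewrite -mulN1r.
by apply: smooth_mul => //; exact: smooth_cst.
Qed.

Lemma msmoothM F G : msmooth F -> msmooth G -> msmooth (fun q => F q *m G q).
Proof.
move=> sF sG i j; split.
- under eq_fun do rewrite mxE Re_sum.
  apply: smooth_sum => k _; under eq_fun do rewrite Re_mul.
  have [rF iF] := sF i k; have [rG iG] := sG k j.
  by apply: smooth_add; [|apply: smooth_opp]; exact: smooth_mul.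
- under eq_fun do rewrite mxE Im_sum.
  apply: smooth_sum => k _; under eq_fun do rewrite Im_mul.
  have [rF iF] := sF i k; have [rG iG] := sG k j.
  by apply: smooth_add; exact: smooth_mul.
Qed.

Lemma derive_sum_smooth (f : 'I_n.+1 -> V -> R) v q : (forall i, smooth (f i)) ->
  'D_v (fun q => \sum_i f i q) q = \sum_i 'D_v (f i) q.
Proof.
move=> sf; rewrite -derive_sum; last first.
  by move=> i; exact/diff_derivable/smooth_differentiable.
by congr ('D_v _ q); apply/funext => x; rewrite fct_sumE.
Qed.

Lemma derive_mul_smooth (f g : V -> R) v q : smooth f -> smooth g ->
  'D_v (fun q => f q * g q) q = 'D_v f q * g q + f q * 'D_v g q.
Proof.
move=> sf sg; rewrite (@deriveM R V f g q v);
  [|exact/diff_derivable/smooth_differentiable..].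
by rewrite addrC; congr (_ + _); exact: mulrC.
Qed.

Lemma derive_add_smooth (f g : V -> R) v q : smooth f -> smooth g ->
  'D_v (fun q => f q + g q) q = 'D_v f q + 'D_v g q.
Proof.
by move=> sf sg; rewrite -deriveD //; exact/diff_derivable/smooth_differentiable.
Qed.

Lemma derive_opp_smooth (f : V -> R) v q : smooth f ->
  'D_v (fun q => - f q) q = - 'D_v f q.
Proof.
by move=> sf; rewrite -deriveN //; exact/diff_derivable/smooth_differentiable.
Qed.

Lemma mderiveM v F G q : msmooth F -> msmooth G ->
  mderive v (fun q => F q *m G q) q = mderive v F q *m G q + F q *m mderive v G q.
Proof.
move=> sF sG; apply/matrixP => i j; rewrite !mxE -big_split /=.
have sFi k := sF i k; have sGj k := sG k j.
apply: complexP => /=.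
- under eq_fun do rewrite mxE Re_sum.
  rewrite Re_sum derive_sum_smooth => [|k]; last first.
    have [? ?] := sFi k; have [? ?] := sGj k.
    under eq_fun do rewrite Re_mul.
    by apply: smooth_add; [|apply: smooth_opp]; exact: smooth_mul.
  apply: eq_bigr => k _; have [? ?] := sFi k; have [? ?] := sGj k.
  under eq_fun do rewrite Re_mul.
  rewrite derive_add_smooth ?derive_opp_smooth ?derive_mul_smooth //;
    [|by do ?apply: smooth_opp; exact: smooth_mul..].
  by rewrite Re_add !mxE !Re_mul /=; ring.
- under eq_fun do rewrite mxE Im_sum.
  rewrite Im_sum derive_sum_smooth => [|k]; last first.
    have [? ?] := sFi k; have [? ?] := sGj k.
    under eq_fun do rewrite Im_mul.
    by apply: smooth_add; exact: smooth_mul.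
  apply: eq_bigr => k _; have [? ?] := sFi k; have [? ?] := sGj k.
  under eq_fun do rewrite Im_mul.
  rewrite derive_add_smooth ?derive_mul_smooth //; [|exact: smooth_mul..].
  by rewrite Im_add !mxE !Im_mul /=; ring.
Qed.

Lemma msmoothZ (c : R[i]) F : msmooth F -> msmooth (fun q => c *: F q).
Proof.
by move=> sF; under eq_fun do rewrite -mul_scalar_mx; apply: msmoothM => //;
  exact: msmooth_cst.
Qed.

Lemma mderiveZ v (c : R[i]) F q : msmooth F ->
  mderive v (fun q => c *: F q) q = c *: mderive v F q.
Proof.
move=> sF; under [X in mderive v X]eq_fun do rewrite -mul_scalar_mx.
by rewrite mderiveM ?mderive_cst ?mul0mx ?add0r ?mul_scalar_mx //; exact: msmooth_cst.
Qed.

Lemma msmoothN F : msmooth F -> msmooth (fun q => - F q).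
Proof. by move=> sF; under eq_fun do rewrite -scaleN1r; exact: msmoothZ. Qed.

Lemma mderiveN v F q : msmooth F -> mderive v (fun q => - F q) q = - mderive v F q.
Proof.
move=> sF; under [X in mderive v X]eq_fun do rewrite -scaleN1r.
by rewrite mderiveZ // scaleN1r.
Qed.

Lemma msmooth_adj F : msmooth F -> msmooth (fun q => (F q) ^t*).
Proof.
move=> sF i j; have [? ?] := sF j i; split.
- by under eq_fun do rewrite adjE Re_conjc.
- by under eq_fun do rewrite adjE Im_conjc; exact: smooth_opp.
Qed.

Lemma mderive_adj v F q : msmooth F ->
  mderive v (fun q => (F q) ^t*) q = (mderive v F q) ^t*.
Proof.
move=> sF; apply/matrixP => i j; have [? ?] := sF j i.
rewrite adjE !mxE; apply: complexP => /=.
- by under eq_fun do rewrite adjE Re_conjc.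
- by under eq_fun do rewrite adjE Im_conjc; rewrite derive_opp_smooth.
Qed.

Lemma msmooth_scale (f : V -> R) F : smooth f -> msmooth F ->
  msmooth (fun q => rscale (f q) (F q)).
Proof.
move=> sf sF; rewrite /rscale => i j; have [? ?] := sF i j; split.
- under eq_fun do rewrite mxE Re_mul /= mul0r subr0; exact: smooth_mul.
- under eq_fun do rewrite mxE Im_mul /= mul0r addr0; exact: smooth_mul.
Qed.

Lemma smooth_Re_trace F : msmooth F -> smooth (fun q => complex.Re (\tr (F q))).
Proof.
move=> sF; under eq_fun do rewrite Re_sum.
by apply: smooth_sum => i _; case: (sF i i).
Qed.

Lemma smooth_Im_trace F : msmooth F -> smooth (fun q => complex.Im (\tr (F q))).
Proof.
move=> sF; under eq_fun do rewrite Im_sum.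
by apply: smooth_sum => i _; case: (sF i i).
Qed.

Lemma derive_Re_trace v F q : msmooth F ->
  'D_v (fun q => complex.Re (\tr (F q))) q = complex.Re (\tr (mderive v F q)).
Proof.
move=> sF; under eq_fun do rewrite Re_sum.
rewrite derive_sum_smooth => [|i]; last by case: (sF i i).
by rewrite Re_sum; apply: eq_bigr => i _; rewrite mxE.
Qed.

Lemma derive_Im_trace v F q : msmooth F ->
  'D_v (fun q => complex.Im (\tr (F q))) q = complex.Im (\tr (mderive v F q)).
Proof.
move=> sF; under eq_fun do rewrite Im_sum.
rewrite derive_sum_smooth => [|i]; last by case: (sF i i).
by rewrite Im_sum; apply: eq_bigr => i _; rewrite mxE.
Qed.

End ComplexMatrixMaps.

(** * The ambient space *)

(** The projector P and the matrix Z of a point (P, Z) of T CP^n, or of a vector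
    tangent at such a point. They are locked, like the definitions by matrix
    formulas below, so that comparing points never unfolds them to entries. *)
HB.lock Definition ptP {R : realType} {n : nat} (p : ambient (R := R) n) :
  'M[R[i]]_n.+1 := to_complex p.1.
HB.lock Definition ptZ {R : realType} {n : nat} (p : ambient (R := R) n) :
  'M[R[i]]_n.+1 := to_complex p.2.
HB.lock Definition pt {R : realType} {n : nat} (A B : 'M[R[i]]_n.+1) :
  ambient (R := R) n := (of_complex A, of_complex B).

Section AmbientSpace.
Context {R : realType} {n : nat}.
Notation mat := ('M[R[i]]_n.+1).
Notation amb := (ambient (R := R) n).
Implicit Types (A B : mat).

Lemma to_complexK : cancel (@to_complex R n) (@of_complex R n).
Proof.
by case=> A B; congr (_, _); apply/matrixP => i j; rewrite !mxE.
Qed.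

Lemma of_complexK : cancel (@of_complex R n) (@to_complex R n).
Proof. by move=> A; apply/matrixP => i j; rewrite !mxE; case: (A i j). Qed.

Lemma ptPK A B : ptP (pt A B) = A. Proof. by rewrite !unlock of_complexK. Qed.
Lemma ptZK A B : ptZ (pt A B) = B. Proof. by rewrite !unlock of_complexK. Qed.
Lemma ptK (p : amb) : pt (ptP p) (ptZ p) = p.
Proof. by case: p => p1 p2; rewrite !unlock !to_complexK. Qed.

Lemma pt_inj (p q : amb) : ptP p = ptP q -> ptZ p = ptZ q -> p = q.
Proof. by move=> eP eZ; rewrite -[p]ptK -[q]ptK eP eZ. Qed.

Lemma ptPD (p q : amb) : ptP (p + q) = ptP p + ptP q.
Proof. by rewrite !unlock; apply/matrixP => i j; rewrite !mxE. Qed.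
Lemma ptZD (p q : amb) : ptZ (p + q) = ptZ p + ptZ q.
Proof. by rewrite !unlock; apply/matrixP => i j; rewrite !mxE. Qed.
Lemma ptPN (p : amb) : ptP (- p) = - ptP p.
Proof. by rewrite !unlock; apply/matrixP => i j; rewrite !mxE. Qed.
Lemma ptZN (p : amb) : ptZ (- p) = - ptZ p.
Proof. by rewrite !unlock; apply/matrixP => i j; rewrite !mxE. Qed.
Lemma ptPZ (k : R) (p : amb) : ptP (k *: p) = rscale k (ptP p).
Proof. by rewrite !unlock; apply/matrixP => i j; rewrite !mxE; apply: complexP; rewrite ?Re_mul ?Im_mul /=; ring. Qed.
Lemma ptZZ (k : R) (p : amb) : ptZ (k *: p) = rscale k (ptZ p).
Proof. by rewrite !unlock; apply/matrixP => i j; rewrite !mxE; apply: complexP; rewrite ?Re_mul ?Im_mul /=; ring. Qed.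

(** The four families of real coordinates; smoothness and derivatives of maps
    into the ambient space are read on them. *)
Definition coord (b c : bool) i j (p : amb) : R :=
  (let m := if b then p.1 else p.2 in if c then m.1 else m.2) i j.

Lemma coord_is_linear b c i j : linear (coord b c i j).
Proof. by move=> k p q; case: b; case: c; rewrite /coord /= !mxE. Qed.

HB.instance Definition _ b c i j :=
  GRing.isLinear.Build R amb R _ (coord b c i j) (coord_is_linear b c i j).

Lemma coord_continuous b c i j : continuous (coord b c i j).
Proof.
have fstc (U1 U2 W : normedModType R) (f : U1 -> W) :
    continuous f -> continuous (fun q : U1 * U2 => f q.1).
  by move=> cf q; apply: (cvg_comp (fun q : U1 * U2 => q.1) f); [exact: cvg_fst|exact: cf].
have sndc (U1 U2 W : normedModType R) (f : U2 -> W) :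
    continuous f -> continuous (fun q : U1 * U2 => f q.2).
  by move=> cf q; apply: (cvg_comp (fun q : U1 * U2 => q.2) f); [exact: cvg_snd|exact: cf].
have cc : continuous (fun m : 'M[R]_n.+1 => m i j).
  exact: matrix_normedtype.coord_continuous.
have c1 := fstc _ 'M[R]_n.+1 _ _ cc; have c2 := sndc 'M[R]_n.+1 _ _ _ cc.
rewrite /coord; case: b; case: c => /= p.
- exact: (fstc _ ('M[R]_n.+1 * 'M[R]_n.+1)%type _ _ c1).
- exact: (fstc _ ('M[R]_n.+1 * 'M[R]_n.+1)%type _ _ c2).
- exact: (sndc ('M[R]_n.+1 * 'M[R]_n.+1)%type _ _ _ c1).
- exact: (sndc ('M[R]_n.+1 * 'M[R]_n.+1)%type _ _ _ c2).
Qed.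

Context {V : normedModType R}.

Lemma derive_coord b c i j (U : V -> amb) q v : smooth U ->
  'D_v (fun q => coord b c i j (U q)) q = coord b c i j ('D_v U q).
Proof.
move=> sU; apply: derive_linear_comp; first exact: coord_continuous.
exact: smooth_differentiable.
Qed.

Lemma smooth_coord b c i j (U : V -> amb) : smooth U ->
  smooth (fun q => coord b c i j (U q)).
Proof. by move=> sU; apply: smooth_linear_comp => //; exact: coord_continuous. Qed.

Lemma ptP_coord (U : V -> amb) i j :
  (fun q => complex.Re (ptP (U q) i j)) = (fun q => coord true true i j (U q)) /\
  (fun q => complex.Im (ptP (U q) i j)) = (fun q => coord true false i j (U q)).
Proof. by split; apply/funext => q; rewrite unlock mxE. Qed.

Lemma ptZ_coord (U : V -> amb) i j :
  (fun q => complex.Re (ptZ (U q) i j)) = (fun q => coord false true i j (U q)) /\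
  (fun q => complex.Im (ptZ (U q) i j)) = (fun q => coord false false i j (U q)).
Proof. by split; apply/funext => q; rewrite unlock mxE. Qed.

Lemma msmooth_ptP (U : V -> amb) : smooth U -> msmooth (fun q => ptP (U q)).
Proof.
by move=> sU i j; have [-> ->] := ptP_coord U i j; split; exact: smooth_coord.
Qed.

Lemma msmooth_ptZ (U : V -> amb) : smooth U -> msmooth (fun q => ptZ (U q)).
Proof.
by move=> sU i j; have [-> ->] := ptZ_coord U i j; split; exact: smooth_coord.
Qed.

Lemma mderive_ptP (U : V -> amb) v q : smooth U ->
  mderive v (fun q => ptP (U q)) q = ptP ('D_v U q).
Proof.
move=> sU; apply/matrixP => i j; rewrite !mxE; have [-> ->] := ptP_coord U i j.
by rewrite !derive_coord // unlock mxE.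
Qed.

Lemma mderive_ptZ (U : V -> amb) v q : smooth U ->
  mderive v (fun q => ptZ (U q)) q = ptZ ('D_v U q).
Proof.
move=> sU; apply/matrixP => i j; rewrite !mxE; have [-> ->] := ptZ_coord U i j.
by rewrite !derive_coord // unlock mxE.
Qed.

Lemma derive_pair (W1 W2 : normedModType R) (f : V -> W1) (g : V -> W2) v q :
  differentiable f q -> differentiable g q ->
  'D_v (fun x => (f x, g x)) q = ('D_v f q, 'D_v g q).
Proof.
move=> df dg; rewrite !deriveE ?diff_pair //.
exact: (@differentiable_pair R V W1 W2 f g).
Qed.

Lemma smooth_pair (W1 W2 : normedModType R) (f : V -> W1) (g : V -> W2) :
  smooth f -> smooth g -> smooth (fun q => (f q, g q)).
Proof.
move=> sf sg k; move: (sf k) (sg k) => {sf sg}.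
elim: k f g => [|k IH] f g.
  by move=> cf cg x; apply: cvg_pair; [exact: cf|exact: cg].
move=> [df Df] [dg Dg]; split=> [x|v].
  exact: (@differentiable_pair R V W1 W2 f g).
rewrite (_ : (fun x => 'D_v _ x) = fun x => ('D_v f x, 'D_v g x)).
  by apply: IH; [exact: Df|exact: Dg].
by apply/funext => x; exact: derive_pair.
Qed.

(** Scaling of a fixed vector, as a linear map in the scalar: a matrix valued map
    is a sum of such maps composed with its entries. *)
Definition along (W : normedModType R) (w : W) (x : R) : W := x *: w.

Lemma along_is_linear (W : normedModType R) (w : W) : linear (@along W w).
Proof. by move=> k x y; rewrite /along scalerDl scalerA. Qed.

HB.instance Definition _ (W : normedModType R) (w : W) :=
  GRing.isLinear.Build R R W _ (@along W w) (along_is_linear w).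

Lemma smooth_along (W : normedModType R) (w : W) (f : V -> R) :
  smooth f -> smooth (fun q => along w (f q)).
Proof.
move=> sf; apply: smooth_linear_comp => // x; exact: scalel_continuous.
Qed.

Lemma smooth_mx (F : V -> 'M[R]_n.+1) :
  (forall i j, smooth (fun q => F q i j)) -> smooth F.
Proof.
move=> sF.
rewrite (_ : F = fun q => \sum_i \sum_j along (delta_mx i j) (F q i j)).
  by do 2!apply: smooth_sum => ? _; exact: smooth_along.
by apply/funext => q; rewrite {1}[F q]matrix_sum_delta.
Qed.

Lemma smooth_pt (F G : V -> mat) :
  msmooth F -> msmooth G -> smooth (fun q => pt (F q) (G q)).
Proof.
move=> sF sG; rewrite unlock; apply: smooth_pair; apply: smooth_pair; apply: smooth_mx => i j;
  have [? ?] := sF i j; have [? ?] := sG i j; by under eq_fun do rewrite mxE.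
Qed.

Lemma smooth_id : smooth (@id V).
Proof. by apply: (@smooth_linear _ _ _ idfun) => x. Qed.

End AmbientSpace.

(** * Unitary conjugation *)

Section Action.
Context {R : realType} {n : nat}.
Notation mat := ('M[R[i]]_n.+1).
Notation amb := (ambient (R := R) n).
Implicit Types (A B K : mat) (p v : amb).

Definition unitary (a : mat) : Prop := a *m a ^t* = 1%:M.

Lemma unitary_adjM (a : mat) : unitary a -> a ^t* *m a = 1%:M.
Proof. by move=> /mulmx1C. Qed.

Lemma unitary_adj (a : mat) : unitary a -> unitary (a ^t*).
Proof. by move=> ua; rewrite /unitary trmxCK unitary_adjM. Qed.

Lemma unitary_mul (a b : mat) : unitary a -> unitary b -> unitary (a *m b).
Proof.
move=> ua ub; rewrite /unitary adj_mul mulmxA -(mulmxA a) ub mulmx1.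
exact: ua.
Qed.

Lemma unitary_inv (a : mat) : unitary a -> invmx a = a ^t*.
Proof. by move=> ua; apply: invmx_unitary; apply/unitarymxP. Qed.

End Action.

HB.lock Definition cj {R : realType} {n : nat} (a A : 'M[R[i]]_n.+1) : 'M[R[i]]_n.+1 :=
  a *m A *m a ^t*.

Section Conjugation.
Context {R : realType} {n : nat}.
Notation mat := ('M[R[i]]_n.+1).
Notation amb := (ambient (R := R) n).
Implicit Types (a A B K : mat) (p v : amb).

Lemma cjM a A B : unitary a -> cj a (A *m B) = cj a A *m cj a B.
Proof.
move=> ua; have e : a ^t* *m a = 1%:M by exact: unitary_adjM.
by rewrite !cj.unlock !mulmxA -[X in _ = X *m _ *m _]mulmxA e mulmx1.
Qed.
Lemma cjD a A B : cj a (A + B) = cj a A + cj a B.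
Proof. by rewrite !cj.unlock mulmxDr mulmxDl. Qed.
Lemma cjN a A : cj a (- A) = - cj a A.
Proof. by rewrite !cj.unlock mulmxN mulNmx. Qed.
Lemma cjZ a c A : cj a (c *: A) = c *: cj a A.
Proof. by rewrite !cj.unlock -scalemxAr -scalemxAl. Qed.
Lemma cj_adj a A : (cj a A) ^t* = cj a (A ^t*).
Proof. by rewrite !cj.unlock !adj_mul trmxCK mulmxA. Qed.
Lemma cj1 a : unitary a -> cj a 1%:M = 1%:M.
Proof. by move=> ua; rewrite !cj.unlock mulmx1. Qed.
Lemma tr_cj a A : unitary a -> \tr (cj a A) = \tr A.
Proof. by move=> ua; rewrite !cj.unlock mxtrace_mulC mulmxA unitary_adjM ?mul1mx. Qed.
Lemma cj_cj a b A : cj a (cj b A) = cj (a *m b) A.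
Proof. by rewrite !cj.unlock adj_mul !mulmxA. Qed.
Lemma cj_id A : cj 1%:M A = A.
Proof. by rewrite !cj.unlock trmx1 map_mx1 mul1mx mulmx1. Qed.
Lemma cj_brk a A B : unitary a -> cj a (brk A B) = brk (cj a A) (cj a B).
Proof. by move=> ua; rewrite /brk cjD cjN !cjM. Qed.

End Conjugation.

(** For unitary a the inverse is the adjoint, so that the action of a becomes
    polynomial in a; fund A is the linear vector field induced by A. *)
HB.lock Definition gact {R : realType} {n : nat} (a : 'M[R[i]]_n.+1)
  (p : ambient (R := R) n) : ambient (R := R) n := pt (cj a (ptP p)) (cj a (ptZ p)).
HB.lock Definition fund {R : realType} {n : nat} (A : 'M[R[i]]_n.+1)
  (p : ambient (R := R) n) : ambient (R := R) n := pt (brk A (ptP p)) (brk A (ptZ p)).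

Section LockedAction.
Context {R : realType} {n : nat}.
Notation mat := ('M[R[i]]_n.+1).
Notation amb := (ambient (R := R) n).
Implicit Types (a b A B K : mat) (p v : amb).

Lemma gact_P a p : ptP (gact a p) = cj a (ptP p).
Proof. by rewrite gact.unlock ptPK. Qed.
Lemma gact_Z a p : ptZ (gact a p) = cj a (ptZ p).
Proof. by rewrite gact.unlock ptZK. Qed.

Lemma actE a p : unitary a -> act a p = gact a p.
Proof. by move=> ua; rewrite /act /map_pair unitary_inv // !unlock. Qed.

Lemma fund_P A p : ptP (fund A p) = brk A (ptP p).
Proof. by rewrite fund.unlock ptPK. Qed.
Lemma fund_Z A p : ptZ (fund A p) = brk A (ptZ p).
Proof. by rewrite fund.unlock ptZK. Qed.

Lemma fundamentalE A p : fundamental A p = fund A p.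
Proof. by rewrite !unlock. Qed.

Lemma gact_mul a b p : gact (a *m b) p = gact a (gact b p).
Proof. by apply: pt_inj; rewrite !(gact_P, gact_Z) cj_cj. Qed.

Lemma gact1 p : gact 1%:M p = p.
Proof. by apply: pt_inj; rewrite !(gact_P, gact_Z) cj_id. Qed.

Lemma gact_adjK a p : unitary a -> gact (a ^t*) (gact a p) = p.
Proof. by move=> ua; rewrite -gact_mul unitary_adjM // gact1. Qed.

Lemma gact_adjVK a p : unitary a -> gact a (gact (a ^t*) p) = p.
Proof. by move=> ua; rewrite -gact_mul ua gact1. Qed.

Lemma gact_fund a A p : unitary a -> gact a (fund A p) = fund (cj a A) (gact a p).
Proof. by move=> ua; apply: pt_inj; rewrite !(gact_P, gact_Z, fund_P, fund_Z) cj_brk. Qed.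

Lemma gactD a p v : gact a (p + v) = gact a p + gact a v.
Proof. by apply: pt_inj; rewrite ?(gact_P, gact_Z, ptPD, ptZD) cjD. Qed.

Lemma gactZ a (k : R) p : gact a (k *: p) = k *: gact a p.
Proof. by apply: pt_inj; rewrite ?(gact_P, gact_Z, ptPZ, ptZZ) /rscale cjZ. Qed.

Lemma gactN a p : gact a (- p) = - gact a p.
Proof. by apply: pt_inj; rewrite ?(gact_P, gact_Z, ptPN, ptZN) cjN. Qed.

Lemma SU_unitary (a : mat) : SU a -> unitary a.
Proof. by case=> /unitarymxP. Qed.

(** Dividing by an (n+1)-st root of the determinant gives determinant 1 and does
    not change the conjugation, since that root has modulus 1. Hence unitary
    matrices such as Cayley transforms preserve M. *)
Lemma unitary_act_SU (a : mat) : unitary a -> exists2 b, SU b & forall p, gact b p = gact a p.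
Proof.
move=> ua; have da : \det a * Num.conj (\det a) = 1.
  have <- : \det (a ^t*) = Num.conj (\det a) by rewrite det_map_mx det_tr.
  by rewrite -det_mulmx ua det1.
pose c : R[i] := n.+1.-root ((\det a)^-1).
have cn : c ^+ n.+1 = (\det a)^-1 by rewrite rootCK.
have cc : c * Num.conj c = 1.
  have c0 : 0 <= c * Num.conj c by rewrite mul_conjC_ge0.
  apply/eqP; rewrite -(@pexpr_eq1 _ _ n.+1) //; apply/eqP.
  by rewrite exprMn -rmorphXn /= cn rmorphV ?unitfE /=;
    rewrite -?invfM ?da ?invr1 //; apply/eqP => d0;
    move: da; rewrite d0 mul0r => /esym/eqP; rewrite oner_eq0.
have cja A : cj (c *: a) A = cj a A.
  by rewrite !cj.unlock adjZ -!scalemxAl -scalemxAr scalerA cc scale1r.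
have uca : unitary (c *: a).
  by rewrite /unitary adjZ -scalemxAl -scalemxAr scalerA cc scale1r.
exists (c *: a).
  split; first exact/unitarymxP.
  rewrite detZ cn mulVf //; apply/eqP => d0.
  by move: da; rewrite d0 mul0r => /esym/eqP; rewrite oner_eq0.
by move=> p; apply: pt_inj; rewrite !(gact_P, gact_Z) cja.
Qed.

End LockedAction.

(** * Cayley curves *)

Section CayleyCurves.
Context {R : realType} {n : nat}.
Notation mat := ('M[R[i]]_n.+1).
Notation amb := (ambient (R := R) n).

Definition skew (A : mat) : Prop := A ^t* = - A.

Lemma rscale_adj (t : R) (A : mat) : (rscale t A) ^t* = rscale t (A ^t*).
Proof. by rewrite /rscale adjZ; congr (_ *: _); apply: complexP; rewrite /= ?oppr0. Qed.

Lemma adj1 : (1%:M : mat) ^t* = 1%:M.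
Proof. by rewrite trmx1 map_mx1. Qed.

Lemma rscaleD (s t : R) (A : mat) : rscale (s + t) A = rscale s A + rscale t A.
Proof. by rewrite /rscale rmorphD scalerDl. Qed.

Lemma rscaleDr (t : R) (A B : mat) : rscale t (A + B) = rscale t A + rscale t B.
Proof. by rewrite /rscale scalerDr. Qed.

Lemma rscaleNr (t : R) (A : mat) : rscale t (- A) = - rscale t A.
Proof. by rewrite /rscale scalerN. Qed.

Lemma rscaleA (s t : R) (A : mat) : rscale s (rscale t A) = rscale (s * t) A.
Proof. by rewrite /rscale scalerA rmorphM. Qed.

Lemma rscale1 (A : mat) : rscale 1 A = A.
Proof. by rewrite /rscale rmorph1 scale1r. Qed.

Lemma rscale0 (A : mat) : rscale 0 A = 0.
Proof. by rewrite /rscale rmorph0 scale0r. Qed.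

Lemma rscaleMl (t : R) (A B : mat) : rscale t A *m B = rscale t (A *m B).
Proof. by rewrite /rscale scalemxAl. Qed.

Lemma rscaleMr (t : R) (A B : mat) : A *m rscale t B = rscale t (A *m B).
Proof. by rewrite /rscale scalemxAr. Qed.

(** The diagonal entries of K K^* are the squared norms of the rows of K. *)
Lemma adj_mul_eq0 (K : mat) : K *m K ^t* = 0 -> K = 0.
Proof.
move=> KK; apply/matrixP => i j; rewrite mxE; apply/eqP; rewrite -normr_eq0 -sqrf_eq0.
have : \sum_k `|K i k| ^+ 2 = 0.
  have /matrixP/(_ i i) := KK; rewrite !mxE => e; rewrite -[RHS]e; apply: eq_bigr => k _.
  by rewrite !mxE normCK.
move=> /psumr_eq0P => s0; apply/eqP; apply: s0 => // k _; exact: exprn_ge0.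
Qed.

Variable A : mat.
Hypothesis skA : skew A.

Let B (t : R) : mat := 1%:M - rscale t A.

Let B_adj t : (B t) ^t* = 1%:M + rscale t A.
Proof. by rewrite /B adjD adjN adj1 rscale_adj skA rscaleNr opprK. Qed.

(** If K (1 - tA) = 0, then K K^* = t K A K^* is both Hermitian and skew, hence
    zero. *)
Let B_unit t : B t \in unitmx.
Proof.
rewrite -row_free_unit -kermx_eq0; apply/eqP; set K := kermx _.
have KB : K = K *m rscale t A.
  by apply/eqP; rewrite -subr_eq0 -{1}[K]mulmx1 -mulmxBr mulmx_ker.
have e1 : K *m K ^t* = K *m rscale t A *m K ^t* by rewrite -KB.
have e2 : K *m K ^t* = - (K *m K ^t*).
  rewrite {1}[X in _ *m X ^t*]KB adj_mul rscale_adj skA rscaleNr mulNmx mulmxN.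
  by rewrite mulmxA -e1.
apply: adj_mul_eq0; apply/eqP.
by move/eqP: e2; rewrite -subr_eq0 opprK -mulr2n -scaler_nat scaler_eq0 pnatr_eq0.
Qed.

(** A rational curve of unitary matrices with velocity 2A at t = 0; it replaces
    exp(2tA), and needs no matrix exponential. *)
Definition cayley t : mat := invmx (1%:M - rscale t A) *m (1%:M + rscale t A).

Let B_comm t : B t *m (B t)^t* = (B t)^t* *m B t.
Proof.
rewrite B_adj /B mulmxBl mul1mx mulmxDr mulmx1 opprD addrA addrK.
by rewrite mulmxDl mul1mx mulmxBr mulmx1 addrA subrK.
Qed.

Lemma cayley_unitary t : unitary (cayley t).
Proof.
rewrite /unitary /cayley -/(B t) -B_adj adj_mul trmxCK.
rewrite mulmxA -(mulmxA _ _ (B t)) -B_comm !mulmxA mulVmx ?B_unit // mul1mx.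
by rewrite -adj_mul mulVmx ?B_unit // adj1.
Qed.

Lemma cayleyE t : cayley t = 1%:M + rscale t (A *m (cayley t + 1%:M)).
Proof.
have : B t *m cayley t = 1%:M + rscale t A by rewrite /cayley mulmxA mulmxV ?B_unit // mul1mx.
rewrite /B mulmxBl mul1mx rscaleMl => /eqP; rewrite subr_eq => /eqP {1}->.
by rewrite mulmxDr mulmx1 rscaleDr -addrA (addrC (rscale t A)).
Qed.

Lemma unitary_entry (a : mat) i j : unitary a -> `|a i j| <= 1.
Proof.
move=> ua; rewrite -(@expr_le1 _ 2) //.
have /matrixP/(_ i i) := ua; rewrite !mxE eqxx => e.
rewrite -[leRHS]e (bigD1 j) //= !mxE -normCK lerDl.
by apply: sumr_ge0 => k _; rewrite !mxE mul_conjC_ge0.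
Qed.

Lemma unitary_entry_Re (a : mat) i j : unitary a -> `|complex.Re (a i j)| <= 1.
Proof.
move=> /(unitary_entry i j) h; rewrite -lecR; exact: le_trans (normc_ge_Re _) h.
Qed.

Lemma unitary_entry_Im (a : mat) i j : unitary a -> `|complex.Im (a i j)| <= 1.
Proof.
move=> /(unitary_entry i j) h; rewrite -lecR; apply: le_trans h.
rewrite normc_def lecR -[leLHS]sqrtr_sqr ler_sqrt ?addr_ge0 ?sqr_ge0 //.
by rewrite lerDr sqr_ge0.
Qed.

Lemma cvg_of_bounded_quotient (f g : R -> R) (K : R) :
  (forall t, f t = f 0 + t * g t) -> (forall t, `|g t| <= K) -> f t @[t --> 0] --> f 0.
Proof.
move=> fg gK.
have lim s : f 0 + s * (`|t| * K) @[t --> (0 : R)] --> f 0.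
  rewrite -[X in _ --> X]addr0 -[X in _ --> _ + X](mulr0 s) -[X in _ * X](mul0r K).
  apply: cvgD; first exact: cvg_cst.
  apply: cvgM; first exact: cvg_cst.
  apply: cvgM; last exact: cvg_cst.
  by rewrite -[X in _ --> X](@normr0 _ R); apply: cvg_norm; exact: cvg_id.
apply: (squeeze_cvgr _ (lim (-1)) (lim 1)); near=> t.
rewrite (fg t) !lerD2l mulN1r mul1r -ler_norml normrM.
by apply: ler_wpM2l.
Unshelve. all: by end_near.
Qed.

Lemma cvg_sum (W : normedModType R) (I : finType) (f : I -> R -> W) (l : I -> W) :
  (forall i, f i t @[t --> 0] --> l i) -> \sum_i f i t @[t --> 0] --> \sum_i l i.
Proof. by move=> fl; apply: cvg_big => [|i _]; [exact: add_continuous|exact: fl]. Qed.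

Definition ccvg0 (f : R -> R[i]) :=
  complex.Re (f t) @[t --> 0] --> complex.Re (f 0) /\
  complex.Im (f t) @[t --> 0] --> complex.Im (f 0).

Lemma ccvg0M f g : ccvg0 f -> ccvg0 g -> ccvg0 (fun t => f t * g t).
Proof.
move=> [? ?] [? ?]; rewrite /ccvg0; split.
- under eq_fun do rewrite Re_mul; rewrite Re_mul.
  by apply: cvgB; exact: cvgM.
- under eq_fun do rewrite Im_mul; rewrite Im_mul.
  by apply: cvgD; exact: cvgM.
Qed.

Definition mcvg0 (F : R -> mat) := forall i j, ccvg0 (fun t => F t i j).

Lemma mcvg0_cst K : mcvg0 (fun _ => K).
Proof. by move=> i j; split; exact: cvg_cst. Qed.

Lemma mcvg0D F G : mcvg0 F -> mcvg0 G -> mcvg0 (fun t => F t + G t).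
Proof.
move=> cF cG i j; have [? ?] := cF i j; have [? ?] := cG i j; rewrite /ccvg0; split.
- by under eq_fun do rewrite mxE Re_add; rewrite mxE Re_add; exact: cvgD.
- by under eq_fun do rewrite mxE Im_add; rewrite mxE Im_add; exact: cvgD.
Qed.

Lemma mcvg0M F G : mcvg0 F -> mcvg0 G -> mcvg0 (fun t => F t *m G t).
Proof.
move=> cF cG i j; rewrite /ccvg0; split.
- under eq_fun do rewrite mxE Re_sum; rewrite mxE Re_sum.
  by apply: cvg_sum => k; exact: (ccvg0M (cF i k) (cG k j)).1.
- under eq_fun do rewrite mxE Im_sum; rewrite mxE Im_sum.
  by apply: cvg_sum => k; exact: (ccvg0M (cF i k) (cG k j)).2.
Qed.

Lemma mcvg0_adj F : mcvg0 F -> mcvg0 (fun t => (F t)^t*).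
Proof.
move=> cF i j; have [? ?] := cF j i; rewrite /ccvg0; split.
- by under eq_fun do rewrite adjE Re_conjc; rewrite adjE Re_conjc.
- by under eq_fun do rewrite adjE Im_conjc; rewrite adjE Im_conjc; exact: cvgN.
Qed.

Lemma mcvg0_scale F : mcvg0 F -> mcvg0 (fun t => rscale t (F t)).
Proof.
move=> cF i j; have [? ?] := cF i j; rewrite /rscale /ccvg0; split.
- under eq_fun do rewrite mxE Re_mul /= mul0r subr0; rewrite mxE Re_mul /= (mul0r (complex.Im _)) subr0.
  by apply: cvgM => //; exact: cvg_id.
- under eq_fun do rewrite mxE Im_mul /= mul0r addr0; rewrite mxE Im_mul /= (mul0r (complex.Re _)) addr0.
  by apply: cvgM => //; exact: cvg_id.
Qed.

Lemma cayley0 : cayley 0 = 1%:M.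
Proof. by rewrite /cayley rscale0 subr0 addr0 invmx1 mulmx1. Qed.

(** Continuity at 0 needs no continuity of the matrix inverse: the increment
    cayley t - 1 is tA(cayley t + 1), and entries of unitary matrices are bounded. *)
Lemma mcvg0_cayley : mcvg0 cayley.
Proof.
have bnd t k j : `|complex.Re ((cayley t + 1%:M) k j)| <= 2 /\
    `|complex.Im ((cayley t + 1%:M) k j)| <= 2.
  rewrite mxE Re_add Im_add; split; apply: le_trans (ler_normD _ _) _;
    apply: (@le_trans _ _ (1 + 1)) => //; apply: lerD.
  - exact/unitary_entry_Re/cayley_unitary.
  - by apply: unitary_entry_Re; rewrite /unitary adj1 mulmx1.
  - exact/unitary_entry_Im/cayley_unitary.
  - by apply: unitary_entry_Im; rewrite /unitary adj1 mulmx1.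
move=> i j; split.
- apply: (@cvg_of_bounded_quotient _
    (fun t => complex.Re ((A *m (cayley t + 1%:M)) i j))
    (\sum_k (`|complex.Re (A i k)| * 2 + `|complex.Im (A i k)| * 2))) => t.
    by rewrite {1}cayleyE cayley0 [in LHS]mxE Re_add; congr (_ + _); rewrite mxE Re_mul /= mul0r subr0.
  rewrite mxE Re_sum; apply: le_trans (ler_norm_sum _ _ _) _; apply: ler_sum => k _.
  rewrite Re_mul; apply: le_trans (ler_normB _ _) _; have [? ?] := bnd t k j.
  by rewrite !normrM; apply: lerD; apply: ler_wpM2l.
- apply: (@cvg_of_bounded_quotient _
    (fun t => complex.Im ((A *m (cayley t + 1%:M)) i j))
    (\sum_k (`|complex.Re (A i k)| * 2 + `|complex.Im (A i k)| * 2))) => t.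
    by rewrite {1}cayleyE cayley0 [in LHS]mxE Im_add; congr (_ + _); rewrite mxE Im_mul /= mul0r addr0.
  rewrite mxE Im_sum; apply: le_trans (ler_norm_sum _ _ _) _; apply: ler_sum => k _.
  rewrite Im_mul; apply: le_trans (ler_normD _ _) _; have [? ?] := bnd t k j.
  by rewrite !normrM; apply: lerD; apply: ler_wpM2l.
Qed.

Lemma mcvg0_pt F G : mcvg0 F -> mcvg0 G -> pt (F t) (G t) @[t --> 0] --> pt (F 0) (G 0).
Proof.
have mx (H : R -> 'M[R]_n.+1) : (forall i j, H t i j @[t --> 0] --> H 0 i j) ->
    H t @[t --> 0] --> H 0.
  move=> cH; rewrite [H 0]matrix_sum_delta.
  rewrite [X in X t @[t --> _]](_ : H = fun t => \sum_i \sum_j H t i j *: delta_mx i j).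
    do 2!(apply: cvg_sum => ?); apply: cvgZr_tmp; exact: cH.
  by apply/funext => t; rewrite {1}[H t]matrix_sum_delta.
move=> cF cG; rewrite unlock.
have re (K : R -> mat) : mcvg0 K ->
    map_mx (@complex.Re R) (K t) @[t --> 0] --> map_mx (@complex.Re R) (K 0).
  move=> cK; apply: (mx (fun t => map_mx (@complex.Re R) (K t))) => i j.
  by under eq_fun do rewrite mxE; rewrite mxE; exact: (cK i j).1.
have im (K : R -> mat) : mcvg0 K ->
    map_mx (@complex.Im R) (K t) @[t --> 0] --> map_mx (@complex.Im R) (K 0).
  move=> cK; apply: (mx (fun t => map_mx (@complex.Im R) (K t))) => i j.
  by under eq_fun do rewrite mxE; rewrite mxE; exact: (cK i j).2.
exact: (cvg_pair (cvg_pair (re _ cF) (im _ cF)) (cvg_pair (re _ cG) (im _ cG))).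
Qed.

(** Once the difference quotient is an explicit function G of t, continuity of G
    at 0 is all that differentiability requires. *)
Lemma is_derive_of_quotient (V : normedModType R) (c G : R -> V) :
  (forall t, c t = c 0 + t *: G t) -> G t @[t --> 0] --> G 0 ->
  is_derive (0 : R) (1 : R) c (G 0).
Proof.
move=> cG G0.
have q : h^-1 *: (c (h *: 1 + 0) - c 0) @[h --> 0^'] --> G 0.
  apply: (cvg_trans _ (cvg_within_filter (fun h : R => h != 0) G0)).
  apply: near_eq_cvg; near=> h.
  rewrite addr0 (_ : h *: (1 : R) = h); last exact: mulr1.
  rewrite (cG h) (addrC (c 0)) addrK scalerA mulVf ?scale1r //.
  near: h; exact: nbhs_dnbhs_neq.
by split; [apply/cvg_ex; exists (G 0)|exact: cvg_lim].
Unshelve. all: by end_near.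
Qed.

End CayleyCurves.

(** * Fundamental vectors are tangent *)

Section FundamentalTangent.
Context {R : realType} {n : nat}.
Notation mat := ('M[R[i]]_n.+1).
Notation amb := (ambient (R := R) n).
Variable M : set amb.
Hypothesis M_act : forall a q, unitary a -> M q -> M (gact a q).

Lemma cj_first_order (t : R) (K Q : mat) :
  cj (1%:M + rscale t K) Q =
  Q + rscale t (K *m Q + Q *m K ^t* + rscale t (K *m Q *m K ^t*)).
Proof.
rewrite cj.unlock adjD adj1 rscale_adj mulmxDl mul1mx mulmxDr mulmx1 mulmxDl.
by rewrite !(rscaleMl, rscaleMr) !rscaleDr -!addrA.
Qed.

(** The curve is the action on p of the Cayley transform of tA/2. *)
Lemma fundamental_tangent p A : skew A -> M p -> tangent M p (fund A p).
Proof.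
move=> skA Mp; pose A' := rscale (1 / 2) A.
have skA' : skew A' by rewrite /skew rscale_adj skA rscaleNr.
pose U := cayley A'; have uU t : unitary (U t) by exact: cayley_unitary.
pose K t := A' *m (U t + 1%:M).
have UE t : U t = 1%:M + rscale t (K t) by exact: cayleyE.
pose vel (t : R) Q := K t *m Q + Q *m (K t) ^t* + rscale t (K t *m Q *m (K t) ^t*).
have cU : mcvg0 U by exact: mcvg0_cayley.
have cK : mcvg0 K.
  by apply: mcvg0M; [exact: mcvg0_cst|apply: mcvg0D => //; exact: mcvg0_cst].
have cvel Q : mcvg0 (vel^~ Q).
  have cQ := mcvg0_cst Q; have cK' := mcvg0_adj cK.
  apply: mcvg0D; first by apply: mcvg0D; exact: mcvg0M.
  by apply: mcvg0_scale; apply: mcvg0M => //; exact: mcvg0M.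
pose c t := gact (U t) p; pose G t := pt (vel t (ptP p)) (vel t (ptZ p)).
have c0 : c 0 = p.
  by rewrite /c /U cayley0 gact1.
have K0 : K 0 = A.
  by rewrite /K /U cayley0 mulmxDr mulmx1 -rscaleD -splitr rscale1.
have vel0 Q : vel 0 Q = brk A Q.
  by rewrite /vel K0 rscale0 addr0 skA mulmxN.
exists c; split=> //; first by move=> t; exact: M_act.
have -> : fund A p = G 0 by rewrite /G !vel0 unlock.
apply: is_derive_of_quotient; last first.
  exact: mcvg0_pt (cvel (ptP p)) (cvel (ptZ p)).
move=> t; rewrite c0; apply: pt_inj.
- by rewrite gact_P ptPD ptPZ ptPK UE cj_first_order.
- by rewrite gact_Z ptZD ptZZ ptZK UE cj_first_order.
Qed.

End FundamentalTangent.

(** * Coordinates on n_bar + m_half + k_half *)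

Section Frame.
Context {R : realType} {m : nat}.
Notation mat := ('M[R[i]]_m.+2).
Notation amb := (ambient (R := R) m.+1).

(** The indices of the coordinates 1, 2 and j + 2 of C^(n+1), for n = m + 1. *)
Definition i0 : 'I_m.+2 := inord 0.
Definition i1 : 'I_m.+2 := inord 1.
Definition jj (k : 'I_m) : 'I_m.+2 := inord k.+2.

Lemma i0_val : i0 = 0 :> nat. Proof. by rewrite inordK. Qed.
Lemma i1_val : i1 = 1%N :> nat. Proof. by rewrite inordK. Qed.
Lemma jj_val k : jj k = k.+2 :> nat. Proof. by rewrite inordK // !ltnS. Qed.

Lemma i01 : (i0 == i1) = false.
Proof. by rewrite -val_eqE /= i0_val i1_val. Qed.
Lemma i10 : (i1 == i0) = false.
Proof. by rewrite eq_sym i01. Qed.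
Lemma i0j k : (i0 == jj k) = false.
Proof. by rewrite -val_eqE /= i0_val jj_val. Qed.
Lemma ij0 k : (jj k == i0) = false.
Proof. by rewrite eq_sym i0j. Qed.
Lemma i1j k : (i1 == jj k) = false.
Proof. by rewrite -val_eqE /= i1_val jj_val. Qed.
Lemma ij1 k : (jj k == i1) = false.
Proof. by rewrite eq_sym i1j. Qed.
Lemma jjE k l : (jj k == jj l) = (k == l).
Proof. by rewrite -val_eqE /= !jj_val !eqSS val_eqE. Qed.

Definition idxE := (i01, i10, i0j, ij0, i1j, ij1, jjE, eqxx).

Variant index_spec : 'I_m.+2 -> Type :=
  | Index0 : index_spec i0
  | Index1 : index_spec i1
  | IndexJ k : index_spec (jj k).

Lemma indexP i : index_spec i.
Proof.
case: i => [[|[|k]] hi].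
- by rewrite (_ : Ordinal hi = i0); [constructor|apply: val_inj; rewrite /= i0_val].
- by rewrite (_ : Ordinal hi = i1); [constructor|apply: val_inj; rewrite /= i1_val].
- have hk : (k < m)%N by rewrite -2!ltnS.
  rewrite (_ : Ordinal hi = jj (Ordinal hk)); first by constructor.
  by apply: val_inj; rewrite /= jj_val.
Qed.

Lemma sum_index (S : nmodType) (F : 'I_m.+2 -> S) :
  \sum_i F i = F i0 + F i1 + \sum_k F (jj k).
Proof.
rewrite big_ord_recl big_ord_recl addrA; congr (_ + _ + _).
- by congr F; apply: val_inj; rewrite /= i0_val.
- by congr F; apply: val_inj; rewrite /= i1_val.
- by apply: eq_bigr => k _; congr F; apply: val_inj; rewrite /= jj_val.
Qed.

Lemma mat_ext (A B : mat) :
  A i0 i0 = B i0 i0 -> A i0 i1 = B i0 i1 -> A i1 i0 = B i1 i0 -> A i1 i1 = B i1 i1 ->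
  (forall k, A i0 (jj k) = B i0 (jj k)) -> (forall k, A (jj k) i0 = B (jj k) i0) ->
  (forall k, A i1 (jj k) = B i1 (jj k)) -> (forall k, A (jj k) i1 = B (jj k) i1) ->
  (forall k l, A (jj k) (jj l) = B (jj k) (jj l)) -> A = B.
Proof.
by move=> *; apply/matrixP => i j; case: (indexP i) => [||k]; case: (indexP j).
Qed.

Lemma oppmxE (A : mat) i j : (- A) i j = - A i j. Proof. by rewrite mxE. Qed.
Lemma addmxE (A B : mat) i j : (A + B) i j = A i j + B i j. Proof. by rewrite mxE. Qed.

Lemma mul_deltaE (A : mat) (a b i j : 'I_m.+2) : (A *m delta_mx a b) i j = A i a * (j == b)%:R.
Proof.
rewrite mxE (bigD1 a) //= big1 => [|k /negPf ka]; last by rewrite mxE ka mulr0.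
by rewrite !mxE eqxx addr0.
Qed.

Lemma delta_mulE (A : mat) (a b i j : 'I_m.+2) : (delta_mx a b *m A) i j = (i == a)%:R * A b j.
Proof.
rewrite mxE (bigD1 b) //= big1 => [|k /negPf kb]; last by rewrite mxE kb andbF mul0r.
by rewrite !mxE eqxx andbT addr0.
Qed.

Lemma tr_delta_mul (A : mat) a b : \tr (delta_mx a b *m A) = A b a.
Proof.
rewrite /mxtrace (bigD1 a) //= big1 => [|k /negPf ka]; last first.
  by rewrite delta_mulE ka mul0r.
by rewrite delta_mulE eqxx mul1r addr0.
Qed.

(** The element of n_bar + m_half + k_half with the given coordinates; f and h
    are complex coordinates on m_half and k_half. *)
Definition mb (x y z : R) (f h : 'I_m -> R[i]) : mat := \matrix_(i, j)
  if i == i0 then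
    if j == i0 then (0 +i* (- (z / 2)))%C else
    if j == i1 then ((x / 2) +i* (y / 2))%C else
    \sum_k (j == jj k)%:R * f k
  else if i == i1 then
    if j == i0 then ((- (x / 2)) +i* (y / 2))%C else
    if j == i1 then (0 +i* (z / 2))%C else
    \sum_k (j == jj k)%:R * h k
  else
    if j == i0 then - \sum_k (i == jj k)%:R * Num.conj (f k) else
    if j == i1 then - \sum_k (i == jj k)%:R * Num.conj (h k) else 0.

Lemma sum_jj (k : 'I_m) (f : 'I_m -> R[i]) : \sum_l (jj k == jj l)%:R * f l = f k.
Proof.
rewrite (bigD1 k) //= big1 => [|l lk]; last by rewrite jjE eq_sym (negPf lk) mul0r.
by rewrite eqxx mul1r addr0.
Qed.

Section Entries.
Variables (x y z : R) (f h : 'I_m -> R[i]).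
Lemma mb00 : mb x y z f h i0 i0 = (0 +i* (- (z / 2)))%C.
Proof. by rewrite mxE !idxE. Qed.
Lemma mb01 : mb x y z f h i0 i1 = ((x / 2) +i* (y / 2))%C.
Proof. by rewrite mxE !idxE. Qed.
Lemma mb10 : mb x y z f h i1 i0 = ((- (x / 2)) +i* (y / 2))%C.
Proof. by rewrite mxE !idxE. Qed.
Lemma mb11 : mb x y z f h i1 i1 = (0 +i* (z / 2))%C.
Proof. by rewrite mxE !idxE. Qed.
Lemma mb0j k : mb x y z f h i0 (jj k) = f k.
Proof. by rewrite mxE !idxE sum_jj. Qed.
Lemma mb1j k : mb x y z f h i1 (jj k) = h k.
Proof. by rewrite mxE !idxE sum_jj. Qed.
Lemma mbj0 k : mb x y z f h (jj k) i0 = - Num.conj (f k).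
Proof. by rewrite mxE !idxE (sum_jj k (fun l => Num.conj (f l))). Qed.
Lemma mbj1 k : mb x y z f h (jj k) i1 = - Num.conj (h k).
Proof. by rewrite mxE !idxE (sum_jj k (fun l => Num.conj (h l))). Qed.
Lemma mbjj k l : mb x y z f h (jj k) (jj l) = 0.
Proof. by rewrite mxE !idxE. Qed.
End Entries.

Definition mbE := (mb00, mb01, mb10, mb11, mb0j, mb1j, mbj0, mbj1, mbjj).

Lemma conjE (a b : R) : Num.conj (a +i* b)%C = (a -i* b)%C. Proof. by []. Qed.
Lemma oppE (a b : R) : - (a +i* b)%C = ((- a) +i* (- b))%C. Proof. by []. Qed.

Lemma mb_skew x y z f h : skew (mb x y z f h).
Proof.
rewrite /skew; apply: mat_ext => *; rewrite adjE oppmxE !mbE ?conjE ?oppE ?opprK ?oppr0 ?rmorph0 //.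
- by rewrite rmorphN /= conjCK.
- by rewrite rmorphN /= conjCK.
Qed.

End Frame.

Section Frame2.
Context {R : realType} {m : nat}.
Notation mat := ('M[R[i]]_m.+2).
Notation amb := (ambient (R := R) m.+1).
Implicit Types (A B : mat) (x y z : R) (f h : 'I_m -> R[i]).

Lemma rscaleE (t : R) (A : mat) i j : rscale t A i j = (t +i* 0)%C * A i j.
Proof. by rewrite mxE. Qed.

Lemma mbD x y z f h x' y' z' f' h' :
  mb x y z f h + mb x' y' z' f' h' =
  mb (x + x') (y + y') (z + z') (fun k => f k + f' k) (fun k => h k + h' k).
Proof.
by apply: mat_ext => *; rewrite addmxE !mbE; apply: complexP;
  rewrite ?(Re_add, Im_add, Re_opp, Im_opp, Re_conjc, Im_conjc) /=; ring.
Qed.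

Lemma mbZ (t : R) x y z f h : rscale t (mb x y z f h) =
  mb (t * x) (t * y) (t * z) (fun k => (t +i* 0)%C * f k) (fun k => (t +i* 0)%C * h k).
Proof.
by apply: mat_ext => *; rewrite rscaleE !mbE; apply: complexP;
  rewrite ?(Re_mul, Im_mul, Re_opp, Im_opp, Re_conjc, Im_conjc) /=; ring.
Qed.

Lemma vXE : (vX m.+1 : mat) = mb 1 0 0 (fun _ => 0) (fun _ => 0).
Proof.
rewrite /vX /E /= -/i0 -/i1; apply: mat_ext => *; rewrite mbE /rscale !mxE !idxE;
  by apply: complexP; rewrite ?(Re_mul, Im_mul) /=; ring.
Qed.

Lemma vmuE : (vmu m.+1 : mat) = mb 0 1 0 (fun _ => 0) (fun _ => 0).
Proof.
rewrite /vmu /E /= -/i0 -/i1; apply: mat_ext => *; rewrite mbE /rscale !mxE !idxE;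
  by apply: complexP; rewrite ?(Re_mul, Im_mul) /=; ring.
Qed.

Lemma vnuE : (vnu m.+1 : mat) = mb 0 0 1 (fun _ => 0) (fun _ => 0).
Proof.
rewrite /vnu /E /= -/i0 -/i1; apply: mat_ext => *; rewrite mbE /rscale !mxE !idxE;
  by apply: complexP; rewrite ?(Re_mul, Im_mul) /=; ring.
Qed.

Lemma mb_ext x y z f h x' y' z' f' h' : x = x' -> y = y' -> z = z' -> f =1 f' -> h =1 h' ->
  mb x y z f h = mb x' y' z' f' h'.
Proof. by move=> -> -> -> /funext -> /funext ->. Qed.

Lemma nvecE x y z : nvec m.+1 x y z = mb x y z (fun _ => 0) (fun _ => 0).
Proof.
rewrite /nvec vXE vmuE vnuE !mbZ !mbD.
by apply: mb_ext => [|||k|k]; rewrite ?mulr0 ?mulr1 ?addr0 ?add0r.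
Qed.

Lemma span_halfE (l : nat) (A : mat) : (l = 1%N \/ l = 2%N) ->
  span_half l A <-> exists f : 'I_m -> R[i], A = \sum_k
    (f k *: delta_mx (inord l.-1) (jj k) - Num.conj (f k) *: delta_mx (jj k) (inord l.-1)).
Proof.
move=> _; have term (a b : R) (D D' : mat) :
    rscale a (D - D') + rscale b ('i%C *: (D + D')) =
    (a +i* b)%C *: D - Num.conj (a +i* b)%C *: D'.
  rewrite /rscale scalerBr !scalerA scalerDr addrACA -scalerDl -scaleNr -scalerDl -scaleNr.
  by congr (_ *: _ + _ *: _);
    apply: complexP; rewrite ?(Re_add, Im_add, Re_mul, Im_mul, Re_opp, Im_opp) /=; ring.
split=> [[x [y ->]]|[f ->]].
  by exists (fun k => (x k +i* y k)%C); apply: eq_bigr => k _; exact: term.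
exists (fun k => complex.Re (f k)), (fun k => complex.Im (f k)).
by apply: eq_bigr => k _; rewrite term; case: (f k).
Qed.

Lemma half_entry (a i j : 'I_m.+2) (f : 'I_m -> R[i]) :
  (\sum_k (f k *: delta_mx a (jj k) - Num.conj (f k) *: delta_mx (jj k) a) : mat) i j =
  (i == a)%:R * (\sum_k (j == jj k)%:R * f k) -
  (j == a)%:R * (\sum_k (i == jj k)%:R * Num.conj (f k)).
Proof.
rewrite summxE mulr_sumr mulr_sumr -sumrB; apply: eq_bigr => k _.
by rewrite !mxE; do 4![case: (_ == _) => /=]; ring.
Qed.

Lemma sum_j0 (i : 'I_m.+2) (f : 'I_m -> R[i]) : (forall k, (i == jj k) = false) ->
  \sum_k (i == jj k)%:R * f k = 0.
Proof. by move=> hi; rewrite big1 // => k _; rewrite hi mul0r. Qed.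

Lemma m_halfE (A : mat) : m_half A <-> exists f, A = mb 0 0 0 f (fun _ => 0).
Proof.
rewrite /m_half span_halfE; last by left.
have e f : \sum_k (f k *: delta_mx i0 (jj k) - Num.conj (f k) *: delta_mx (jj k) i0) =
    mb 0 0 0 f (fun _ => 0).
  apply: mat_ext => *; rewrite half_entry mbE !idxE ?sum_jj
    ?(sum_jj _ (fun l => Num.conj (f l))) ?sum_j0 //; (try by move=> ?; rewrite idxE);
    by rewrite ?rmorph0 ?mul0r ?mul1r ?mulr0 ?subr0 ?sub0r ?oppr0 ?mul0r ?oppr0.
by split=> -[f ->]; exists f; rewrite -?e // -e.
Qed.

Lemma k_halfE (A : mat) : k_half A <-> exists h, A = mb 0 0 0 (fun _ => 0) h.
Proof.
rewrite /k_half span_halfE; last by right.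
have e f : \sum_k (f k *: delta_mx i1 (jj k) - Num.conj (f k) *: delta_mx (jj k) i1) =
    mb 0 0 0 (fun _ => 0) f.
  apply: mat_ext => *; rewrite half_entry mbE !idxE ?sum_jj
    ?(sum_jj _ (fun l => Num.conj (f l))) ?sum_j0 //; (try by move=> ?; rewrite idxE);
    by rewrite ?rmorph0 ?mul0r ?mul1r ?mulr0 ?subr0 ?sub0r ?oppr0 ?mul0r ?oppr0.
by split=> -[f ->]; exists f; rewrite -?e // -e.
Qed.

Lemma tr_mul_index (A B : mat) : \tr (A *m B) = \sum_i \sum_j A i j * B j i.
Proof. by apply: eq_bigr => i _; rewrite mxE. Qed.

(** ip is - 2 Re tr(AB), and each coordinate occurs twice in a skew matrix. *)
Lemma ip_half f h f' h' : ip (mb 0 0 0 f h) (mb 0 0 0 f' h') =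
  4 * (\sum_k complex.Re (f k * Num.conj (f' k)) +
       \sum_k complex.Re (h k * Num.conj (h' k))).
Proof.
set A := mb 0 0 0 f h; set B := mb 0 0 0 f' h'.
have e0 : \sum_j A i0 j * B j i0 = - \sum_k f k * Num.conj (f' k).
  rewrite sum_index !mbE [X in X + \sum_(_ < _) _](_ : _ = 0); last by apply: complexP; rewrite !(Re_add, Im_add, Re_mul, Im_mul) /=; field.
  by rewrite add0r -sumrN; apply: eq_bigr => k _; rewrite !mbE mulrN.
have e1 : \sum_j A i1 j * B j i1 = - \sum_k h k * Num.conj (h' k).
  rewrite sum_index !mbE [X in X + \sum_(_ < _) _](_ : _ = 0); last by apply: complexP; rewrite !(Re_add, Im_add, Re_mul, Im_mul) /=; field.
  by rewrite add0r -sumrN; apply: eq_bigr => k _; rewrite !mbE mulrN.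
have ej k : \sum_j A (jj k) j * B j (jj k) = - (Num.conj (f k) * f' k + Num.conj (h k) * h' k).
  rewrite sum_index !mbE big1 ?addr0 ?opprD ?mulNr //.
  by move=> l _; rewrite !mbE mul0r.
rewrite /ip tr_mul_index sum_index e0 e1 (eq_bigr _ (fun k _ => ej k)) sumrN big_split /=.
have eJ (g g' : 'I_m -> R[i]) : complex.Re (\sum_k Num.conj (g k) * g' k) =
    complex.Re (\sum_k g k * Num.conj (g' k)).
  by rewrite !Re_sum; apply: eq_bigr => k _; rewrite !Re_mul !(Re_conjc, Im_conjc); ring.
rewrite !(Re_add, Re_opp) !eJ -!Re_sum; ring.
Qed.

(** The two components of o_H are Po and - (r/2) No. *)
Definition Po : mat := delta_mx i0 i0.
Definition No : mat := delta_mx i0 i1 + delta_mx i1 i0.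

Lemma brk_PoE A i j : brk A Po i j = A i i0 * (j == i0)%:R - (i == i0)%:R * A i0 j.
Proof. by rewrite /brk addmxE oppmxE mul_deltaE delta_mulE. Qed.

Lemma brk_NoE A i j : brk A No i j =
  A i i0 * (j == i1)%:R + A i i1 * (j == i0)%:R -
  ((i == i0)%:R * A i1 j + (i == i1)%:R * A i0 j).
Proof. by rewrite /brk /No mulmxDr mulmxDl !(addmxE, oppmxE) !mul_deltaE !delta_mulE. Qed.

Variable r : R.

Lemma ptP_o : ptP (o_H m.+1 r) = Po.
Proof. by rewrite unlock /o_H of_complexK. Qed.

Lemma brkZl (t : R) A B : brk (rscale t A) B = rscale t (brk A B).
Proof. by rewrite /brk rscaleMl rscaleMr rscaleDr rscaleNr. Qed.

Lemma brkZr (t : R) A B : brk A (rscale t B) = rscale t (brk A B).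
Proof. by rewrite /brk rscaleMl rscaleMr rscaleDr rscaleNr. Qed.

Lemma brk_vX_Po : brk (vX m.+1) Po = rscale (- (1 / 2)) No.
Proof.
apply: mat_ext => *; rewrite vXE brk_PoE !mbE /rscale !mxE !idxE;
  by apply: complexP; rewrite ?(Re_add, Im_add, Re_opp, Im_opp, Re_mul, Im_mul) /=; field.
Qed.

Lemma ptZ_o : ptZ (o_H m.+1 r) = rscale (- (r / 2)) No.
Proof.
by rewrite unlock /o_H of_complexK brkZl brk_vX_Po rscaleA mulrN mul1r.
Qed.

Lemma at_oE A : at_o r A = fund A (o_H m.+1 r).
Proof. exact: fundamentalE. Qed.

Lemma ptP_at_o A : ptP (at_o r A) = brk A Po.
Proof. by rewrite at_oE fund_P ptP_o. Qed.

Lemma ptZ_at_o A : ptZ (at_o r A) = rscale (- (r / 2)) (brk A No).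
Proof. by rewrite at_oE fund_Z ptZ_o brkZr. Qed.

End Frame2.

(** The coordinates of the n_bar part of a tangent vector v at p, as
    polynomials in p and v. *)
HB.lock Definition cx {R : realType} {m : nat} (r : R) (p v : ambient (R := R) m.+1) : R :=
  2 / r * complex.Re (\tr (ptZ p *m ptP v)).
HB.lock Definition cy {R : realType} {m : nat} (r : R) (p v : ambient (R := R) m.+1) : R :=
  - (4 / r) * complex.Im (\tr (ptP p *m ptZ p *m ptP v)).
HB.lock Definition cz {R : realType} {m : nat} (r : R) (p v : ambient (R := R) m.+1) : R :=
  4 / r ^+ 2 * complex.Im (\tr (ptP p *m ptZ p *m ptZ v)).

Section CoordinatesAtOrigin.
Context {R : realType} {m : nat}.
Notation mat := ('M[R[i]]_m.+2).
Notation amb := (ambient (R := R) m.+1).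
Implicit Types (A B : mat) (x y z : R) (f h : 'I_m -> R[i]).
Variable r : R.
Hypothesis r0 : r != 0.

Lemma Po_No : (Po : mat) *m No = delta_mx i0 i1.
Proof. by rewrite /Po /No mulmxDr mul_delta_mx mul_delta_mx_0 ?addr0 // i01. Qed.

Lemma tr_rscale (t : R) A : \tr (rscale t A) = (t +i* 0)%C * \tr A.
Proof. by rewrite /rscale mxtraceZ. Qed.

Lemma cx_at_o A : cx r (o_H m.+1 r) (at_o r A) = complex.Re (A i0 i1) - complex.Re (A i1 i0).
Proof.
rewrite cx.unlock ptP_at_o ptZ_o rscaleMl tr_rscale /No mulmxDl mxtraceD !tr_delta_mul.
rewrite !brk_PoE !idxE !(Re_mul, Re_add, Re_opp, Im_add, Im_mul, Im_opp) /=; field.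
exact: r0.
Qed.

Lemma cy_at_o A : cy r (o_H m.+1 r) (at_o r A) = 2 * complex.Im (A i1 i0).
Proof.
rewrite cy.unlock ptP_at_o ptZ_o ptP_o rscaleMr rscaleMl tr_rscale Po_No !tr_delta_mul.
rewrite !brk_PoE !idxE !(Re_mul, Re_add, Re_opp, Im_add, Im_mul, Im_opp) /=; field.
exact: r0.
Qed.

Lemma cz_at_o A : cz r (o_H m.+1 r) (at_o r A) = complex.Im (A i1 i1) - complex.Im (A i0 i0).
Proof.
rewrite cz.unlock ptZ_at_o ptZ_o ptP_o !(rscaleMl, rscaleMr) !tr_rscale Po_No !tr_delta_mul.
rewrite !brk_NoE !idxE !(Re_mul, Re_add, Re_opp, Im_add, Im_mul, Im_opp) /=; field.
exact: r0.
Qed.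

Lemma cx_mb x y z f h : cx r (o_H m.+1 r) (at_o r (mb x y z f h)) = x.
Proof. by rewrite cx_at_o !mbE /=; field. Qed.
Lemma cy_mb x y z f h : cy r (o_H m.+1 r) (at_o r (mb x y z f h)) = y.
Proof. by rewrite cy_at_o !mbE /=; field. Qed.
Lemma cz_mb x y z f h : cz r (o_H m.+1 r) (at_o r (mb x y z f h)) = z.
Proof. by rewrite cz_at_o !mbE /=; field. Qed.

End CoordinatesAtOrigin.

(** * The equations of T_r CP^n *)

Section TangentSpaces.
Context {R : realType} {m : nat}.
Notation mat := ('M[R[i]]_m.+2).
Notation amb := (ambient (R := R) m.+1).
Variable r : R.
Notation M := (TrCP (n := m.+1) r).
Notation o := (o_H m.+1 r).
Implicit Types (p q u v w : amb) (a A B : mat).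

Lemma TrCP_o : M o.
Proof.
exists 1%:M; first by split; [apply/unitarymxP; rewrite adj1 mulmx1|rewrite det1].
by rewrite actE ?gact1 // /unitary adj1 mulmx1.
Qed.

Lemma TrCP_orbit p : M p -> exists2 a, SU a & p = gact a o.
Proof. by move=> [a Sa <-]; exists a => //; rewrite actE //; exact: SU_unitary. Qed.

Lemma TrCP_act a p : unitary a -> M p -> M (gact a p).
Proof.
move=> ua /TrCP_orbit [b /SU_unitary ub ->].
have [c Sc cE] := unitary_act_SU (unitary_mul ua ub).
by exists c => //; rewrite (actE _ (SU_unitary Sc)) cE gact_mul.
Qed.

(** Equations of T_r CP^n: P is a Hermitian projector, Z is Hermitian and
    off-diagonal for P, and has a fixed length. *)
Definition point_eqs p : Prop :=
  [/\ (ptP p)^t* = ptP p, (ptZ p)^t* = ptZ p, ptP p *m ptP p = ptP p,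
      ptP p *m ptZ p + ptZ p *m ptP p = ptZ p &
      complex.Re (\tr (ptZ p *m ptZ p)) = complex.Re (\tr (ptZ o *m ptZ o))].

Lemma point_eqs_act a p : unitary a -> point_eqs p -> point_eqs (gact a p).
Proof.
move=> ua [aP aZ PP PZ ZZ].
rewrite /point_eqs !(gact_P, gact_Z).
split.
- by rewrite cj_adj aP.
- by rewrite cj_adj aZ.
- by rewrite -(cjM _ _ ua) PP.
- by rewrite -!(cjM _ _ ua) -cjD PZ.
- by rewrite -(cjM _ _ ua) (tr_cj _ ua).
Qed.

Lemma point_eqs_o : point_eqs o.
Proof.
rewrite /point_eqs !ptP_o !ptZ_o; split=> //.
- by rewrite /Po trmx_delta map_delta_mx.
- by rewrite rscale_adj; congr rscale; rewrite /No adjD !trmx_delta !map_delta_mx addrC.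
- by rewrite /Po mul_delta_mx.
- rewrite rscaleMl rscaleMr -rscaleDr; congr rscale.
  rewrite /Po /No mulmxDl mulmxDr !mul_delta_mx !mul_delta_mx_0 ?add0r ?addr0 ?i01 ?i10 //.
Qed.

Lemma point_eqs_TrCP p : M p -> point_eqs p.
Proof.
by move=> /TrCP_orbit [a /SU_unitary ua ->]; apply: point_eqs_act => //; exact: point_eqs_o.
Qed.

(** The same equations, linearised at p. *)
Definition tangent_eqs p v : Prop :=
  [/\ (ptP v)^t* = ptP v, (ptZ v)^t* = ptZ v,
      ptP v *m ptP p + ptP p *m ptP v - ptP v = 0,
      ptP v *m ptZ p + ptP p *m ptZ v + (ptZ v *m ptP p + ptZ p *m ptP v) - ptZ v = 0 &
      complex.Re (\tr (ptZ v *m ptZ p + ptZ p *m ptZ v)) = 0].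

Lemma tangent_eqs_act a p v : unitary a -> tangent_eqs p v ->
  tangent_eqs (gact a p) (gact a v).
Proof.
move=> ua [aP aZ e3 e4 e5].
rewrite /tangent_eqs !(gact_P, gact_Z).
have c0 : cj a 0 = 0 by rewrite cj.unlock mulmx0 mul0mx.
split.
- by rewrite cj_adj aP.
- by rewrite cj_adj aZ.
- by rewrite -!(cjM _ _ ua) -cjN -!cjD e3.
- by rewrite -!(cjM _ _ ua) -!cjD -cjN -cjD e4.
- by rewrite -!(cjM _ _ ua) -cjD (tr_cj _ ua).
Qed.

Lemma mderive_vanishing (F : amb -> mat) p v : msmooth F ->
  (forall q, M q -> F q = 0) -> tangent M p v -> mderive v F p = 0.
Proof.
move=> sF F0 tv; apply/matrixP => i j; rewrite !mxE; have [sR sI] := sF i j.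
rewrite (derive_vanishing sR _ tv); last by move=> q Mq; rewrite F0 // mxE.
by rewrite (derive_vanishing sI _ tv) // => q Mq; rewrite F0 // mxE.
Qed.

Lemma tangent_mono p v : tangent M p v -> M p.
Proof. by move=> [c [Mc <- _]]. Qed.

Section VectorField.
Variables (U U' : amb -> amb) (p w : amb).
Hypotheses (UU' : extends M U U') (tw : tangent M p w).
Hypothesis eqsU : forall q, M q -> tangent_eqs q (U q).
Let sU : smooth U' := UU'.1.
Let sP := @msmooth_ptP R m.+1 _ _ (@smooth_id R amb).
Let sZ := @msmooth_ptZ R m.+1 _ _ (@smooth_id R amb).
Let sUP := msmooth_ptP sU.
Let sUZ := msmooth_ptZ sU.
Let D := 'D_w U' p.
Let dP : mderive w (fun q => ptP q) p = ptP w.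
Proof. by rewrite (mderive_ptP _ _ (@smooth_id R amb)) derive_id. Qed.
Let dZ : mderive w (fun q => ptZ q) p = ptZ w.
Proof. by rewrite (mderive_ptZ _ _ (@smooth_id R amb)) derive_id. Qed.
Let dUP : mderive w (fun q => ptP (U' q)) p = ptP D := mderive_ptP w p sU.
Let dUZ : mderive w (fun q => ptZ (U' q)) p = ptZ D := mderive_ptZ w p sU.
Let Up : U' p = U p := UU'.2 p (tangent_mono tw).
Let eqsU' q : M q -> tangent_eqs q (U' q).
Proof. by move=> Mq; rewrite UU'.2 //; exact: eqsU. Qed.

Let regroup (S : zmodType) (b c d e : S) : b + c + (d + e) = b + e + (c + d).
Proof. by rewrite (addrC d) addrACA. Qed.

Let regroup2 (S : zmodType) (b c d e b' c' d' e' f : S) :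
  b + c + (d + e) + (b' + c' + (d' + e')) - f = 0 ->
  b + e + (b' + e') - f = - (c + d + (c' + d')).
Proof.
rewrite (regroup b) (regroup b') addrACA (addrAC (b + e + _)) => /eqP.
by rewrite addr_eq0 => /eqP.
Qed.

(** Differentiating the linearised equations along w leaves a term that is
    symmetric in w and U p. *)
Lemma tangent_eqs_derive :
  [/\ (ptP D)^t* = ptP D, (ptZ D)^t* = ptZ D,
      ptP D *m ptP p + ptP p *m ptP D - ptP D =
        - (ptP (U p) *m ptP w + ptP w *m ptP (U p)),
      ptP D *m ptZ p + ptP p *m ptZ D + (ptZ D *m ptP p + ptZ p *m ptP D) - ptZ D =
        - (ptP (U p) *m ptZ w + ptP w *m ptZ (U p)
           + (ptZ (U p) *m ptP w + ptZ w *m ptP (U p))) &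
      complex.Re (\tr (ptZ D *m ptZ p + ptZ p *m ptZ D)) =
        - complex.Re (\tr (ptZ (U p) *m ptZ w + ptZ w *m ptZ (U p)))].
Proof.
split.
- have := @mderive_vanishing (fun q => (ptP (U' q))^t* - ptP (U' q)) p w _ _ tw.
  rewrite mderiveD ?mderiveN ?mderive_adj ?dUP //; [|exact: msmooth_adj|exact: msmoothN].
  move=> h; apply/eqP; rewrite -subr_eq0; apply/eqP; apply: h.
    by apply: msmoothD; [exact: msmooth_adj|exact: msmoothN].
  by move=> q /eqsU' [-> *]; rewrite subrr.
- have := @mderive_vanishing (fun q => (ptZ (U' q))^t* - ptZ (U' q)) p w _ _ tw.
  rewrite mderiveD ?mderiveN ?mderive_adj ?dUZ //; [|exact: msmooth_adj|exact: msmoothN].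
  move=> h; apply/eqP; rewrite -subr_eq0; apply/eqP; apply: h.
    by apply: msmoothD; [exact: msmooth_adj|exact: msmoothN].
  by move=> q /eqsU' [_ -> *]; rewrite subrr.
- have s1 : msmooth (fun q => ptP (U' q) *m ptP q) by exact: msmoothM.
  have s2 : msmooth (fun q => ptP q *m ptP (U' q)) by exact: msmoothM.
  have s3 : msmooth (fun q => - ptP (U' q)) by exact: msmoothN.
  have := @mderive_vanishing
    (fun q => ptP (U' q) *m ptP q + ptP q *m ptP (U' q) - ptP (U' q)) p w _ _ tw.
  rewrite !mderiveD //; last exact: msmoothD.
  rewrite mderiveN // !mderiveM // dUP dP Up regroup addrAC => h.
  by apply/eqP; rewrite -addr_eq0; apply/eqP; apply: h => [|q /eqsU' []//];
    do !apply: msmoothD.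
- have s1 : msmooth (fun q => ptP (U' q) *m ptZ q) by exact: msmoothM.
  have s2 : msmooth (fun q => ptP q *m ptZ (U' q)) by exact: msmoothM.
  have s3 : msmooth (fun q => ptZ (U' q) *m ptP q) by exact: msmoothM.
  have s4 : msmooth (fun q => ptZ q *m ptP (U' q)) by exact: msmoothM.
  have s5 : msmooth (fun q => - ptZ (U' q)) by exact: msmoothN.
  have s12 := msmoothD s1 s2; have s34 := msmoothD s3 s4.
  have s1234 := msmoothD s12 s34; have s := msmoothD s1234 s5.
  have := mderive_vanishing s (fun q Mq => let: And5 _ _ _ e _ := eqsU' Mq in e) tw.
  rewrite (mderiveD _ _ s1234 s5) (mderiveD _ _ s12 s34) (mderiveD _ _ s1 s2) (mderiveD _ _ s3 s4).
  rewrite mderiveN // !mderiveM // dUP dUZ dZ dP Up.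
  exact: regroup2.
- have s1 : msmooth (fun q => ptZ (U' q) *m ptZ q) by exact: msmoothM.
  have s2 : msmooth (fun q => ptZ q *m ptZ (U' q)) by exact: msmoothM.
  have s := msmoothD s1 s2.
  have := derive_vanishing (smooth_Re_trace s)
    (fun q Mq => let: And5 _ _ _ _ e := eqsU' Mq in e) tw.
  rewrite derive_Re_trace // mderiveD // !mderiveM // dUZ dZ Up.
  by rewrite regroup (mxtraceD (_ + _) (_ + _)) Re_add => /eqP; rewrite addr_eq0 => /eqP.
Qed.

End VectorField.

Hypothesis r0 : r != 0.

Lemma tangent_eqs_TrCP p v : tangent M p v -> tangent_eqs p v.
Proof.
move=> tv; have Mp := tangent_mono tv.
have sid := @smooth_id R amb.
have sP := msmooth_ptP sid; have sZ := msmooth_ptZ sid.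
have dP : mderive v (fun q => ptP q) p = ptP v by rewrite (mderive_ptP _ _ sid) derive_id.
have dZ : mderive v (fun q => ptZ q) p = ptZ v by rewrite (mderive_ptZ _ _ sid) derive_id.
split.
- have s1 := msmooth_adj sP; have s2 := msmoothN sP.
  have := @mderive_vanishing _ p v (msmoothD s1 s2) _ tv.
  rewrite mderiveD // mderiveN // mderive_adj // dP => h.
  apply/eqP; rewrite -subr_eq0; apply/eqP; apply: h => q /point_eqs_TrCP [-> *].
  by rewrite subrr.
- have s1 := msmooth_adj sZ; have s2 := msmoothN sZ.
  have := @mderive_vanishing _ p v (msmoothD s1 s2) _ tv.
  rewrite mderiveD // mderiveN // mderive_adj // dZ => h.
  apply/eqP; rewrite -subr_eq0; apply/eqP; apply: h => q /point_eqs_TrCP [_ -> *].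
  by rewrite subrr.
- have s1 := msmoothM sP sP; have s2 := msmoothN sP.
  have := @mderive_vanishing _ p v (msmoothD s1 s2) _ tv.
  rewrite mderiveD // mderiveN // mderiveM // dP; apply=> q /point_eqs_TrCP [_ _ -> *].
  by rewrite subrr.
- have s1 := msmoothM sP sZ; have s2 := msmoothM sZ sP; have s3 := msmoothN sZ.
  have s12 := msmoothD s1 s2.
  have := @mderive_vanishing _ p v (msmoothD s12 s3) _ tv.
  rewrite (mderiveD _ _ s12 s3) mderiveD // mderiveN // !mderiveM // dP dZ; apply=> q.
  by case/point_eqs_TrCP => _ _ _ -> _; rewrite subrr.
- have s1 := msmoothM sZ sZ.
  pose c := complex.Re (\tr (ptZ o *m ptZ o)).
  have s2 : smooth (fun q : amb => complex.Re (\tr (ptZ q *m ptZ q)) + - c).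
    by apply: smooth_add; [exact: smooth_Re_trace|exact: smooth_cst].
  have := @derive_vanishing _ _ M _ _ p v s2 _ tv.
  rewrite (derive_add_smooth _ _ (smooth_Re_trace s1) (@smooth_cst _ _ _ (- c))).
  rewrite derive_cst addr0 derive_Re_trace // mderiveM // dZ; apply=> q.
  by case/point_eqs_TrCP => _ _ _ _ ->; rewrite subrr.
Qed.

End TangentSpaces.

(** * Tangent spaces *)

Section TangentAtOrigin.
Context {R : realType} {m : nat}.
Notation mat := ('M[R[i]]_m.+2).
Notation amb := (ambient (R := R) m.+1).
Variable r : R.
Hypothesis r0 : r != 0.
Notation M := (TrCP (n := m.+1) r).
Notation o := (o_H m.+1 r).
Implicit Types (p q u v w : amb) (a A B : mat).

Lemma tr_opp A : \tr (- A) = - \tr A.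
Proof. by rewrite -scaleN1r mxtraceZ mulN1r. Qed.

(** The linearised equations cut out exactly the fundamental vectors of
    n_bar + m_half + k_half: the coordinates are read off from the entries
    (1,2), (1,j), (2,j) of the two components of v. *)
Lemma tangent_eqs_o v : tangent_eqs o v ->
  exists x y z f h, v = at_o r (mb x y z f h).
Proof.
case=> aP aZ e3 e4 e5; pose c := - (r / 2).
have c0 : c != 0 by rewrite oppr_eq0 mulf_neq0 // invr_eq0 pnatr_eq0.
have hP i j : ptP v i j = Num.conj (ptP v j i) by rewrite -adjE aP.
have hZ i j : ptZ v i j = Num.conj (ptZ v j i) by rewrite -adjE aZ.
have E3 i j : ptP v i i0 * (j == i0)%:R + (i == i0)%:R * ptP v i0 j = ptP v i j.
  have /matrixP/(_ i j) := e3; rewrite ptP_o /Po !addmxE oppmxE mul_deltaE delta_mulE mxE.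
  by move/eqP; rewrite subr_eq0 => /eqP.
have E4 i j : (c +i* 0)%C * (ptP v i i0 * (j == i1)%:R + ptP v i i1 * (j == i0)%:R) +
    (i == i0)%:R * ptZ v i0 j + (ptZ v i i0 * (j == i0)%:R +
    (c +i* 0)%C * ((i == i0)%:R * ptP v i1 j + (i == i1)%:R * ptP v i0 j)) = ptZ v i j.
  have /matrixP/(_ i j) := e4.
  rewrite ptP_o ptZ_o -/c rscaleMl rscaleMr /Po /No mulmxDr mulmxDl.
  rewrite !addmxE oppmxE !rscaleE !addmxE !(mul_deltaE, delta_mulE) mxE.
  by move/eqP; rewrite subr_eq0 => /eqP.
have E5 : complex.Re (ptZ v i0 i1) + complex.Re (ptZ v i1 i0) = 0.
  move: e5; rewrite ptZ_o -/c rscaleMl rscaleMr -rscaleDr tr_rscale mxtraceD.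
  rewrite (mxtrace_mulC (ptZ v)) /No mulmxDl !mxtraceD !tr_delta_mul Re_mul /= mul0r subr0.
  move/eqP; rewrite mulf_eq0 (negPf c0) /= Re_add !Re_add -mulr2n mulrn_eq0 /= => /eqP e.
  by rewrite addrC.
have P00 : ptP v i0 i0 = 0.
  have := E3 i0 i0; rewrite !idxE mulr1 mul1r => /eqP.
  by rewrite -subr_eq0 addrK => /eqP.
have P11 : ptP v i1 i1 = 0 by rewrite -E3 !idxE mulr0 mul0r addr0.
have P1j k : ptP v i1 (jj k) = 0 by rewrite -E3 !idxE mulr0 mul0r addr0.
have Pj1 k : ptP v (jj k) i1 = 0 by rewrite -E3 !idxE mulr0 mul0r addr0.
have Pjj k l : ptP v (jj k) (jj l) = 0 by rewrite -E3 !idxE mulr0 mul0r addr0.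
have Z00 : ptZ v i0 i0 = - (c +i* 0)%C * (ptP v i0 i1 + ptP v i1 i0).
  have := E4 i0 i0; rewrite !idxE !(mulr0, mulr1, mul1r, mul0r, add0r, addr0) => e.
  have {e} : (c +i* 0)%C * ptP v i0 i1 + (ptZ v i0 i0 + (c +i* 0)%C * ptP v i1 i0) = 0.
    by apply: (addIr (ptZ v i0 i0)); rewrite add0r -{3}e; ring.
  by move=> e; apply: (addIr ((c +i* 0)%C * (ptP v i0 i1 + ptP v i1 i0)));
    rewrite mulNr addNr -e; ring.
have Z11 : ptZ v i1 i1 = (c +i* 0)%C * (ptP v i0 i1 + ptP v i1 i0).
  by rewrite -E4 !idxE !(mulr0, mulr1, mul1r, mul0r, add0r, addr0); ring.
have Z1j k : ptZ v i1 (jj k) = (c +i* 0)%C * ptP v i0 (jj k).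
  by rewrite -E4 !idxE !(mulr0, mulr1, mul1r, mul0r, add0r, addr0); ring.
have Zj1 k : ptZ v (jj k) i1 = (c +i* 0)%C * ptP v (jj k) i0.
  by rewrite -E4 !idxE !(mulr0, mulr1, mul1r, mul0r, add0r, addr0); ring.
have Zjj k l : ptZ v (jj k) (jj l) = 0 by rewrite -E4 !idxE !(mulr0, mulr1, mul1r, mul0r, add0r, addr0); ring.
pose x := - (2 * complex.Re (ptP v i0 i1)); pose y := - (2 * complex.Im (ptP v i0 i1)).
pose z := - (complex.Im (ptZ v i0 i1) / c).
pose f k := - ptP v i0 (jj k); pose h k := - ((c^-1) +i* 0)%C * ptZ v i0 (jj k).
have ReP10 : complex.Re (ptP v i1 i0) = complex.Re (ptP v i0 i1) by rewrite hP Re_conjc.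
have ImP10 : complex.Im (ptP v i1 i0) = - complex.Im (ptP v i0 i1) by rewrite hP Im_conjc.
have ReZ10 : complex.Re (ptZ v i1 i0) = complex.Re (ptZ v i0 i1) by rewrite hZ Re_conjc.
have ImZ10 : complex.Im (ptZ v i1 i0) = - complex.Im (ptZ v i0 i1) by rewrite hZ Im_conjc.
have ReZ01 : complex.Re (ptZ v i0 i1) = 0.
  by move: E5; rewrite ReZ10 -mulr2n => /eqP; rewrite mulrn_eq0 /= => /eqP.
exists x, y, z, f, h; apply: pt_inj.
- rewrite ptP_at_o; apply: mat_ext => *; rewrite brk_PoE !mbE !idxE ?(mulr0, mulr1, mul1r, mul0r, add0r, addr0, subr0, sub0r).
  + by rewrite P00; ring.
  + apply: complexP; rewrite ?(Re_add, Re_opp, Re_mul, Im_add, Im_opp, Im_mul) /=.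
      by rewrite /x; field.
    by rewrite /y; field.
  + apply: complexP; rewrite ?(Re_add, Re_opp, Re_mul, Im_add, Im_opp, Im_mul) /=.
      by rewrite ReP10 /x; field.
    by rewrite ImP10 /y; field.
  + by rewrite P11; ring.
  + by rewrite /f; ring.
  + by rewrite /f rmorphN opprK [LHS]hP; ring.
  + by rewrite P1j; ring.
  + by rewrite Pj1; ring.
  + by rewrite Pjj; ring.
- rewrite ptZ_at_o -/c; apply: mat_ext => *; rewrite rscaleE brk_NoE !mbE !idxE ?(mulr0, mulr1, mul1r, mul0r, add0r, addr0, subr0, sub0r).
  + rewrite Z00; apply: complexP; rewrite ?(Re_add, Re_opp, Re_mul, Im_add, Im_opp, Im_mul) /=.
      by rewrite ReP10 /x; field.
    by rewrite ImP10 /y; field.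
  + apply: complexP; rewrite ?(Re_add, Re_opp, Re_mul, Im_add, Im_opp, Im_mul) /=.
      by rewrite ReZ01; field.
    by rewrite /z; field.
  + apply: complexP; rewrite ?(Re_add, Re_opp, Re_mul, Im_add, Im_opp, Im_mul) /=.
      by rewrite ReZ10 ReZ01; field.
    by rewrite ImZ10 /z; field.
  + rewrite Z11; apply: complexP; rewrite ?(Re_add, Re_opp, Re_mul, Im_add, Im_opp, Im_mul) /=.
      by rewrite ReP10 /x; field.
    by rewrite ImP10 /y; field.
  + apply: complexP; rewrite ?(Re_add, Re_opp, Re_mul, Im_add, Im_opp, Im_mul) /=; field => //.
  + rewrite [LHS]hZ; apply: complexP;
      rewrite ?(Re_add, Re_opp, Re_mul, Im_add, Im_opp, Im_mul, Re_conjc, Im_conjc) /=; field => //.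
  + by rewrite Z1j /f; ring.
  + rewrite Zj1 (hP (jj _) i0) /f rmorphN opprK; ring.
  + by rewrite Zjj; ring.
Qed.

Lemma at_o_tangent x y z f h : tangent M o (at_o r (mb x y z f h)).
Proof.
rewrite at_oE; apply: fundamental_tangent; last exact: TrCP_o.
- by move=> a q ua Mq; exact: TrCP_act.
- exact: mb_skew.
Qed.

Lemma fund_tangent p A : M p -> skew A -> tangent M p (fund A p).
Proof.
by move=> Mp sA; apply: fundamental_tangent => // a q ua Mq; exact: TrCP_act.
Qed.

Lemma skew_cj a A : unitary a -> skew A -> skew (cj a A).
Proof. by move=> ua sA; rewrite /skew cj_adj sA cjN. Qed.

(** The equations are equivariant, so the solution at o_H gives the tangent space
    everywhere. *)
Lemma tangent_eqs_tangent p v : M p -> tangent_eqs p v -> tangent M p v.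
Proof.
move=> Mp tv; have [a /SU_unitary ua pE] := TrCP_orbit Mp; subst p.
have := tangent_eqs_act (unitary_adj ua) tv.
rewrite gact_adjK // => /tangent_eqs_o [x [y [z [f [h e]]]]].
have -> : v = fund (cj a (mb x y z f h)) (gact a o).
  by rewrite -gact_fund // -at_oE -e gact_adjVK.
by apply: fund_tangent => //; apply: skew_cj => //; exact: mb_skew.
Qed.

Lemma tangent_o v : tangent M o v -> exists x y z f h, v = at_o r (mb x y z f h).
Proof. by move=> /tangent_eqs_TrCP; exact: tangent_eqs_o. Qed.

Lemma tangent_gact a p v : unitary a -> tangent M p v -> tangent M (gact a p) (gact a v).
Proof.
move=> ua tv; have Mp := tangent_mono tv.
apply: tangent_eqs_tangent; first exact: TrCP_act.
exact: (tangent_eqs_act ua (tangent_eqs_TrCP tv)).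
Qed.

Let sub2 (x x' y y' : mat) : x - x' + (y - y') = x + y - (x' + y').
Proof. by rewrite opprD addrACA. Qed.

Let sub3 (x x' y y' : mat) : x - x' - (y - y') = x - y - (x' - y').
Proof. by rewrite (opprB y) (opprB x') addrACA [RHS]addrACA (addrC (- x')). Qed.

(** The symmetric terms of tangent_eqs_derive cancel in the bracket, which thus
    satisfies the linearised equations. *)
Lemma lie_bracket_tangent U W p : vector_field M U -> vector_field M W -> M p ->
  tangent M p (lie_bracket M U W p).
Proof.
move=> [tU [U' UU']] [tW [W' WW']] Mp; apply: (tangent_eqs_tangent Mp).
have eqsU q : M q -> tangent_eqs q (U q).
  by move=> Mq; apply: tangent_eqs_TrCP; exact: tU.
have eqsW q : M q -> tangent_eqs q (W q).
  by move=> Mq; apply: tangent_eqs_TrCP; exact: tW.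
have [a1 a2 a3 a4 a5] := tangent_eqs_derive WW' (tU p Mp) eqsW.
have [b1 b2 b3 b4 b5] := tangent_eqs_derive UU' (tW p Mp) eqsU.
rewrite /lie_bracket (der_eq WW' (tU p Mp)) (der_eq UU' (tW p Mp)).
move: a1 a2 a3 a4 a5 b1 b2 b3 b4 b5; move: ('D_(U p) W' p) ('D_(W p) U' p) => D D'.
move=> a1 a2 a3 a4 a5 b1 b2 b3 b4 b5.
rewrite /tangent_eqs (ptPD D) (ptZD D) (ptPN D') (ptZN D') !(adjD, adjN) a1 a2 b1 b2.
split=> //.
- move: a3 b3; move: (ptP D) (ptP D') (ptP p) (ptP (U p)) (ptP (W p)).
  move=> A A' P B B' a3 b3; rewrite mulmxBl mulmxBr sub2 sub3 a3 b3 opprK addrC.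
  by rewrite (addrC (B *m _)) subrr.
- move: a4 b4; move: (ptP D) (ptZ D) (ptP D') (ptZ D') (ptP p) (ptZ p).
  move: (ptP (U p)) (ptZ (U p)) (ptP (W p)) (ptZ (W p)) => B C B' C' A K A' K' P Z a4 b4.
  rewrite !mulmxBl !mulmxBr !sub2 sub3 a4 b4 opprK addrC.
  by rewrite (addrC (B *m _)) (addrC (C *m _)) subrr.
- move: a5 b5; move: (ptZ D) (ptZ D') (ptZ p) (ptZ (U p)) (ptZ (W p)).
  move=> A A' Z B B' a5 b5.
  rewrite mulmxBl mulmxBr sub2 mxtraceD tr_opp Re_add Re_opp a5 b5 opprK addrC.
  by rewrite (addrC (B *m _)) subrr.
Qed.

End TangentAtOrigin.

(** * An equivariant polynomial frame *)

Section PolynomialFrame.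
Context {R : realType} {m : nat}.
Notation mat := ('M[R[i]]_m.+2).
Notation amb := (ambient (R := R) m.+1).
Variable r : R.
Hypothesis r0 : r != 0.
Notation M := (TrCP (n := m.+1) r).
Notation o := (o_H m.+1 r).
Implicit Types (p q u v w : amb) (a A B : mat).

(** At o_H these are E_12, E_21, E_22 and the projector onto the remaining
    coordinates. *)
Definition pE12 p : mat := rscale (- (2 / r)) (ptP p *m ptZ p).
Definition pE21 p : mat := rscale (- (2 / r)) (ptZ p *m ptP p).
Definition pE22 p : mat := pE21 p *m pE12 p.
Definition pS p : mat := 1%:M - ptP p - pE22 p.

Definition pX p : mat := rscale (1 / 2) (pE12 p - pE21 p).
Definition pmu p : mat := rscale (1 / 2) ('i%C *: (pE12 p + pE21 p)).
Definition pnu p : mat := rscale (- (1 / 2)) ('i%C *: (ptP p - pE22 p)).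
Definition pn p x y z : mat := rscale x (pX p) + rscale y (pmu p) + rscale z (pnu p).

(** The rows of the m_half and k_half parts of a tangent vector v at p. *)
Definition pf p v : mat := - (ptP p *m ptP v *m pS p).
Definition ph p v : mat := rscale (2 / r) (pE21 p *m ptZ v *m pS p).

Section Equivariance.
Variables (a : mat) (ua : unitary a).

Lemma cj_rscale (t : R) A : cj a (rscale t A) = rscale t (cj a A).
Proof. exact: cjZ. Qed.

Lemma pE12_gact p : pE12 (gact a p) = cj a (pE12 p).
Proof. by rewrite /pE12 cj_rscale (cjM _ _ ua) gact_P gact_Z. Qed.
Lemma pE21_gact p : pE21 (gact a p) = cj a (pE21 p).
Proof. by rewrite /pE21 cj_rscale (cjM _ _ ua) gact_P gact_Z. Qed.
Lemma pE22_gact p : pE22 (gact a p) = cj a (pE22 p).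
Proof. by rewrite /pE22 (cjM _ _ ua) pE12_gact pE21_gact. Qed.
Lemma pS_gact p : pS (gact a p) = cj a (pS p).
Proof. by rewrite /pS !cjD !cjN (cj1 ua) gact_P pE22_gact. Qed.
Lemma pX_gact p : pX (gact a p) = cj a (pX p).
Proof. by rewrite /pX cj_rscale cjD cjN pE12_gact pE21_gact. Qed.
Lemma pmu_gact p : pmu (gact a p) = cj a (pmu p).
Proof. by rewrite /pmu cj_rscale cjZ cjD pE12_gact pE21_gact. Qed.
Lemma pnu_gact p : pnu (gact a p) = cj a (pnu p).
Proof. by rewrite /pnu cj_rscale cjZ cjD cjN gact_P pE22_gact. Qed.
Lemma pn_gact p x y z : pn (gact a p) x y z = cj a (pn p x y z).
Proof. by rewrite /pn pX_gact pmu_gact pnu_gact -!cj_rscale -!cjD. Qed.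
Lemma pf_gact p v : pf (gact a p) (gact a v) = cj a (pf p v).
Proof. by rewrite /pf cjN !(cjM _ _ ua) !gact_P pS_gact. Qed.
Lemma ph_gact p v : ph (gact a p) (gact a v) = cj a (ph p v).
Proof. by rewrite /ph cj_rscale !(cjM _ _ ua) gact_Z pS_gact pE21_gact. Qed.

Lemma cx_gact p v : cx r (gact a p) (gact a v) = cx r p v.
Proof. by rewrite cx.unlock gact_Z gact_P -(cjM _ _ ua) (tr_cj _ ua). Qed.
Lemma cy_gact p v : cy r (gact a p) (gact a v) = cy r p v.
Proof. by rewrite cy.unlock gact_Z !gact_P -!(cjM _ _ ua) (tr_cj _ ua). Qed.
Lemma cz_gact p v : cz r (gact a p) (gact a v) = cz r p v.
Proof. by rewrite cz.unlock !gact_Z gact_P -!(cjM _ _ ua) (tr_cj _ ua). Qed.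
End Equivariance.

Section Smoothness.
Variable U : amb -> amb.
Hypothesis sU : smooth U.
Let sP := @msmooth_ptP R m.+1 _ _ (@smooth_id R amb).
Let sZ := @msmooth_ptZ R m.+1 _ _ (@smooth_id R amb).

Lemma msmooth_rscale (c : R) (F : amb -> mat) : msmooth F -> msmooth (fun q => rscale c (F q)).
Proof. exact: msmoothZ. Qed.

Lemma msmooth_pE12 : msmooth pE12.
Proof. by apply: msmooth_rscale; exact: msmoothM. Qed.
Lemma msmooth_pE21 : msmooth pE21.
Proof. by apply: msmooth_rscale; exact: msmoothM. Qed.
Lemma msmooth_pE22 : msmooth pE22.
Proof. exact: msmoothM msmooth_pE21 msmooth_pE12. Qed.
Lemma msmooth_pS : msmooth pS.
Proof.
apply: msmoothD; last exact: msmoothN msmooth_pE22.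
by apply: msmoothD; [exact: msmooth_cst|exact: msmoothN].
Qed.
Lemma msmooth_pn (x y z : amb -> R) : smooth x -> smooth y -> smooth z ->
  msmooth (fun q => pn q (x q) (y q) (z q)).
Proof.
move=> sx sy sz; apply: msmoothD; first apply: msmoothD.
- apply: (msmooth_scale sx); apply: msmooth_rscale.
  exact: msmoothD msmooth_pE12 (msmoothN msmooth_pE21).
- apply: (msmooth_scale sy); apply: msmooth_rscale; apply: msmoothZ.
  exact: msmoothD msmooth_pE12 msmooth_pE21.
- apply: (msmooth_scale sz); apply: msmooth_rscale; apply: msmoothZ.
  exact: msmoothD sP (msmoothN msmooth_pE22).
Qed.
Lemma msmooth_pf : msmooth (fun q => pf q (U q)).
Proof.
apply: msmoothN; apply: msmoothM msmooth_pS; apply: msmoothM => //.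
exact: msmooth_ptP.
Qed.
Lemma msmooth_ph : msmooth (fun q => ph q (U q)).
Proof.
apply: msmooth_rscale; apply: msmoothM msmooth_pS; apply: msmoothM msmooth_pE21 _.
exact: msmooth_ptZ.
Qed.
Lemma smooth_cx : smooth (fun q => cx r q (U q)).
Proof.
rewrite cx.unlock.
apply: smooth_mul; first exact: smooth_cst.
by apply: smooth_Re_trace; apply: msmoothM => //; exact: msmooth_ptP.
Qed.
Lemma smooth_cy : smooth (fun q => cy r q (U q)).
Proof.
rewrite cy.unlock.
apply: smooth_mul; first exact: smooth_cst.
apply: smooth_Im_trace; apply: msmoothM; last exact: msmooth_ptP.
exact: msmoothM.
Qed.
Lemma smooth_cz : smooth (fun q => cz r q (U q)).
Proof.
rewrite cz.unlock.
apply: smooth_mul; first exact: smooth_cst.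
apply: smooth_Im_trace; apply: msmoothM; last exact: msmooth_ptZ.
exact: msmoothM.
Qed.
Lemma smooth_fund (F : amb -> mat) : msmooth F -> smooth (fun q => fund (F q) q).
Proof.
move=> sF; under eq_fun do rewrite fund.unlock.
by apply: smooth_pt; apply: msmoothD; do ?apply: msmoothN; exact: msmoothM.
Qed.
End Smoothness.

Section AtOrigin.

Lemma rV2 : - (2 / r) * - (r / 2) = 1.
Proof. by field. Qed.

Lemma pE12_o : pE12 o = delta_mx i0 i1.
Proof. by rewrite /pE12 ptP_o ptZ_o rscaleMr rscaleA rV2 rscale1 Po_No. Qed.
Lemma pE21_o : pE21 o = delta_mx i1 i0.
Proof.
rewrite /pE21 ptP_o ptZ_o rscaleMl rscaleA rV2 rscale1 /Po /No mulmxDl.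
by rewrite mul_delta_mx mul_delta_mx_0 ?add0r // i10.
Qed.
Lemma pE22_o : pE22 o = delta_mx i1 i1.
Proof. by rewrite /pE22 pE12_o pE21_o mul_delta_mx. Qed.

Lemma pX_o : pX o = vX m.+1.
Proof. by rewrite /pX pE12_o pE21_o. Qed.
Lemma pmu_o : pmu o = vmu m.+1.
Proof. by rewrite /pmu pE12_o pE21_o. Qed.
Lemma pnu_o : pnu o = vnu m.+1.
Proof. by rewrite /pnu pE22_o ptP_o. Qed.
Lemma pn_o x y z : pn o x y z = mb x y z (fun _ => 0) (fun _ => 0).
Proof. by rewrite -nvecE /pn pX_o pmu_o pnu_o. Qed.

Lemma mul_pS_o A i j : (A *m pS o) i j = A i j * (1 - (j == i0)%:R - (j == i1)%:R).
Proof.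
rewrite /pS pE22_o ptP_o /Po !mulmxBr mulmx1 addmxE addmxE !oppmxE !mul_deltaE.
have e (k : 'I_m.+2) : A i k * (j == k)%:R = A i j * (j == k)%:R.
  by case: eqP => [->//|_]; rewrite !mulr0.
by rewrite !e !mulrBr mulr1.
Qed.

Definition row_at (a : 'I_m.+2) (f : 'I_m -> R[i]) : mat := \matrix_(i, j)
  ((i == a)%:R * \sum_k (j == jj k)%:R * f k).

Lemma row_atE (c : 'I_m.+2) f i k : row_at c f i (jj k) = (i == c)%:R * f k.
Proof. by rewrite mxE sum_jj. Qed.
Lemma row_at0 (c : 'I_m.+2) f i : row_at c f i i0 = 0.
Proof. by rewrite mxE sum_j0 ?mulr0 // => k; rewrite idxE. Qed.
Lemma row_at1 (c : 'I_m.+2) f i : row_at c f i i1 = 0.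
Proof. by rewrite mxE sum_j0 ?mulr0 // => k; rewrite idxE. Qed.

Lemma pf_o x y z f h : pf o (at_o r (mb x y z f h)) = row_at i0 f.
Proof.
apply/matrixP => i j; rewrite /pf. rewrite at_oE fund_P ptP_o oppmxE mul_pS_o.
rewrite [X in (X *m _) i j]/Po delta_mulE brk_PoE.
case: (indexP j) => [||k]; rewrite ?(row_at0, row_at1, row_atE) !idxE.
- by rewrite subrr sub0r oppr0 mulr0 oppr0.
- by rewrite subr0 subrr mulr0 oppr0.
- by rewrite !mbE mulr0 sub0r mul1r !subr0 mulr1 mulrN opprK.
Qed.

Lemma ph_o x y z f h : ph o (at_o r (mb x y z f h)) = row_at i1 h.
Proof.
apply/matrixP => i j; rewrite /ph at_oE fund_Z ptZ_o brkZr rscaleE mul_pS_o pE21_o.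
rewrite delta_mulE rscaleE brk_NoE.
case: (indexP j) => [||k]; rewrite ?(row_at0, row_at1, row_atE) !idxE.
- by rewrite subrr sub0r oppr0 !mulr0.
- by rewrite subr0 subrr !mulr0.
- rewrite !mbE.
  have c : ((2 / r) +i* 0)%C * ((- (r / 2)) +i* 0)%C = -1 :> R[i].
    by apply: complexP; rewrite ?(Re_mul, Im_mul, Re_opp, Im_opp) /=; field.
  rewrite mulr0 add0r mulr0 mul1r mul0r addr0 sub0r !subr0 mulr1.
  by rewrite mulrCA (mulrA (2 / r +i* 0)%C) c mulN1r opprK.
Qed.

Lemma tr_row_at (a : 'I_m.+2) f f' : \tr (row_at a f *m (row_at a f') ^t*) = \sum_k f k * Num.conj (f' k).
Proof.
rewrite tr_mul_index (bigD1 a) //= [X in _ + X]big1 => [|i /negPf ia]; last first.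
  by rewrite big1 // => j _; rewrite mxE ia !mul0r.
rewrite addr0 sum_index row_at0 row_at1 !mul0r !add0r; apply: eq_bigr => k _.
by rewrite adjE !row_atE eqxx !mul1r.
Qed.

Lemma row_at_mul (a b : 'I_m.+2) f : delta_mx a b *m row_at b f = row_at a f.
Proof.
apply/matrixP => i j; rewrite delta_mulE.
by case: (indexP j) => [||k]; rewrite ?(row_at0, row_at1, row_atE) ?mulr0 // eqxx mul1r.
Qed.

Lemma row_atZ (a : 'I_m.+2) (c : R[i]) f : c *: row_at a f = row_at a (fun k => c * f k).
Proof.
apply/matrixP => i j; rewrite mxE.
by case: (indexP j) => [||k]; rewrite ?(row_at0, row_at1, row_atE) ?mulr0 // mulrCA.
Qed.

Lemma row_atD (a : 'I_m.+2) f f' : row_at a f + row_at a f' = row_at a (fun k => f k + f' k).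
Proof.
apply/matrixP => i j; rewrite addmxE.
by case: (indexP j) => [||k]; rewrite ?(row_at0, row_at1, row_atE) ?addr0 // mulrDr.
Qed.

Lemma mb_rows x y z f h : pn o x y z + (row_at i0 f - (row_at i0 f) ^t*)
  + (row_at i1 h - (row_at i1 h) ^t*) = mb x y z f h.
Proof.
by rewrite pn_o; apply: mat_ext => *; rewrite !(addmxE, oppmxE) !adjE !mbE
  ?(row_at0, row_at1, row_atE) ?idxE
  ?(mul0r, mul1r, rmorph0, oppr0, subr0, addr0, add0r, sub0r).
Qed.

End AtOrigin.
End PolynomialFrame.

(** * Invariant forms and their exterior derivatives *)

Section ContactForm.
Context {R : realType} {m : nat}.
Notation mat := ('M[R[i]]_m.+2).
Notation amb := (ambient (R := R) m.+1).
Variable r : R.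
Hypothesis r0 : r != 0.
Notation M := (TrCP (n := m.+1) r).
Notation o := (o_H m.+1 r).
Implicit Types (p q u v w : amb) (a A B : mat) (x y z : R) (f h : 'I_m -> R[i]).

Definition herm (g g' : 'I_m -> R[i]) : R[i] := \sum_k g k * Num.conj (g' k).

Lemma hermC g g' : herm g' g = Num.conj (herm g g').
Proof.
by rewrite rmorph_sum; apply: eq_bigr => k _; rewrite rmorphM /= conjCK mulrC.
Qed.

Section Brackets.
Variables (x y z x' y' z' : R) (f h f' h' : 'I_m -> R[i]).
Let A : mat := mb x y z f h.
Let B : mat := mb x' y' z' f' h'.

Lemma mul_mb00 : (A *m B) i0 i0 = A i0 i0 * B i0 i0 + A i0 i1 * B i1 i0 - herm f f'.
Proof.
rewrite mxE sum_index -[in RHS]sumrN; congr (_ + _).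
by apply: eq_bigr => k _; rewrite /A /B !mbE mulrN.
Qed.
Lemma mul_mb01 : (A *m B) i0 i1 = A i0 i0 * B i0 i1 + A i0 i1 * B i1 i1 - herm f h'.
Proof.
rewrite mxE sum_index -[in RHS]sumrN; congr (_ + _).
by apply: eq_bigr => k _; rewrite /A /B !mbE mulrN.
Qed.
Lemma mul_mb10 : (A *m B) i1 i0 = A i1 i0 * B i0 i0 + A i1 i1 * B i1 i0 - herm h f'.
Proof.
rewrite mxE sum_index -[in RHS]sumrN; congr (_ + _).
by apply: eq_bigr => k _; rewrite /A /B !mbE mulrN.
Qed.
Lemma mul_mb11 : (A *m B) i1 i1 = A i1 i0 * B i0 i1 + A i1 i1 * B i1 i1 - herm h h'.
Proof.
rewrite mxE sum_index -[in RHS]sumrN; congr (_ + _).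
by apply: eq_bigr => k _; rewrite /A /B !mbE mulrN.
Qed.
End Brackets.

Section BracketCoordinates.
Variables (x y z x' y' z' : R) (f h f' h' : 'I_m -> R[i]).
Let C : mat := brk (mb x y z f h) (mb x' y' z' f' h').

Lemma brk_cx : complex.Re (C i0 i1) - complex.Re (C i1 i0) =
  - (y * z' - z * y') - 2 * (complex.Re (herm f h') - complex.Re (herm f' h)).
Proof.
rewrite /C /brk !addmxE !oppmxE !(mul_mb01, mul_mb10) !mbE.
rewrite (hermC f' h) (hermC f h').
rewrite ?(Re_add, Im_add, Re_opp, Im_opp, Re_mul, Im_mul, Re_conjc, Im_conjc) /=.
by field.
Qed.

Lemma brk_cy : 2 * complex.Im (C i1 i0) =
  (x * z' - z * x') - 2 * (complex.Im (herm f h') - complex.Im (herm f' h)).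
Proof.
rewrite /C /brk !addmxE !oppmxE !(mul_mb01, mul_mb10) !mbE.
rewrite (hermC f' h) (hermC f h').
rewrite ?(Re_add, Im_add, Re_opp, Im_opp, Re_mul, Im_mul, Re_conjc, Im_conjc) /=.
by field.
Qed.

Lemma brk_cz : complex.Im (C i1 i1) - complex.Im (C i0 i0) =
  - (x * y' - y * x') + 2 * (complex.Im (herm f f') - complex.Im (herm h h')).
Proof.
rewrite /C /brk !addmxE !oppmxE !(mul_mb00, mul_mb11) !mbE.
rewrite (hermC f f') (hermC h h').
rewrite ?(Re_add, Im_add, Re_opp, Im_opp, Re_mul, Im_mul, Re_conjc, Im_conjc) /=.
by field.
Qed.
End BracketCoordinates.

(** The form eta = e1 x + e2 y + e3 z on n_bar, extended invariantly. *)
Variables e1 e2 e3 : R.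

Definition eta_poly p v : R := e1 * cx r p v + e2 * cy r p v + e3 * cz r p v.

(** The derivative along u of the coefficients of the polynomial form. *)
Definition deta_half p u w : R :=
  e1 * (2 / r * complex.Re (\tr (ptZ u *m ptP w)))
  + e2 * (- (4 / r) *
      complex.Im (\tr ((ptP u *m ptZ p + ptP p *m ptZ u) *m ptP w)))
  + e3 * (4 / r ^+ 2 *
      complex.Im (\tr ((ptP u *m ptZ p + ptP p *m ptZ u) *m ptZ w))).

Definition deta p u w : R := (deta_half p u w - deta_half p w u) / 2.

Lemma derive_eta_poly (W : amb -> amb) p u : smooth W ->
  'D_u (fun q => eta_poly q (W q)) p = deta_half p u (W p) + eta_poly p ('D_u W p).
Proof.
move=> sW; have sid := @smooth_id R amb.
have sP := msmooth_ptP sid; have sZ := msmooth_ptZ sid.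
have sWP := msmooth_ptP sW; have sWZ := msmooth_ptZ sW.
have dP : mderive u (fun q => ptP q) p = ptP u by rewrite (mderive_ptP _ _ sid) derive_id.
have dZ : mderive u (fun q => ptZ q) p = ptZ u by rewrite (mderive_ptZ _ _ sid) derive_id.
have dWP := mderive_ptP u p sW; have dWZ := mderive_ptZ u p sW.
have sPZ := msmoothM sP sZ.
have scx := smooth_cx r sW; have scy := smooth_cy r sW; have scz := smooth_cz r sW.
have smulc (c : R) (k : amb -> R) : smooth k -> smooth (fun q => c * k q).
  by move=> sk; apply: smooth_mul => //; exact: smooth_cst.
have dmulc (c : R) (k : amb -> R) : smooth k ->
    'D_u (fun q => c * k q) p = c * 'D_u k p.
  move=> sk; rewrite derive_mul_smooth ?derive_cst ?mul0r ?add0r //; exact: smooth_cst.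
rewrite /eta_poly derive_add_smooth; [|by apply: smooth_add; exact: smulc|exact: smulc].
rewrite derive_add_smooth; [|exact: smulc..].
rewrite (dmulc e1 _ scx) (dmulc e2 _ scy) (dmulc e3 _ scz).
have s1 := msmoothM sZ sWP; have s2 := msmoothM sPZ sWP; have s3 := msmoothM sPZ sWZ.
rewrite cx.unlock cy.unlock cz.unlock (dmulc _ _ (smooth_Re_trace s1)) (dmulc _ _ (smooth_Im_trace s2)).
rewrite (dmulc _ _ (smooth_Im_trace s3)) (derive_Re_trace _ _ s1) (derive_Im_trace _ _ s2).
rewrite (derive_Im_trace _ _ s3) (mderiveM _ _ sZ sWP) (mderiveM _ _ sPZ sWP).
rewrite (mderiveM _ _ sPZ sWZ) (mderiveM _ _ sP sZ) dP dZ dWP dWZ.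
rewrite (mxtraceD (ptZ u *m _)) !(mxtraceD (_ *m ptP (W p))) (mxtraceD (_ *m ptZ (W p))).
rewrite !(Re_add, Im_add) /deta_half; ring.
Qed.

Lemma eta_polyD p u v : eta_poly p (u + v) = eta_poly p u + eta_poly p v.
Proof.
rewrite /eta_poly cx.unlock cy.unlock cz.unlock ptPD ptZD !mulmxDr !mxtraceD !(Re_add, Im_add); ring.
Qed.

Lemma eta_polyN p u : eta_poly p (- u) = - eta_poly p u.
Proof.
rewrite /eta_poly cx.unlock cy.unlock cz.unlock ptPN ptZN !mulmxN !tr_opp !(Re_opp, Im_opp); ring.
Qed.

(** The terms with derivatives of U and W cancel because the Lie bracket is
    tangent, so that eta may be evaluated on it. *)
Lemma ext_der_deta (eta : amb -> amb -> R) U W p :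
  (forall q v, tangent M q v -> eta q v = eta_poly q v) ->
  vector_field M U -> vector_field M W -> M p ->
  ext_der M eta U W p = deta p (U p) (W p).
Proof.
move=> etaE vU vW Mp; have tb := lie_bracket_tangent r0 vU vW Mp.
case: (vU) (vW) => tU [U' UU'] [tW [W' WW']].
have sU := UU'.1; have sW := WW'.1.
have ex (X X' : amb -> amb) : (forall q, M q -> tangent M q (X q)) ->
    extends M X X' -> extends M (fun q => eta q (X q)) (fun q => eta_poly q (X' q)).
  move=> tX [sX XX']; split=> [|q Mq]; last by rewrite XX' // etaE //; exact: tX.
  apply: smooth_add; first apply: smooth_add; apply: smooth_mul; try exact: smooth_cst.
  + exact: smooth_cx.
  + exact: smooth_cy.
  + exact: smooth_cz.
rewrite /ext_der (etaE _ _ tb) (der_eq (ex _ _ tW WW') (tU p Mp)).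
rewrite (der_eq (ex _ _ tU UU') (tW p Mp)) !derive_eta_poly //.
rewrite /lie_bracket (der_eq WW' (tU p Mp)) (der_eq UU' (tW p Mp)).
rewrite (eta_polyD p ('D_(U p) W' p)) eta_polyN (UU'.2 p Mp) (WW'.2 p Mp) /deta.
have alg (b c d e : R) : b + c - (d + e) - (c - e) = b - d by ring.
by rewrite alg.
Qed.

Lemma deta_gact a p u w : unitary a -> deta (gact a p) (gact a u) (gact a w) = deta p u w.
Proof.
move=> ua; rewrite /deta /deta_half !gact_P !gact_Z.
by rewrite -!(cjM _ _ ua) -!cjD -!(cjM _ _ ua) !(tr_cj _ ua).
Qed.

Lemma eta_poly_gact a p v : unitary a -> eta_poly (gact a p) (gact a v) = eta_poly p v.
Proof. by move=> ua; rewrite /eta_poly cx_gact // cy_gact // cz_gact. Qed.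

Lemma tr_brk A B K : \tr (brk A B *m K) = - \tr (B *m brk A K).
Proof.
rewrite /brk mulmxBl mulmxBr !mxtraceD !tr_opp opprB !mulmxA.
by rewrite (mxtrace_mulC (B *m K)) mulmxA.
Qed.

Lemma brkM A B K : brk A (B *m K) = brk A B *m K + B *m brk A K.
Proof. by rewrite /brk mulmxBl mulmxBr !mulmxA addrA subrK. Qed.

(** Invariance of the trace form, in infinitesimal form. *)
Lemma deta_half_fund A p v : deta_half p (fund A p) v = - eta_poly p (fund A v).
Proof.
rewrite /deta_half /eta_poly cx.unlock cy.unlock cz.unlock !fund_P !fund_Z -!brkM !tr_brk !(Re_opp, Im_opp).
by rewrite !mulrN -!opprD.
Qed.

Lemma brk_brk A B K : brk A (brk B K) - brk B (brk A K) = brk (brk A B) K.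
Proof.
have L (S : zmodType) (b c d e : S) : b - c - (d - e) = b + e - (c + d).
  by rewrite (opprB d) addrACA -opprD.
have J (S : zmodType) (b c d e f g : S) :
    b - c - (d - e) - (f - d - (c - g)) = b - f - (g - e).
  rewrite (L S b c d e) (L S f d c g) (L S b f g e) (opprB (f + g)) (addrC d c).
  by rewrite addrA subrK.
by rewrite /brk !(mulmxBl, mulmxBr) !mulmxA J.
Qed.

Lemma fund_brk A B p : fund A (fund B p) - fund B (fund A p) = fund (brk A B) p.
Proof.
apply: pt_inj.
- by rewrite ptPD ptPN !fund_P brk_brk.
- by rewrite ptZD ptZN !fund_Z brk_brk.
Qed.

(** By invariance, differentiating eta along fundamental fields amounts to taking
    brackets, and the Jacobi identity combines them into one. *)
Lemma deta_fund A B p :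
  deta p (fund A p) (fund B p) = - (eta_poly p (fund (brk A B) p) / 2).
Proof.
by rewrite /deta !deta_half_fund -fund_brk eta_polyD eta_polyN -opprD mulNr.
Qed.

Lemma deta_o x y z f h x' y' z' f' h' :
  deta o (at_o r (mb x y z f h)) (at_o r (mb x' y' z' f' h')) =
  (e1 * (y * z' - z * y') - e2 * (x * z' - z * x') + e3 * (x * y' - y * x')) / 2
  + e1 * (complex.Re (herm f h') - complex.Re (herm f' h))
  + e2 * (complex.Im (herm f h') - complex.Im (herm f' h))
  - e3 * (complex.Im (herm f f') - complex.Im (herm h h')).
Proof.
rewrite !at_oE deta_fund /eta_poly -at_oE cx_at_o // cy_at_o // cz_at_o //.
by rewrite brk_cx brk_cy brk_cz; field.
Qed.

End ContactForm.

(** * The contact equations and their solutions *)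

Section ContactTypes.
Context {R : realType}.
Variable n : nat.
Implicit Types p u s v w t c x y z a b k q al e : R.

(** The coordinates of xi in the basis X, mu, nu, followed by the values of the
    inner product in the order (X,X), (mu,mu), (nu,nu), (X,mu), (X,nu),
    (mu,nu). *)
Record pair_data := PairData {
  xi_X : R; xi_mu : R; xi_nu : R;
  in_XX : R; in_mumu : R; in_nunu : R; in_Xmu : R; in_Xnu : R; in_munu : R }.

(** L = [[p,0,0],[u,s,0],[v,w,t]] is the Cholesky factor of the inner product on
    n_bar in the basis X, mu, nu: its Gram matrix is L L^T, the rows of the
    inverse of L are the adapted basis, and L c is the covector dual to
    xi = c1 xi_1 + c2 xi_2 + c3 xi_3. The contact condition makes xi and its
    dual covector proportional, with factor 2 det L. *)
Definition cholesky_data p u s v w t c1 c2 c3 : pair_data :=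
  PairData (p * c1 / (2 * (p * s * t))) ((u * c1 + s * c2) / (2 * (p * s * t)))
    ((v * c1 + w * c2 + t * c3) / (2 * (p * s * t)))
    (p ^+ 2) (u ^+ 2 + s ^+ 2) (v ^+ 2 + w ^+ 2 + t ^+ 2)
    (p * u) (p * v) (u * v + s * w).

(** L^T L c = 2 (det L) c. *)
Definition contact_eqs p u s v w t c1 c2 c3 : Prop :=
  [/\ p * (p * c1) + u * (u * c1 + s * c2) + v * (v * c1 + w * c2 + t * c3)
        = 2 * (p * s * t) * c1,
      s * (u * c1 + s * c2) + w * (v * c1 + w * c2 + t * c3) = 2 * (p * s * t) * c2 &
      t * (v * c1 + w * c2 + t * c3) = 2 * (p * s * t) * c3].

Definition half_eqs p s t c3 a b : Prop :=
  (1 < n)%N -> 8 * (a * b) = p * s * t /\ (c3 != 0 -> a = b).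

Definition realizes c1 c2 c3 (D : pair_data) a b : Prop :=
  exists p u s v w t,
    [/\ [/\ 0 < p, 0 < s & 0 < t], contact_eqs p u s v w t c1 c2 c3,
        D = cholesky_data p u s v w t c1 c2 c3 & half_eqs p s t c3 a b].

Definition half_values a b a' b' : Prop := (1 < n)%N -> a = a' /\ b = b'.

Lemma sign_sqr e : e = 1 \/ e = -1 -> e ^+ 2 = 1 /\ e != 0.
Proof. by move=> [] ->; rewrite ?sqrrN expr1n ?oppr_eq0 oner_eq0. Qed.

Lemma mulf_cancel x y z : x != 0 -> x * y = x * z -> y = z.
Proof. by move=> x0 e; apply: (mulfI x0). Qed.

Lemma contact_eq3 p u s v w t c1 c2 c3 : 0 < t -> contact_eqs p u s v w t c1 c2 c3 ->
  v * c1 + w * c2 + t * c3 = 2 * (p * s) * c3.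
Proof.
by move=> t0 [_ _ E3]; apply: (mulf_cancel (lt0r_neq0 t0)); rewrite E3; ring.
Qed.

Section Types.
Variables (D : pair_data) (a b : R).
Hypotheses (a_gt0 : 0 < a) (b_gt0 : 0 < b).
Let a_neq0 : a != 0 := lt0r_neq0 a_gt0.

(** For c = (e, 0, 0) the equations force u = v = 0 and p = 2 s t. The parameters
    are kappa = p, q = p / (2 s^2), alpha = s w and q' = kappa / (4 a). *)
Lemma realized_AI : (exists2 e, e = 1 \/ e = -1 & realizes e 0 0 D a b) <->
  exists e k q q' al, [/\ e = 1 \/ e = -1, 0 < k, 0 < q & 0 < q'] /\
    (D = PairData (e * (1 / k)) 0 0 (k ^+ 2) (k / (2 * q))
      (q / (2 * k) * (4 * al ^+ 2 + k ^+ 2)) 0 0 al /\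
    half_values a b (k / (4 * q')) (k * q' / 4)).
Proof.
split=> [[e he [p [u [s [v [w [t [[p0 s0 t0] E -> hab]]]]]]]]|].
  have [e2 e0] := sign_sqr he; have E3 := contact_eq3 t0 E; case: E => E1 E2 _.
  have p1 := lt0r_neq0 p0; have s1 := lt0r_neq0 s0; have t1 := lt0r_neq0 t0.
  have v0 : v = 0 by apply: (mulIf e0); rewrite mul0r; lra.
  have u0 : u = 0.
    by apply: (mulf_cancel s1); apply: (mulIf e0); rewrite v0 in E2; lra.
  rewrite u0 v0 in E1 *.
  have pE : p = 2 * (s * t).
    by apply: (mulf_cancel p1); apply: (mulIf e0); lra.
  exists e, p, (p / (2 * s ^+ 2)), (p / (4 * a)), (s * w); split.
    by split; rewrite // divr_gt0 // mulr_gt0 // exprn_gt0.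
  split; first by rewrite pE /cholesky_data; congr PairData; field; rewrite ?s1 ?t1.
  move=> n1; have [ab _] := hab n1; split; first by field; rewrite p1 a_neq0.
  apply: (mulf_cancel a_neq0); have -> : a * b = p * s * t / 8 by lra.
  by rewrite [in LHS]pE pE; field.
move=> [e [k [q [q' [al [[he k0 q0 q'0] [-> hab]]]]]]].
have [e2 e0] := sign_sqr he.
have k1 := lt0r_neq0 k0; have q1 := lt0r_neq0 q0; have q'1 := lt0r_neq0 q'0.
exists e => //; pose s := Num.sqrt (k / (2 * q)).
have s2 : s ^+ 2 = k / (2 * q) by rewrite sqr_sqrtr // divr_ge0 ?mulr_ge0 // ltW.
have s0 : 0 < s by rewrite sqrtr_gt0 divr_gt0 // mulr_gt0.
have s1 := lt0r_neq0 s0.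
exists k, 0, s, 0, (al / s), (k / (2 * s)); split.
- by split; rewrite // divr_gt0 // mulr_gt0.
- by split; field.
- rewrite /cholesky_data; congr PairData; rewrite ?expr_div_n; try (by field; rewrite ?s1 ?k1).
  + by rewrite expr0n add0r s2.
  + by rewrite exprMn s2 expr0n /= add0r; field; rewrite ?q1 ?k1.
- move=> n1; have [-> ->] := hab n1; split; first by field; rewrite q'1 s1.
  by rewrite eqxx.
Qed.

(** For c = (0, e, 0) they force u = w = 0 and s = 2 p t. *)
Lemma realized_AII : (exists2 e, e = 1 \/ e = -1 & realizes 0 e 0 D a b) <->
  exists e k q q' al, [/\ e = 1 \/ e = -1, 0 < k, 0 < q & 0 < q'] /\
    (D = PairData 0 (e * (1 / k)) 0 (k / (2 * q)) (k ^+ 2)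
      (q / (2 * k) * (4 * al ^+ 2 + k ^+ 2)) 0 al 0 /\
    half_values a b (k / (4 * q')) (k * q' / 4)).
Proof.
split=> [[e he [p [u [s [v [w [t [[p0 s0 t0] E -> hab]]]]]]]]|].
  have [e2 e0] := sign_sqr he; have E3 := contact_eq3 t0 E; case: E => E1 E2 _.
  have p1 := lt0r_neq0 p0; have s1 := lt0r_neq0 s0; have t1 := lt0r_neq0 t0.
  have w0 : w = 0 by apply: (mulIf e0); rewrite mul0r; lra.
  have u0 : u = 0.
    by apply: (mulf_cancel s1); apply: (mulIf e0); rewrite w0 in E1; lra.
  rewrite u0 w0 in E2 *.
  have sE : s = 2 * (p * t).
    by apply: (mulf_cancel s1); apply: (mulIf e0); lra.
  exists e, s, (s / (2 * p ^+ 2)), (s / (4 * a)), (p * v); split.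
    by split; rewrite // divr_gt0 // mulr_gt0 // exprn_gt0.
  split; first by rewrite sE /cholesky_data; congr PairData; field; rewrite ?p1 ?t1.
  move=> n1; have [ab _] := hab n1; split; first by field; rewrite s1 a_neq0.
  apply: (mulf_cancel a_neq0); have -> : a * b = p * s * t / 8 by lra.
  by rewrite [in LHS]sE sE; field.
move=> [e [k [q [q' [al [[he k0 q0 q'0] [-> hab]]]]]]].
have [e2 e0] := sign_sqr he.
have k1 := lt0r_neq0 k0; have q1 := lt0r_neq0 q0; have q'1 := lt0r_neq0 q'0.
exists e => //; pose p := Num.sqrt (k / (2 * q)).
have p2 : p ^+ 2 = k / (2 * q) by rewrite sqr_sqrtr // divr_ge0 ?mulr_ge0 // ltW.
have p0 : 0 < p by rewrite sqrtr_gt0 divr_gt0 // mulr_gt0.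
have p1 := lt0r_neq0 p0.
exists p, 0, k, (al / p), 0, (k / (2 * p)); split.
- by split; rewrite // divr_gt0 // mulr_gt0.
- by split; field.
- rewrite /cholesky_data; congr PairData; rewrite ?expr_div_n ?p2; try (by field; rewrite ?p1 ?k1).
  by rewrite exprMn p2 expr0n /= addr0; field; rewrite ?q1 ?k1.
- move=> n1; have [-> ->] := hab n1; split; first by field; rewrite q'1 p1.
  by rewrite eqxx.
Qed.

(** When c3 <> 0 both a and b are the positive root of 8 h^2 = det L. *)
Lemma half_equal p s t c3 h : c3 != 0 -> 0 < h -> 8 * h ^+ 2 = p * s * t ->
  half_eqs p s t c3 a b <-> half_values a b h h.
Proof.
move=> c30 h0 hE; split=> H n1; have [e1 e2] := H n1.
  have e := e2 c30; rewrite -e in e1 *.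
  suff -> : a = h by [].
  by apply/eqP; rewrite -(@eqrXn2 _ 2) ?ltW //; apply/eqP; lra.
by rewrite e1 e2 -hE; split=> //; ring.
Qed.

(** For c = (0, 0, e) they force v = w = 0 and t = 2 p s. *)
Lemma realized_AIII : (exists2 e, e = 1 \/ e = -1 & realizes 0 0 e D a b) <->
  exists e k q al, [/\ e = 1 \/ e = -1, 0 < k & 0 < q] /\
    (D = PairData 0 0 (e * (1 / k)) (k / (2 * q))
      (q / (2 * k) * (4 * al ^+ 2 + k ^+ 2)) (k ^+ 2) al 0 0 /\
    half_values a b (k / 4) (k / 4)).
Proof.
split=> [[e he [p [u [s [v [w [t [[p0 s0 t0] E -> hab]]]]]]]]|].
  have [e2 e0] := sign_sqr he; have E3 := contact_eq3 t0 E; case: E => E1 E2 _.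
  have p1 := lt0r_neq0 p0; have s1 := lt0r_neq0 s0; have t1 := lt0r_neq0 t0.
  have tE : t = 2 * (p * s) by apply: (mulIf e0); lra.
  have w0 : w = 0 by apply: (mulf_cancel t1); apply: (mulIf e0); lra.
  have v0 : v = 0 by apply: (mulf_cancel t1); apply: (mulIf e0); lra.
  exists e, t, (t / (2 * p ^+ 2)), (p * u); split.
    by split; rewrite // divr_gt0 // mulr_gt0 // exprn_gt0.
  split.
    by rewrite v0 w0 tE /cholesky_data; congr PairData; field; rewrite ?p1 ?s1.
  by apply/(half_equal (p := p) (s := s) (t := t) e0) => //;
    [rewrite divr_gt0|rewrite tE; field].
move=> [e [k [q [al [[he k0 q0] [-> hab]]]]]].
have [e2 e0] := sign_sqr he.
have k1 := lt0r_neq0 k0; have q1 := lt0r_neq0 q0.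
exists e => //; pose p := Num.sqrt (k / (2 * q)).
have p2 : p ^+ 2 = k / (2 * q) by rewrite sqr_sqrtr // divr_ge0 ?mulr_ge0 // ltW.
have p0 : 0 < p by rewrite sqrtr_gt0 divr_gt0 // mulr_gt0.
have p1 := lt0r_neq0 p0.
exists p, (al / p), (k / (2 * p)), 0, 0, k; split.
- by split; rewrite // divr_gt0 // mulr_gt0.
- by split; field.
- rewrite /cholesky_data; congr PairData; rewrite ?expr_div_n ?p2; try (by field; rewrite ?p1 ?k1).
  by rewrite exprMn p2; field; rewrite ?q1 ?k1.
- by apply: (proj2 (half_equal e0 _ _) hab); [rewrite divr_gt0|field; rewrite ?p1].
Qed.

(** From here on c has the form (cos, sin, 0), (cos, 0, sin), (0, cos, sin) or
    (cos cos', sin cos', sin'). *)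
Section Angle.
Variables C S : R.
Hypotheses (CS : C ^+ 2 + S ^+ 2 = 1) (C0 : C != 0) (S0 : S != 0).
Let sqrC : C ^+ 2 = 1 - S ^+ 2. Proof. by rewrite -CS addrK. Qed.

Definition data_BI k q al : pair_data :=
  let e := Num.sg C in let rho := Num.sqrt (q * (1 - q * S ^+ 2)) in
  PairData (1 / k * (e * (rho / q))) (1 / k * S) 0
    (k ^+ 2 * rho ^+ 2 / C ^+ 2)
    (k ^+ 2 / C ^+ 2 * (C ^+ 2 + (1 - q) ^+ 2 * S ^+ 2))
    (q ^+ 2 * (k ^+ 4 * al ^+ 2 * rho ^+ 2 + S ^+ 2 * C ^+ 2) / (4 * rho ^+ 2 * S ^+ 2))
    (- e * (k ^+ 2 * rho / C ^+ 2) * (1 - q) * S)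
    (e * (al * k ^+ 3 * q * rho / (2 * C)))
    (- (al * k ^+ 3 * rho ^+ 2 / (2 * S * C))).

Section BI.
Variables (p s v k q al : R).
Hypotheses (p0 : 0 < p) (s0 : 0 < s) (q0 : 0 < q).
Let rho := Num.sqrt (q * (1 - q * S ^+ 2)).
Let e := Num.sg C.
Let p1 := lt0r_neq0 p0.
Let s1 := lt0r_neq0 s0.
Let q1 := lt0r_neq0 q0.
Hypothesis rel : p ^+ 2 * C ^+ 2 = s ^+ 2 * q * (1 - q * S ^+ 2).
Hypothesis vE : v = al * s ^+ 2 * q / 2.
Let u := s * S * (q - 1) / C.
Let w := - (v * C / S).
Let t := q * s / (2 * p).

Lemma BI_rho : e * rho = p * C / s /\ rho ^+ 2 = q * (1 - q * S ^+ 2) /\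
  rho ^+ 2 = p ^+ 2 * C ^+ 2 / s ^+ 2.
Proof.
have rE : q * (1 - q * S ^+ 2) = (p * C / s) ^+ 2.
  apply: (mulf_cancel (expf_neq0 2 s1)).
  have -> : s ^+ 2 * (q * (1 - q * S ^+ 2)) = s ^+ 2 * q * (1 - q * S ^+ 2) by ring.
  by rewrite -rel; field; rewrite ?s1.
have r2 : rho ^+ 2 = q * (1 - q * S ^+ 2) by rewrite sqr_sqrtr // rE sqr_ge0.
split; last by rewrite r2; split; rewrite // rE; field; rewrite ?s1.
rewrite /rho rE sqrtr_sqr !normrM normfV (gtr0_norm p0) (gtr0_norm s0).
have {2}<- : e * `|C| = C by rewrite -numEsg.
by ring.
Qed.

Lemma BI_data : cholesky_data p u s v w t C S 0 = data_BI s q al.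
Proof.
have [er [r1 r2]] := BI_rho.
rewrite /cholesky_data /data_BI -/e -/rho; congr PairData.
- have -> : 1 / s * (e * (rho / q)) = (e * rho) / (s * q) by field; rewrite ?s1 ?q1.
  by rewrite er /t; field; rewrite ?p1 ?s1 ?q1.
- by rewrite /u /t; field; rewrite ?p1 ?s1 ?q1 ?C0.
- by rewrite /w /t; field; rewrite ?p1 ?s1 ?q1 ?S0.
- by rewrite r2; field; rewrite ?s1 ?C0.
- by rewrite /u; field.
- rewrite r2 /w /t vE.
  have -> : (al * s ^+ 2 * q / 2) ^+ 2 + (- (al * s ^+ 2 * q / 2 * C / S)) ^+ 2
     = (al * s ^+ 2 * q / 2) ^+ 2 * (C ^+ 2 + S ^+ 2) / S ^+ 2 by field.
  by rewrite CS; field; rewrite ?p1 ?s1 ?C0 ?S0.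
- have -> : - e * (s ^+ 2 * rho / C ^+ 2) * (1 - q) * S =
    - (e * rho) * (s ^+ 2 / C ^+ 2) * (1 - q) * S by ring.
  by rewrite er /u; field; rewrite ?s1 ?C0.
- have -> : e * (al * s ^+ 3 * q * rho / (2 * C)) = (e * rho) * (al * s ^+ 3 * q / (2 * C)).
    by field.
  by rewrite er vE; field; rewrite ?s1 ?C0.
- rewrite r1 /u /w vE.
  have -> : s * S * (q - 1) / C * (al * s ^+ 2 * q / 2) + s * - (al * s ^+ 2 * q / 2 * C / S)
    = al * s ^+ 3 * q / (2 * S * C) * (q * S ^+ 2 - (C ^+ 2 + S ^+ 2)).
    by field; rewrite ?S0 ?C0.
  by rewrite CS; field; rewrite ?S0 ?C0.
Qed.
End BI.

(** The third equation gives w = - v C / S, the second one t = q s / (2 p), and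
    the first one p; the parameters are kappa = s, u = s S (q - 1) / C and
    v = alpha s^2 q / 2. *)
Lemma realized_BI : realizes C S 0 D a b <->
  exists k q q' al, [/\ 0 < k, 0 < q' & 0 < q < 1 / S ^+ 2] /\
    (D = data_BI k q al /\
     half_values a b (k * Num.sqrt q / (4 * q')) (k * Num.sqrt q * q' / 4)).
Proof.
split=> [[p [u [s [v [w [t [[p0 s0 t0] E -> hab]]]]]]]|].
  have E3 := contact_eq3 t0 E; case: E => E1 E2 _.
  have p1 := lt0r_neq0 p0; have s1 := lt0r_neq0 s0; have t1 := lt0r_neq0 t0.
  pose q := 2 * p * t / s.
  have q0 : 0 < q by rewrite divr_gt0 // !mulr_gt0.
  have q1 := lt0r_neq0 q0.
  have wE : w = - (v * C / S) by apply: (mulIf S0); rewrite mulNr divfK //; lra.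
  have uE : u = s * S * (q - 1) / C.
    apply: (mulIf C0); rewrite divfK // /q; apply: (mulf_cancel s1).
    have -> : s * (s * S * (2 * p * t / s - 1)) = 2 * (p * s * t) * S - s * (s * S).
      by field.
    by rewrite -E2 E3; ring.
  have tE : t = q * s / (2 * p) by rewrite /q; field; rewrite p1.
  have rel : p ^+ 2 * C ^+ 2 = s ^+ 2 * q * (1 - q * S ^+ 2).
    have h : p * (p * C) = 2 * (p * s * t) * C - u * (u * C + s * S) by rewrite -E1 E3; ring.
    have -> : p ^+ 2 * C ^+ 2 = p * (p * C) * C by ring.
    rewrite h uE tE.
    have -> : (2 * (p * s * (q * s / (2 * p))) * C -
      s * S * (q - 1) / C * (s * S * (q - 1) / C * C + s * S)) * C
      = s ^+ 2 * q * ((C ^+ 2 + S ^+ 2) - q * S ^+ 2) by field; rewrite ?p1 ?C0.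
    by rewrite CS.
  pose al := 2 * v / (s ^+ 2 * q).
  have vE : v = al * s ^+ 2 * q / 2 by rewrite /al; field; rewrite ?s1 ?q1.
  have sq0 : 0 < Num.sqrt q by rewrite sqrtr_gt0.
  exists s, q, (s * Num.sqrt q / (4 * a)), al; split.
    split=> //; first by rewrite divr_gt0 ?mulr_gt0.
    rewrite q0 /= ltr_pdivlMr ?exprn_even_gt0 //= -subr_gt0.
    rewrite -(pmulr_rgt0 _ (mulr_gt0 (exprn_gt0 2 s0) q0)) -rel.
    by rewrite mulr_gt0 // exprn_even_gt0.
  split; first by rewrite uE wE tE; exact: BI_data.
  move=> n1; have [ab _] := hab n1; split; first by field; rewrite s1 a_neq0 gt_eqF.
  apply: (mulf_cancel a_neq0); have -> : a * b = p * s * t / 8 by lra.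
  have -> : a * (s * Num.sqrt q * (s * Num.sqrt q / (4 * a)) / 4) = s ^+ 2 * (Num.sqrt q) ^+ 2 / 16.
    by field.
  by rewrite sqr_sqrtr ?ltW // tE; field.
move=> [k [q [q' [al [[k0 q'0 /andP[q0 qS]] [-> hab]]]]]].
have S2 : 0 < S ^+ 2 by rewrite exprn_even_gt0.
have C2 : 0 < C ^+ 2 by rewrite exprn_even_gt0.
have r0 : 0 < q * (1 - q * S ^+ 2) by rewrite mulr_gt0 // subr_gt0 -ltr_pdivlMr.
pose p := k * Num.sqrt (q * (1 - q * S ^+ 2)) / `|C|.
have p0 : 0 < p by rewrite divr_gt0 ?normr_gt0 // mulr_gt0 // sqrtr_gt0.
have p1 := lt0r_neq0 p0; have k1 := lt0r_neq0 k0; have q1 := lt0r_neq0 q0.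
have rel : p ^+ 2 * C ^+ 2 = k ^+ 2 * q * (1 - q * S ^+ 2).
  by rewrite /p expr_div_n exprMn sqr_sqrtr ?ltW // real_normK ?num_real // divfK ?gt_eqF // mulrA.
pose v := al * k ^+ 2 * q / 2.
exists p, (k * S * (q - 1) / C), k, v, (- (v * C / S)), (q * k / (2 * p)); split.
- by split; rewrite // divr_gt0 // mulr_gt0.
- split.
  + apply: (mulIf C0).
    have -> : (p * (p * C) + k * S * (q - 1) / C * (k * S * (q - 1) / C * C + k * S) +
      v * (v * C + - (v * C / S) * S + q * k / (2 * p) * 0)) * C =
      p ^+ 2 * C ^+ 2 + k ^+ 2 * S ^+ 2 * q * (q - 1) by field; rewrite ?C0 ?S0 ?p1.
    rewrite rel.
    have -> : 2 * (p * k * (q * k / (2 * p))) * C * C = k ^+ 2 * q * C ^+ 2 by field.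
    by rewrite sqrC; ring.
  + by field; rewrite ?C0 ?S0 ?p1.
  + by field; rewrite ?C0 ?S0 ?p1.
- by symmetry; exact: BI_data.
- move=> n1; have [-> ->] := hab n1; split; last by rewrite eqxx.
  have -> : 8 * (k * Num.sqrt q / (4 * q') * (k * Num.sqrt q * q' / 4)) =
    k ^+ 2 * (Num.sqrt q) ^+ 2 / 2 by field; rewrite gt_eqF.
  by rewrite sqr_sqrtr ?ltW //; field.
Qed.

Definition rho_BII k q al := q ^+ 2 * C ^+ 2 + 4 * (al ^+ 2 * k ^+ 2 + 1) * S ^+ 2.

Definition data_BII k q al : pair_data :=
  let rho := rho_BII k q al in
  PairData (q / (2 * k) * C) (S * al) (S * (1 / k))
    (4 * k ^+ 2 * q ^+ 2 / rho ^+ 2)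
    (1 / (q ^+ 2 * rho ^+ 2)
       * (rho ^+ 2 + 16 * al ^+ 2 * q ^+ 2 * k ^+ 4 * (S / C) ^+ 2))
    (k ^+ 2 * (1 + (4 - rho) ^+ 2 / rho ^+ 2 * (S / C) ^+ 2 + al ^+ 2 / q ^+ 2))
    (8 * al * k ^+ 3 * q / rho ^+ 2 * (S / C))
    (2 * k ^+ 2 * q * (4 - rho) / rho ^+ 2 * (S / C))
    (k * al / (q ^+ 2 * rho ^+ 2)
       * (4 * k ^+ 2 * q ^+ 2 * (4 - rho) * (S / C) ^+ 2 - rho ^+ 2)).

Section BII.
Variables (p s q t al rho : R).
Hypotheses (p0 : p != 0) (q0 : q != 0) (t0 : t != 0) (sE : s = q^-1).
Hypothesis pE : rho = 2 * t / (s * p).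
Let w := - (al * s * t).
Let v := S / C * (2 * (p * s) - t).
Let u := - (2 * p * w * (S / C)).

Lemma BII_data : rho = rho_BII t q al -> cholesky_data p u s v w t C 0 S = data_BII t q al.
Proof.
move=> rE; rewrite /cholesky_data /data_BII -rE pE; congr PairData; rewrite /u /v /w sE; field;
  by rewrite ?p0 ?q0 ?t0 ?C0.
Qed.
End BII.

(** The second equation determines u, the third one v; q = 1 / s, kappa = t and
    alpha = - w / (s t). *)
Lemma realized_BII : realizes C 0 S D a b <->
  exists k q al, [/\ 0 < k & 0 < q] /\
    (D = data_BII k q al /\
      let rho := rho_BII k q al in
      half_values a b (k * Num.sqrt rho / (2 * rho)) (k * Num.sqrt rho / (2 * rho))).
Proof.
have S2 : 0 < S ^+ 2 by rewrite exprn_even_gt0.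
have rho_gt0 k q al : 0 < q ^+ 2 * C ^+ 2 + 4 * (al ^+ 2 * k ^+ 2 + 1) * S ^+ 2.
  apply: ltr_wpDl; first by rewrite mulr_ge0 ?sqr_ge0.
  rewrite pmulr_lgt0 // pmulr_rgt0 //.
  by apply: ltr_wpDl; rewrite ?ltr01 // mulr_ge0 ?sqr_ge0.
have half k rho p s : 0 < p -> 0 < s -> 0 < k -> 0 < rho -> rho = 2 * k / (s * p) ->
    half_eqs p s k S a b <->
    half_values a b (k * Num.sqrt rho / (2 * rho)) (k * Num.sqrt rho / (2 * rho)).
  move=> p0 s0 k0 r0 rE; apply: half_equal => //.
    by rewrite divr_gt0 ?mulr_gt0 ?sqrtr_gt0.
  rewrite expr_div_n exprMn sqr_sqrtr ?ltW //.
  have -> : 8 * (k ^+ 2 * rho / (2 * rho) ^+ 2) = 2 * k ^+ 2 / rho by field; rewrite gt_eqF.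
  by rewrite rE; field; rewrite !gt_eqF.
split=> [[p [u [s [v [w [t [[p0 s0 t0] E -> hab]]]]]]]|].
  have E3 := contact_eq3 t0 E; case: E => E1 E2 _.
  have p1 := lt0r_neq0 p0; have s1 := lt0r_neq0 s0; have t1 := lt0r_neq0 t0.
  pose al := - (w / (s * t)).
  have wE : w = - (al * s * t) by rewrite /al; field; rewrite s1 t1.
  have vE : v = S / C * (2 * (p * s) - t).
    by apply: (mulIf C0); rewrite mulrAC divfK //; lra.
  have uE : u = - (2 * p * w * (S / C)).
    apply: (mulIf C0); have -> : - (2 * p * w * (S / C)) * C = - (2 * p * w * S) by field.
    apply: (mulf_cancel s1).
    by rewrite E3 in E2; lra.
  pose rho := (s^-1) ^+ 2 * C ^+ 2 + 4 * (al ^+ 2 * t ^+ 2 + 1) * S ^+ 2.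
  have rE : rho = 2 * t / (s * p).
    have h : p ^+ 2 * C ^+ 2 + (u * C) ^+ 2 + (v * C) * (2 * (p * s) * S) = 2 * (p * s * t) * C ^+ 2.
      have -> : 2 * (p * s * t) * C ^+ 2 = 2 * (p * s * t) * C * C by ring.
      by rewrite -E1 E3; ring.
    have e : (u * C) ^+ 2 = 4 * p ^+ 2 * w ^+ 2 * S ^+ 2 by rewrite uE; field.
    have e' : v * C = (2 * (p * s) - t) * S by rewrite vE; field.
    rewrite e e' in h.
    have psn : (p * s) ^+ 2 != 0 by rewrite expf_neq0 // mulf_neq0.
    apply: (mulf_cancel psn).
    have -> : (p * s) ^+ 2 * rho = p ^+ 2 * C ^+ 2 + 4 * p ^+ 2 * w ^+ 2 * S ^+ 2
      + 4 * (p * s) ^+ 2 * S ^+ 2 by rewrite /rho /al; field; rewrite s1 t1.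
    have -> : (p * s) ^+ 2 * (2 * t / (s * p)) = 2 * (p * s * t) * (C ^+ 2 + S ^+ 2).
      by rewrite CS; field; rewrite p1 s1.
    by rewrite mulrDr -h; ring.
  exists t, s^-1, al; split; first by rewrite t0 invr_gt0.
  split; first by rewrite uE vE wE; apply: BII_data; rewrite ?invr_eq0 ?invrK.
  by apply/(half t rho p s) => //; exact: rho_gt0.
move=> [k [q [al [[k0 q0] [-> hab]]]]].
have k1 := lt0r_neq0 k0; have q1 := lt0r_neq0 q0.
move: hab (rho_gt0 k q al); set rho := _ + _ * S ^+ 2 => hab r0.
have r1 := lt0r_neq0 r0.
pose p := 2 * k * q / rho; have p0 : 0 < p by rewrite divr_gt0 // !mulr_gt0.
have p1 := lt0r_neq0 p0.
have rE : rho = 2 * k / (q^-1 * p) by rewrite /p; field; rewrite r1 q1 k1.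
pose w := - (al * q^-1 * k).
exists p, (- (2 * p * w * (S / C))), q^-1, (S / C * (2 * (p * q^-1) - k)), w, k; split.
- by split; rewrite ?invr_gt0.
- split.
  + apply: (mulIf C0); apply: (mulf_cancel (expf_neq0 2 q1)).
    have -> : q ^+ 2 * ((p * (p * C) + - (2 * p * w * (S / C)) * (- (2 * p * w * (S / C)) * C + q^-1 * 0)
       + S / C * (2 * (p * q^-1) - k) * (S / C * (2 * (p * q^-1) - k) * C + w * 0 + k * S)) * C) =
       p ^+ 2 * rho - 2 * p * k * q * S ^+ 2 by rewrite /rho /w; field; rewrite ?C0 ?q1.
    have -> : q ^+ 2 * (2 * (p * q^-1 * k) * C * C) = 2 * p * k * q * C ^+ 2 by field.
    rewrite sqrC {1}rE; field; by rewrite ?q1 ?p1.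
  + by rewrite /w; field; rewrite ?C0 ?q1.
  + by rewrite /w; field; rewrite ?C0 ?q1.
- by symmetry; exact: BII_data.
- by apply/(half k rho p q^-1) => //; rewrite invr_gt0.
Qed.

Definition rho_BIII q := C ^+ 2 + q ^+ 2 * S ^+ 2.

Definition data_BIII k q al : pair_data :=
  let rho := rho_BIII q in
  PairData 0 (1 / (k * q) * C) (1 / (k * q) * (q * S))
    (q ^+ 2 / 4)
    (k ^+ 2 * q ^+ 2 / rho ^+ 2 * (1 + al ^+ 2 * rho ^+ 2 * (S / C) ^+ 2))
    (k ^+ 2 / rho ^+ 2 * (rho ^+ 2 * al ^+ 2 + rho ^+ 2
        + (1 - q ^+ 2) ^+ 2 * S ^+ 2 * C ^+ 2))
    (- (al * k * q ^+ 2 / 2 * (S / C)))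
    (al * k * q / 2)
    (- (q * k ^+ 2 / rho ^+ 2
          * (al ^+ 2 * rho ^+ 2 * (S / C) + (1 - q ^+ 2) * S * C))).

Section BIII.
Variables (s t q al rho : R).
Hypotheses (q0 : q != 0) (t0 : t != 0) (r0 : rho != 0).
Hypotheses (rhoE : rho = C ^+ 2 + q ^+ 2 * S ^+ 2) (sE : s = q * t / rho).
Let v := al * t.
Let u := - (q * v * S / C).
Let w := S * t * C * (q ^+ 2 - 1) / rho.

Let wE : w * C + t * S = q * s * S.
Proof.
apply: (mulf_cancel r0); rewrite /w sE.
have -> : rho * (S * t * C * (q ^+ 2 - 1) / rho * C + t * S) =
  S * t * (C ^+ 2 * (q ^+ 2 - 1) + rho) by field.
by rewrite {1}rhoE sqrC; field.
Qed.

Lemma BIII_data : cholesky_data (q / 2) u s v w t 0 C S = data_BIII t q al.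
Proof.
rewrite /cholesky_data /data_BIII /rho_BIII -rhoE (mulr0 v) add0r wE sE.
by congr PairData; rewrite /u /v /w; field; rewrite ?q0 ?t0 ?r0 ?C0.
Qed.
End BIII.

(** The first equation determines u, the third one w, and the second one then
    gives s; q = 2 p, kappa = t and alpha = v / t. *)
Lemma realized_BIII : realizes 0 C S D a b <->
  exists k q al, [/\ 0 < k & 0 < q] /\
    (D = data_BIII k q al /\
      let rho := rho_BIII q in
      half_values a b (k * q * Num.sqrt rho / (4 * rho)) (k * q * Num.sqrt rho / (4 * rho))).
Proof.
have rho_gt0 q : 0 < C ^+ 2 + q ^+ 2 * S ^+ 2.
  by apply: ltr_pwDl; rewrite ?exprn_even_gt0 // mulr_ge0 ?sqr_ge0.
have half q k rho s : 0 < q -> 0 < k -> 0 < rho -> s = q * k / rho ->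
    half_eqs (q / 2) s k S a b <->
    half_values a b (k * q * Num.sqrt rho / (4 * rho)) (k * q * Num.sqrt rho / (4 * rho)).
  move=> q0 k0 r0 sE; apply: half_equal => //.
    by rewrite divr_gt0 ?mulr_gt0 ?sqrtr_gt0.
  rewrite expr_div_n exprMn sqr_sqrtr ?ltW // sE.
  by field; rewrite gt_eqF.
split=> [[p [u [s [v [w [t [[p0 s0 t0] E -> hab]]]]]]]|].
  have E3 := contact_eq3 t0 E; case: E => E1 E2 _.
  have p1 := lt0r_neq0 p0; have s1 := lt0r_neq0 s0; have t1 := lt0r_neq0 t0.
  have [q qE] : exists q, q = 2 * p by exists (2 * p).
  have pE : p = q / 2 by rewrite qE; field.
  have q0 : 0 < q by rewrite qE mulr_gt0.
  have q1 := lt0r_neq0 q0.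
  pose al := v / t; have vE : v = al * t by rewrite /al divfK.
  pose rho := C ^+ 2 + q ^+ 2 * S ^+ 2; have r1 : rho != 0 by rewrite gt_eqF // rho_gt0.
  rewrite E3 in E1; rewrite E3 in E2.
  have wC : w * C = 2 * (p * s) * S - t * S by lra.
  have uE : u = - (q * v * S / C).
    apply: (mulIf C0); have -> : - (q * v * S / C) * C = - (q * v * S) by field.
    by apply: (mulf_cancel s1); rewrite qE; lra.
  have sE : s = q * t / rho.
    apply: (mulIf r1); rewrite divfK //; apply: (mulf_cancel s1).
    have -> : s * (q * t) = 2 * (p * s * t) * (C ^+ 2 + S ^+ 2) by rewrite CS qE; ring.
    have h : s * (s * C) * C = 2 * (p * s * t) * C * C - w * C * (2 * (p * s) * S).
      by rewrite -E2; ring.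
    have -> : s * (s * rho) = s * (s * C) * C + s ^+ 2 * q ^+ 2 * S ^+ 2 by rewrite /rho; ring.
    by rewrite h wC qE; ring.
  have wE : w = S * t * C * (q ^+ 2 - 1) / rho.
    apply: (mulIf C0); rewrite wC; apply: (mulIf r1).
    have -> : (2 * (p * s) * S - t * S) * rho = q * (s * rho) * S - t * S * rho.
      by rewrite qE; ring.
    rewrite {1}sE divfK //.
    have -> : S * t * C * (q ^+ 2 - 1) / rho * C * rho = S * t * C ^+ 2 * (q ^+ 2 - 1) by field.
    by rewrite /rho sqrC; ring.
  exists t, q, al; split=> //; split.
    rewrite /= uE wE vE pE; exact: BIII_data.
  by move: hab; rewrite pE => hab; apply/(half q t rho s) => //; exact: rho_gt0.
move=> [k [q [al [[k0 q0] [-> hab]]]]].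
have k1 := lt0r_neq0 k0; have q1 := lt0r_neq0 q0.
move: hab (rho_gt0 q); set rho := _ + _ => hab r0.
have r1 := lt0r_neq0 r0.
exists (q / 2), (- (q * (al * k) * S / C)), (q * k / rho), (al * k),
  (S * k * C * (q ^+ 2 - 1) / rho), k; split.
- by split; rewrite // divr_gt0 // mulr_gt0.
- have wE : S * k * C * (q ^+ 2 - 1) / rho * C + k * S = q ^+ 2 * k * S / rho.
    apply: (mulIf r1).
    have -> : (S * k * C * (q ^+ 2 - 1) / rho * C + k * S) * rho =
      S * k * (C ^+ 2 * (q ^+ 2 - 1) + rho) by field.
    by rewrite {1}/rho sqrC; field.
  split; rewrite (mulr0 (al * k)) add0r wE.
  + by field; rewrite ?r1 ?C0.
  + have -> : q * k / rho * (- (q * (al * k) * S / C) * 0 + q * k / rho * C) =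
      (q * k / rho) ^+ 2 * C by ring.
    apply: (mulIf C0); rewrite mulrDl.
    have -> : S * k * C * (q ^+ 2 - 1) / rho * (q ^+ 2 * k * S / rho) * C =
      q ^+ 2 * k ^+ 2 / rho ^+ 2 * (S ^+ 2 * C ^+ 2 * (q ^+ 2 - 1)) by field.
    have -> : (q * k / rho) ^+ 2 * C * C = q ^+ 2 * k ^+ 2 / rho ^+ 2 * C ^+ 2 by field.
    rewrite -mulrDr.
    have -> : C ^+ 2 + S ^+ 2 * C ^+ 2 * (q ^+ 2 - 1) = C ^+ 2 * rho.
      by rewrite /rho sqrC; ring.
    by field.
  + by field.
- by symmetry; exact: BIII_data.
- by apply/(half q k rho (q * k / rho)).
Qed.

Section TypeC.
Variables K Z : R.
Hypotheses (KZ : K ^+ 2 + Z ^+ 2 = 1) (K0 : K != 0) (Z0 : Z != 0).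

Definition rhoC q al : R := K ^+ 2 * (S - q * al * C) ^+ 2 + 4 * q ^+ 2 * Z ^+ 2.

Lemma rhoC_gt0 q al : q != 0 -> 0 < rhoC q al.
Proof.
move=> q0; apply: ltr_wpDl; first by rewrite mulr_ge0 ?sqr_ge0.
by rewrite pmulr_lgt0 ?exprn_even_gt0 // pmulr_rgt0 ?exprn_even_gt0.
Qed.

Definition data_C k q al be de : pair_data :=
  let cot := K / Z in
  let ga1 := cot / (k ^+ 2 * be) * ((1 - k ^+ 2 * be * de) * S - q * al * C) in
  let ga2 := cot / (k ^+ 2 * be * q)
    * (q * al * S + (k ^+ 2 * be * de - q ^+ 2 * (al ^+ 2 + de ^+ 2)) * C) in
  PairData
    (1 / (q * de) * (de * K * (C + q * al * S) + q * (al * ga1 - ga2) * Z))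
    (de * S * K + ga1 * Z) (Z / k)
    (q ^+ 2) ((1 + al ^+ 2 * q ^+ 2) / de ^+ 2)
    (k ^+ 2 / de ^+ 2 * (ga1 ^+ 2 + q ^+ 2 * ga2 ^+ 2 + de ^+ 2))
    (- (al * q ^+ 2 / de)) (k * q ^+ 2 * ga2 / de)
    (- (k / de ^+ 2 * (ga1 + al * q ^+ 2 * ga2))).

Definition half_values_C q al de : Prop := (1 < n)%N ->
  let c := 1 / (16 * de ^+ 2) * (q ^+ 2 * de ^+ 2 * C ^+ 2 * K ^+ 2 + rhoC q al) in
  a ^+ 2 = c /\ b ^+ 2 = c.

(** beta is 2 q / kappa: the other square root of 4 q^2 / kappa^2 would make all
    terms of the quadratic equation positive. *)
Lemma root_beta k q al be de : 0 < k -> 0 < q -> be ^+ 2 = 4 * q ^+ 2 / k ^+ 2 -> 0 < de ->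
  (q * C * K) ^+ 2 * de ^+ 2 - k ^+ 2 * be * de + rhoC q al = 0 -> be = 2 * q / k.
Proof.
move=> k0 q0 be2 de0 root; have r0 := rhoC_gt0 al (lt0r_neq0 q0).
have be0 : 0 < be.
  have h : 0 < (k ^+ 2 * de) * be.
    have -> : (k ^+ 2 * de) * be = (q * C * K) ^+ 2 * de ^+ 2 + rhoC q al by lra.
    by apply: ltr_wpDl; rewrite // mulr_ge0 ?sqr_ge0.
  by move: h; rewrite pmulr_rgt0 // mulr_gt0 // exprn_gt0.
apply/eqP; rewrite -(@eqrXn2 _ 2) ?ltW // ?divr_gt0 ?mulr_gt0 //; apply/eqP.
by rewrite be2; field; rewrite gt_eqF.
Qed.

Section Data.
Variables (k q al de be : R).
Hypotheses (k0 : k != 0) (q0 : q != 0) (de0 : de != 0) (beE : be = 2 * q / k).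
Let ga1 := K / Z / (k ^+ 2 * be) * ((1 - k ^+ 2 * be * de) * S - q * al * C).
Let ga2 := K / Z / (k ^+ 2 * be * q)
  * (q * al * S + (k ^+ 2 * be * de - q ^+ 2 * (al ^+ 2 + de ^+ 2)) * C).
Let s := de^-1.
Let u := - (al * q * s).
Let v := k * q * s * ga2.
Let w := - (k * s * ga1).
Hypothesis e3 : v * (C * K) + w * (S * K) + k * Z = 2 * (q * s) * Z.

Lemma C_data : cholesky_data q u s v w k (C * K) (S * K) Z = data_C k q al be de.
Proof.
rewrite /cholesky_data e3 /data_C -/ga1 -/ga2; congr PairData.
- by rewrite /u /ga1 /ga2 beE /s; field; rewrite ?k0 ?q0 ?de0 ?Z0.
- by rewrite /u /ga1 beE /s; field; rewrite ?k0 ?q0 ?de0 ?Z0.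
- by rewrite /s; field; rewrite ?k0 ?q0 ?de0.
- by rewrite /u /s; field.
- by rewrite /v /w /s; field.
- by rewrite /u /s; field.
- by rewrite /v /s; field.
- by rewrite /u /v /w /s; field.
Qed.
End Data.

Lemma half_C (p s t q al de : R) : 0 < p * s * t -> 8 / (16 * de ^+ 2)
      * (q ^+ 2 * de ^+ 2 * C ^+ 2 * K ^+ 2 + rhoC q al) = p * s * t ->
  half_eqs p s t Z a b <-> half_values_C q al de.
Proof.
move=> pst cE; set X := q ^+ 2 * _ * _ * _ + _ in cE *; set c := 1 / (16 * de ^+ 2) * X.
have cE' : 8 * c = p * s * t by rewrite -cE /c; ring.
split=> H n1.
  have [e1 /(_ Z0) e2] := H n1; rewrite -e2 in e1 *.
  have h : a ^+ 2 = c by lra.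
  by [].
have [e1 e2] := H n1.
have ab : a = b by apply/eqP; rewrite -(@eqrXn2 _ 2) ?ltW // e1 e2.
by split=> //; rewrite -ab -expr2 e1.
Qed.

(** The first two equations are linear in v and w, with p = q, t = kappa,
    s = 1 / delta and u = - alpha q / delta; the third one becomes the quadratic
    equation for delta. *)
Lemma realized_C : realizes (C * K) (S * K) Z D a b <->
  exists k q al be de, [/\ 0 < k, 0 < q, rhoC q al * C ^+ 2 * K ^+ 2 <= k ^+ 2 &
      [/\ be ^+ 2 = 4 * q ^+ 2 / k ^+ 2, 0 < de &
      (q * C * K) ^+ 2 * de ^+ 2 - k ^+ 2 * be * de + rhoC q al = 0]] /\
    (D = data_C k q al be de /\ half_values_C q al de).
Proof.
split=> [[p [u [s [v [w [t [[p0 s0 t0] E -> hab]]]]]]]|].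
  have E3 := contact_eq3 t0 E; case: E => E1 E2 _.
  have p1 := lt0r_neq0 p0; have s1 := lt0r_neq0 s0; have t1 := lt0r_neq0 t0.
  have [de sE] : exists de, s = de^-1 by exists s^-1; rewrite invrK.
  have de0 : 0 < de by rewrite -invr_gt0 -sE.
  have de1 := lt0r_neq0 de0.
  pose al := - (u * de / p).
  have uE : u = - (al * p * s) by rewrite /al sE; field; rewrite p1 de1.
  pose be := 2 * p / t.
  have be2 : be ^+ 2 = 4 * p ^+ 2 / t ^+ 2 by rewrite /be; field.
  rewrite E3 in E1; rewrite E3 in E2.
  have wE : w = - (t * s * (K / Z / (t ^+ 2 * be) * ((1 - t ^+ 2 * be * de) * S - p * al * C))).
    apply: (mulIf Z0); apply: (mulf_cancel p1); apply: (mulf_cancel s1).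
    have -> : s * (p * (w * Z)) = (2 * (p * s * t) * (S * K) - s * (u * (C * K) + s * (S * K))) / 2.
      by rewrite -E2; field.
    by rewrite uE sE /be; field; rewrite ?p1 ?t1 ?de1 ?Z0.
  have vE : v = t * p * s * (K / Z / (t ^+ 2 * be * p)
     * (p * al * S + (t ^+ 2 * be * de - p ^+ 2 * (al ^+ 2 + de ^+ 2)) * C)).
    apply: (mulIf Z0); apply: (mulf_cancel p1); apply: (mulf_cancel s1).
    have -> : s * (p * (v * Z)) = (2 * (p * s * t) * (C * K) - p * (p * (C * K))
       - u * (u * (C * K) + s * (S * K))) / 2.
      by rewrite -E1; field.
    by rewrite uE sE /be; field; rewrite ?p1 ?t1 ?de1 ?Z0.
  have root : (p * C * K) ^+ 2 * de ^+ 2 - t ^+ 2 * be * de + rhoC p al = 0.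
    have h : 2 * p * de * Z * (v * (C * K) + w * (S * K) + t * Z - 2 * (p * s) * Z) = 0.
      by rewrite E3 subrr mulr0.
    have h' : t ^+ 2 * be = 2 * p * t by rewrite /be; field.
    rewrite h'; move: h; rewrite vE wE sE h'.
    have -> : 2 * p * de * Z * (t * p / de * (K / Z / (2 * p * t * p) *
         (p * al * S + (2 * p * t * de - p ^+ 2 * (al ^+ 2 + de ^+ 2)) * C)) * (C * K) +
        - (t / de * (K / Z / (2 * p * t) * ((1 - 2 * p * t * de) * S - p * al * C))) * (S * K)
        + t * Z - 2 * (p / de) * Z) =
      - ((p * C * K) ^+ 2 * de ^+ 2 - 2 * p * t * de * (K ^+ 2 * (C ^+ 2 + S ^+ 2) + Z ^+ 2)
         + rhoC p al).
      by rewrite /rhoC; field; rewrite ?p1 ?t1 ?de1 ?Z0.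
    by rewrite CS mulr1 KZ mulr1 => /eqP; rewrite oppr_eq0 => /eqP.
  have h' : t ^+ 2 * be = 2 * p * t by rewrite /be; field.
  exists t, p, al, be, de; split.
    split=> //.
    rewrite -subr_ge0 -(pmulr_rge0 _ (exprn_gt0 2 p0)).
    have -> : p ^+ 2 * (t ^+ 2 - rhoC p al * C ^+ 2 * K ^+ 2) =
       ((p * C * K) ^+ 2 * de - p * t) ^+ 2 - (p * C * K) ^+ 2 *
         ((p * C * K) ^+ 2 * de ^+ 2 - 2 * p * t * de + rhoC p al) by ring.
    by rewrite -h' root mulr0 subr0 sqr_ge0.
  split.
    by rewrite /= uE vE wE sE; apply: C_data => //; rewrite -?sE -?vE -?wE.
  apply/(half_C (p := p) (s := s) (t := t)) => //; first by rewrite !mulr_gt0.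
  have -> : p ^+ 2 * de ^+ 2 * C ^+ 2 * K ^+ 2 + rhoC p al = 2 * p * t * de.
    by rewrite -h'; have := root; lra.
  by rewrite sE; field.
move=> [k [q [al [be [de [[k0 q0 _ [be2 de0 root]] [-> hab]]]]]]].
have beE := root_beta k0 q0 be2 de0 root.
have k1 := lt0r_neq0 k0; have q1 := lt0r_neq0 q0; have de1 := lt0r_neq0 de0.
have h' : k ^+ 2 * be = 2 * q * k by rewrite beE; field.
pose ga1 := K / Z / (k ^+ 2 * be) * ((1 - k ^+ 2 * be * de) * S - q * al * C).
pose ga2 := K / Z / (k ^+ 2 * be * q)
  * (q * al * S + (k ^+ 2 * be * de - q ^+ 2 * (al ^+ 2 + de ^+ 2)) * C).
have e3 : k * q * de^-1 * ga2 * (C * K) + - (k * de^-1 * ga1) * (S * K) + k * Z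
    = 2 * (q * de^-1) * Z.
  apply/eqP; rewrite -subr_eq0; apply/eqP.
  have nz : 2 * q * de * Z != 0 by rewrite !mulf_neq0 // pnatr_eq0.
  apply: (mulf_cancel nz); rewrite mulr0 -oppr0 -root /ga1 /ga2 h'.
  transitivity (- ((q * C * K) ^+ 2 * de ^+ 2
      - 2 * q * k * de * (K ^+ 2 * (C ^+ 2 + S ^+ 2) + Z ^+ 2) + rhoC q al)).
    by rewrite /rhoC; field; rewrite ?k1 ?q1 ?de1 ?Z0.
  by rewrite CS mulr1 KZ mulr1.
exists q, (- (al * q * de^-1)), de^-1, (k * q * de^-1 * ga2), (- (k * de^-1 * ga1)), k; split.
- by rewrite invr_gt0.
- split; rewrite e3.
  + by rewrite /ga2 h'; field; rewrite ?k1 ?q1 ?de1 ?Z0.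
  + by rewrite /ga1 h'; field; rewrite ?k1 ?q1 ?de1 ?Z0.
  + by field.
- by symmetry; exact: C_data.
- apply: (proj2 (half_C (p := q) (s := de^-1) (t := k) (q := q) (al := al) (de := de) _ _) hab).
    by rewrite !mulr_gt0 // invr_gt0.
  have -> : q ^+ 2 * de ^+ 2 * C ^+ 2 * K ^+ 2 + rhoC q al = 2 * q * k * de.
    by rewrite -h'; have := root; lra.
  by field.
Qed.

(** The quadratic equation for delta has discriminant
    4 q^2 (kappa^2 - rho cos^2 cos'^2). *)
Lemma root_C_exists k q al : 0 < k -> 0 < q -> rhoC q al * C ^+ 2 * K ^+ 2 <= k ^+ 2 ->
  exists be de, [/\ be ^+ 2 = 4 * q ^+ 2 / k ^+ 2, 0 < de &
    (q * C * K) ^+ 2 * de ^+ 2 - k ^+ 2 * be * de + rhoC q al = 0].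
Proof.
move=> k0 q0 disc; have k1 := lt0r_neq0 k0; have q1 := lt0r_neq0 q0.
pose d := Num.sqrt (k ^+ 2 - rhoC q al * C ^+ 2 * K ^+ 2).
have d2 : d ^+ 2 = k ^+ 2 - rhoC q al * C ^+ 2 * K ^+ 2 by rewrite sqr_sqrtr // subr_ge0.
exists (2 * q / k), ((k + d) / (q * C ^+ 2 * K ^+ 2)); split.
- by field.
- apply: divr_gt0; first by rewrite ltr_pwDl // sqrtr_ge0.
  by rewrite pmulr_lgt0 ?exprn_even_gt0 // pmulr_lgt0 ?exprn_even_gt0.
- transitivity ((d ^+ 2 - k ^+ 2 + rhoC q al * C ^+ 2 * K ^+ 2) / (C ^+ 2 * K ^+ 2)).
    by field; rewrite ?k1 ?q1 ?C0 ?K0.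
  by rewrite d2; field; rewrite C0 K0.
Qed.

End TypeC.
End Angle.
End Types.
End ContactTypes.

(** * Linear algebra behind the contact equations *)

Section ContactAlgebra.
Context {R : realType}.

(** Comparing entries, k k^T = c c^T, so that k is (k . c) c with k . c = 1 or -1. *)
Lemma vector_product_sqr (k1 k2 k3 c1 c2 c3 : R) : c1 ^+ 2 + c2 ^+ 2 + c3 ^+ 2 = 1 ->
  (forall Y1 Y2 Y3 : R, let Z1 := Y2 * k3 - Y3 * k2 in let Z2 := Y3 * k1 - Y1 * k3 in
     let Z3 := Y1 * k2 - Y2 * k1 in let d := c1 * Y1 + c2 * Y2 + c3 * Y3 in
     [/\ Z2 * k3 - Z3 * k2 = - Y1 + d * c1, Z3 * k1 - Z1 * k3 = - Y2 + d * c2 &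
         Z1 * k2 - Z2 * k1 = - Y3 + d * c3]) ->
  exists2 e : R, e ^+ 2 = 1 & [/\ k1 = e * c1, k2 = e * c2 & k3 = e * c3].
Proof.
move=> cc H.
have /= [A11 A12 A13] := H 1 0 0; have /= [A21 A22 A23] := H 0 1 0.
have /= [A31 A32 A33] := H 0 0 1.
have s1 : k1 ^+ 2 = c1 ^+ 2 by lra.
have s2 : k2 ^+ 2 = c2 ^+ 2 by lra.
have s3 : k3 ^+ 2 = c3 ^+ 2 by lra.
have p12 : k1 * k2 = c1 * c2 by lra.
have p13 : k1 * k3 = c1 * c3 by lra.
have p23 : k2 * k3 = c2 * c3 by lra.
exists (k1 * c1 + k2 * c2 + k3 * c3).
  transitivity (k1 ^+ 2 * c1 ^+ 2 + k2 ^+ 2 * c2 ^+ 2 + k3 ^+ 2 * c3 ^+ 2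
    + 2 * (k1 * k2 * (c1 * c2)) + 2 * (k1 * k3 * (c1 * c3)) + 2 * (k2 * k3 * (c2 * c3))).
    by ring.
  rewrite s1 s2 s3 p12 p13 p23.
  by transitivity ((c1 ^+ 2 + c2 ^+ 2 + c3 ^+ 2) ^+ 2); [ring|rewrite cc expr1n].
split.
- transitivity (k1 * c1 ^+ 2 + k2 * (c1 * c2) + k3 * (c1 * c3)); last by ring.
  rewrite -p12 -p13 -s1; transitivity (k1 * (k1 ^+ 2 + k2 ^+ 2 + k3 ^+ 2)); last by ring.
  by rewrite s1 s2 s3 cc mulr1.
- transitivity (k2 * c2 ^+ 2 + k1 * (c1 * c2) + k3 * (c2 * c3)); last by ring.
  rewrite -p12 -p23 -s2; transitivity (k2 * (k1 ^+ 2 + k2 ^+ 2 + k3 ^+ 2)); last by ring.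
  by rewrite s1 s2 s3 cc mulr1.
- transitivity (k3 * c3 ^+ 2 + k1 * (c1 * c3) + k2 * (c2 * c3)); last by ring.
  rewrite -p13 -p23 -s3; transitivity (k3 * (k1 ^+ 2 + k2 ^+ 2 + k3 ^+ 2)); last by ring.
  by rewrite s1 s2 s3 cc mulr1.
Qed.

Lemma unit_vector_product (Y1 Y2 Y3 c1 c2 c3 : R) : c1 ^+ 2 + c2 ^+ 2 + c3 ^+ 2 = 1 ->
  (Y2 * c3 - Y3 * c2) * c2 - (Y3 * c1 - Y1 * c3) * c1 =
    - Y3 + (c1 * Y1 + c2 * Y2 + c3 * Y3) * c3.
Proof.
move=> cc; apply/eqP; rewrite -subr_eq0; apply/eqP.
transitivity (Y3 * (1 - (c1 ^+ 2 + c2 ^+ 2 + c3 ^+ 2))); first by ring.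
by rewrite cc subrr mulr0.
Qed.

(** Comparing the components of kappa = e c along c with the squared length of
    the covector (e1, e2, e3) excludes the sign e = -1. *)
Lemma kappa_eq (P U S V W T c1 c2 c3 e : R) : 0 < P -> 0 < S -> 0 < T ->
  c1 ^+ 2 + c2 ^+ 2 + c3 ^+ 2 = 1 -> e ^+ 2 = 1 ->
  let e1 := P * c1 in let e2 := U * c1 + S * c2 in let e3 := V * c1 + W * c2 + T * c3 in
  [/\ P * e1 + U * e2 + V * e3 = 2 * (P * S * T) * (e * c1),
      S * e2 + W * e3 = 2 * (P * S * T) * (e * c2) & T * e3 = 2 * (P * S * T) * (e * c3)] ->
  e = 1.
Proof.
move=> P0 S0 T0 cc ee; set e1 := P * c1; set e2 := U * c1 + S * c2; set e3 := _ + T * c3.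
move=> /= [E1 E2 E3]; have D0 : 0 < 2 * (P * S * T) by rewrite !mulr_gt0.
have h : 2 * (P * S * T) * e = e1 ^+ 2 + e2 ^+ 2 + e3 ^+ 2.
  transitivity (2 * (P * S * T) * e * (c1 ^+ 2 + c2 ^+ 2 + c3 ^+ 2)).
    by rewrite cc mulr1.
  transitivity (2 * (P * S * T) * (e * c1) * c1 + 2 * (P * S * T) * (e * c2) * c2
    + 2 * (P * S * T) * (e * c3) * c3); first by ring.
  by rewrite -E1 -E2 -E3 /e1 /e2 /e3; ring.
have e0 : 0 <= e by rewrite -(pmulr_rge0 _ D0) h !addr_ge0 ?sqr_ge0.
by apply/eqP; rewrite -(@eqrXn2 _ 2) // ee expr1n.
Qed.

Lemma covector_norm (P U S V W T c1 c2 c3 : R) : c1 ^+ 2 + c2 ^+ 2 + c3 ^+ 2 = 1 ->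
  contact_eqs P U S V W T c1 c2 c3 ->
  (P * c1) ^+ 2 + (U * c1 + S * c2) ^+ 2 + (V * c1 + W * c2 + T * c3) ^+ 2 = 2 * (P * S * T).
Proof.
move=> cc [E1 E2 E3].
transitivity (2 * (P * S * T) * c1 * c1 + 2 * (P * S * T) * c2 * c2
    + 2 * (P * S * T) * c3 * c3); first by rewrite -E1 -E2 -E3; ring.
by rewrite -[RHS]mulr1 -cc; ring.
Qed.

(** The 2 x 2 blocks by which phi acts on m_half + k_half have square - 1 exactly
    if these two equations hold. *)
Lemma half_blocks (N e12 e3 a b : R) : 0 < a -> 0 < b -> e12 + e3 ^+ 2 = N ->
  (e3 ^+ 2 / (16 * a ^+ 2) + e12 / (16 * (a * b)) = 1 /\
   e3 ^+ 2 / (16 * b ^+ 2) + e12 / (16 * (a * b)) = 1) <->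
  16 * (a * b) = N /\ (e3 != 0 -> a = b).
Proof.
move=> a0 b0 NE; have a1 := lt0r_neq0 a0; have b1 := lt0r_neq0 b0.
split=> [[A B]|[ab e3ab]].
  have A' : e3 ^+ 2 * b + e12 * a = 16 * a ^+ 2 * b.
    transitivity (16 * a ^+ 2 * b * (e3 ^+ 2 / (16 * a ^+ 2) + e12 / (16 * (a * b)))).
      by field; rewrite a1 b1.
    by rewrite A mulr1.
  have B' : e3 ^+ 2 * a + e12 * b = 16 * b ^+ 2 * a.
    transitivity (16 * b ^+ 2 * a * (e3 ^+ 2 / (16 * b ^+ 2) + e12 / (16 * (a * b)))).
      by field; rewrite a1 b1.
    by rewrite B mulr1.
  have AB : e3 ^+ 2 * (b - a) * (b + a) = 0.
    transitivity ((e3 ^+ 2 * b + e12 * a) * b - (e3 ^+ 2 * a + e12 * b) * a); first by ring.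
    by rewrite A' B'; ring.
  have ab0 : b + a != 0 by rewrite gt_eqF // addr_gt0.
  move/eqP: AB; rewrite mulf_eq0 (negPf ab0) orbF mulf_eq0 expf_eq0 /= => /orP[|].
    move=> /eqP e0; rewrite e0 eqxx; split=> //.
    by apply: (mulIf a1); rewrite -NE e0; rewrite e0 in A'; lra.
  rewrite subr_eq0 => /eqP ba; split=> [|_]; last by rewrite ba.
  by apply: (mulIf a1); rewrite -NE; rewrite ba in A' *; lra.
have [e0|e0] := eqVneq e3 0.
  rewrite e0 expr0n /= addr0 in NE; rewrite e0 expr0n /= !mul0r !add0r NE -ab divff //.
  by rewrite !mulf_neq0 // pnatr_eq0.
have ba := e3ab e0; rewrite -ba in ab *.
have -> : e3 ^+ 2 / (16 * a ^+ 2) + e12 / (16 * (a * a)) = (e12 + e3 ^+ 2) / (16 * (a * a)).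
  by field.
by rewrite NE -ab divff // !mulf_neq0 // pnatr_eq0.
Qed.

Definition gram_form (gXX gmm gnn gXm gXn gmn x y z x' y' z' : R) : R :=
  x * x' * gXX + y * y' * gmm + z * z' * gnn + (x * y' + y * x') * gXm
  + (x * z' + z * x') * gXn + (y * z' + z * y') * gmn.

(** If the rows of B are orthonormal for the Gram matrix G, then B G B^T = 1, and
    G = L L^T for the inverse L of B. *)
Lemma triangular_orthonormal (gXX gmm gnn gXm gXn gmn b11 b21 b22 b31 b32 b33 : R) :
  0 < b11 -> 0 < b22 -> 0 < b33 ->
  let G := gram_form gXX gmm gnn gXm gXn gmn in
  G b11 0 0 b11 0 0 = 1 -> G b11 0 0 b21 b22 0 = 0 -> G b21 b22 0 b21 b22 0 = 1 ->
  G b11 0 0 b31 b32 b33 = 0 -> G b21 b22 0 b31 b32 b33 = 0 -> G b31 b32 b33 b31 b32 b33 = 1 ->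
  exists P U S V W T,
    [/\ [/\ 0 < P, 0 < S & 0 < T],
        [/\ b11 = P^-1, b21 = - (U / (P * S)) & b22 = S^-1],
        [/\ b31 = (U * W - V * S) / (P * S * T), b32 = - (W / (S * T)) & b33 = T^-1],
        [/\ gXX = P ^+ 2, gmm = U ^+ 2 + S ^+ 2 & gnn = V ^+ 2 + W ^+ 2 + T ^+ 2] &
        [/\ gXm = P * U, gXn = P * V & gmn = U * V + S * W]].
Proof.
move=> p11 p22 p33 G.
have n11 := lt0r_neq0 p11; have n22 := lt0r_neq0 p22; have n33 := lt0r_neq0 p33.
have [P [P0 PE]] : exists P, 0 < P /\ b11 = P^-1 by exists b11^-1; rewrite invr_gt0 invrK.
have [S [S0 SE]] : exists S, 0 < S /\ b22 = S^-1 by exists b22^-1; rewrite invr_gt0 invrK.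
have [T [T0 TE]] : exists T, 0 < T /\ b33 = T^-1 by exists b33^-1; rewrite invr_gt0 invrK.
have P1 := lt0r_neq0 P0; have S1 := lt0r_neq0 S0; have T1 := lt0r_neq0 T0.
pose U := - (b21 * P * S); pose W := - (b32 * S * T); pose V := (U * W - b31 * P * S * T) / S.
have b21E : b21 = - (U / (P * S)) by rewrite /U; field; rewrite P1 S1.
have b32E : b32 = - (W / (S * T)) by rewrite /W; field; rewrite S1 T1.
have b31E : b31 = (U * W - V * S) / (P * S * T) by rewrite /V; field; rewrite P1 S1 T1.
clearbody V; clearbody U W.
rewrite /G /gram_form PE SE TE b21E b32E b31E => e11 e12 e22 e13 e23 e33.
have solve (k l c x y : R) : l = c -> k * (l - c) = x - y -> x = y.
  by move=> ->; rewrite subrr mulr0 => /eqP; rewrite eq_sym subr_eq0 => /eqP.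
have gXXE : gXX = P ^+ 2 by apply: (solve (P ^+ 2) _ _ _ _ e11); field.
rewrite gXXE in e12 e22 e13 e23 e33.
have gXmE : gXm = P * U by apply: (solve (P * S) _ _ _ _ e12); field; rewrite P1 S1.
rewrite gXmE in e22 e13 e23 e33.
have gmmE : gmm = U ^+ 2 + S ^+ 2 by apply: (solve (S ^+ 2) _ _ _ _ e22); field; rewrite P1 S1.
rewrite gmmE in e23 e33.
have gXnE : gXn = P * V by apply: (solve (P * T) _ _ _ _ e13); field; rewrite P1 S1 T1.
rewrite gXnE in e23 e33.
have gmnE : gmn = U * V + S * W.
  by apply: (solve (S * T) _ _ _ _ e23); field; rewrite P1 S1 T1.
rewrite gmnE in e33.
have gnnE : gnn = V ^+ 2 + W ^+ 2 + T ^+ 2.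
  by apply: (solve (T ^+ 2) _ _ _ _ e33); field; rewrite P1 S1 T1.
by exists P, U, S, V, W, T.
Qed.

End ContactAlgebra.

(** * Tangent vectors in coordinates *)

HB.lock Definition tvec {R : realType} {m : nat} (r x y z : R) (f h : 'I_m -> R[i]) :
  ambient (R := R) m.+1 := at_o r (mb x y z f h).

Section TangentVectorsAtOrigin.
Context {R : realType} {m : nat}.
Notation mat := ('M[R[i]]_m.+2).
Notation amb := (ambient (R := R) m.+1).
Variable r : R.
Hypothesis r0 : r != 0.
Notation M := (TrCP (n := m.+1) r).
Notation o := (o_H m.+1 r).
Implicit Types (p q u v w : amb) (A B : mat).
Implicit Types (x y z : R) (f h : 'I_m -> R[i]).

Lemma at_o_mb x y z f h : at_o r (mb x y z f h) = tvec r x y z f h.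
Proof. by rewrite tvec.unlock. Qed.

Lemma fund_mb x y z f h : fund (mb x y z f h) o = tvec r x y z f h.
Proof. by rewrite -at_oE at_o_mb. Qed.

Lemma tvec_tangent x y z f h : tangent M o (tvec r x y z f h).
Proof. rewrite tvec.unlock; exact: at_o_tangent. Qed.

Lemma tangent_tvec v : tangent M o v -> exists x y z f h, v = tvec r x y z f h.
Proof.
move=> /(tangent_o r0) [x [y [z [f [h ->]]]]].
by exists x, y, z, f, h; rewrite at_o_mb.
Qed.

Lemma cx_tvec x y z f h : cx r o (tvec r x y z f h) = x.
Proof. by rewrite tvec.unlock cx_mb. Qed.
Lemma cy_tvec x y z f h : cy r o (tvec r x y z f h) = y.
Proof. by rewrite tvec.unlock cy_mb. Qed.
Lemma cz_tvec x y z f h : cz r o (tvec r x y z f h) = z.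
Proof. by rewrite tvec.unlock cz_mb. Qed.
Lemma pf_tvec x y z f h : pf r o (tvec r x y z f h) = row_at i0 f.
Proof. by rewrite tvec.unlock pf_o. Qed.
Lemma ph_tvec x y z f h : ph r o (tvec r x y z f h) = row_at i1 h.
Proof. by rewrite tvec.unlock ph_o. Qed.

Lemma deta_tvec e1 e2 e3 x y z f h x' y' z' f' h' :
  deta r e1 e2 e3 o (tvec r x y z f h) (tvec r x' y' z' f' h') =
  (e1 * (y * z' - z * y') - e2 * (x * z' - z * x') + e3 * (x * y' - y * x')) / 2
  + e1 * (complex.Re (herm f h') - complex.Re (herm f' h))
  + e2 * (complex.Im (herm f h') - complex.Im (herm f' h))
  - e3 * (complex.Im (herm f f') - complex.Im (herm h h')).
Proof. by rewrite tvec.unlock deta_o. Qed.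

Lemma fundD A B p : fund (A + B) p = fund A p + fund B p.
Proof.
have bD K : brk (A + B) K = brk A K + brk B K.
  by rewrite /brk mulmxDl mulmxDr opprD addrACA.
by apply: pt_inj; [rewrite ptPD !fund_P bD|rewrite ptZD !fund_Z bD].
Qed.

Lemma fundZ (k : R) A p : fund (rscale k A) p = k *: fund A p.
Proof. by apply: pt_inj; [rewrite ptPZ !fund_P brkZl|rewrite ptZZ !fund_Z brkZl]. Qed.

Lemma tvec_linear (k : R) x y z f h x' y' z' f' h' :
  k *: tvec r x y z f h + tvec r x' y' z' f' h' =
  tvec r (k * x + x') (k * y + y') (k * z + z')
    (fun j => (k +i* 0)%C * f j + f' j) (fun j => (k +i* 0)%C * h j + h' j).
Proof. by rewrite -!fund_mb -fundZ -fundD mbZ mbD. Qed.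

Lemma tvec_ext x y z f h x' y' z' f' h' : x = x' -> y = y' -> z = z' -> f =1 f' -> h =1 h' ->
  tvec r x y z f h = tvec r x' y' z' f' h'.
Proof. by move=> -> -> -> /funext -> /funext ->. Qed.

Lemma row_at_inj (i : 'I_m.+2) : injective (@row_at R m i).
Proof.
move=> f f' /matrixP e; apply/funext => k; have := e i (jj k).
by rewrite !row_atE eqxx !mul1r.
Qed.

Lemma tvec_inj x y z f h x' y' z' f' h' :
  tvec r x y z f h = tvec r x' y' z' f' h' ->
  [/\ x = x', y = y', z = z', f = f' & h = h'].
Proof.
move=> e; split.
- by rewrite -(cx_tvec x y z f h) e cx_tvec.
- by rewrite -(cy_tvec x y z f h) e cy_tvec.
- by rewrite -(cz_tvec x y z f h) e cz_tvec.
- by apply: (@row_at_inj i0); rewrite -(pf_tvec x y z f h) e pf_tvec.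
- by apply: (@row_at_inj i1); rewrite -(ph_tvec x y z f h) e ph_tvec.
Qed.

Lemma at_o_nvec x y z : at_o r (nvec m.+1 x y z) = tvec r x y z (fun _ => 0) (fun _ => 0).
Proof. by rewrite nvecE at_o_mb. Qed.
Lemma at_o_vX : at_o r (vX m.+1) = tvec r 1 0 0 (fun _ => 0) (fun _ => 0).
Proof. by rewrite vXE at_o_mb. Qed.
Lemma at_o_vmu : at_o r (vmu m.+1) = tvec r 0 1 0 (fun _ => 0) (fun _ => 0).
Proof. by rewrite vmuE at_o_mb. Qed.
Lemma at_o_vnu : at_o r (vnu m.+1) = tvec r 0 0 1 (fun _ => 0) (fun _ => 0).
Proof. by rewrite vnuE at_o_mb. Qed.

(** Everything at a point of M is a translate of something at o_H. *)
Lemma TrCP_frame p : M p -> exists a, [/\ SU a, unitary a, p = gact a o &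
  forall v, tangent M p v -> exists x y z f h, v = gact a (tvec r x y z f h)].
Proof.
move=> /TrCP_orbit [a Sa pE]; have ua := SU_unitary Sa; exists a; split=> // v tv.
have tv' : tangent M o (gact (a ^t*) v).
  by have := tangent_gact r0 (unitary_adj ua) tv; rewrite pE gact_adjK.
have [x [y [z [f [h e]]]]] := tangent_tvec tv'.
by exists x, y, z, f, h; rewrite -e gact_adjVK.
Qed.

Lemma fund_vector_field A : skew A -> vector_field M (fun q => fund A q).
Proof.
move=> sA; split=> [q Mq|]; first exact: fund_tangent.
exists (fun q => fund A q); split=> //.
by apply: smooth_fund; exact: msmooth_cst.
Qed.

Lemma tvec_vector_field x y z f h :
  exists2 U, vector_field M U & U o = tvec r x y z f h.
Proof.
exists (fun q => fund (mb x y z f h) q); last exact: fund_mb.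
by apply: fund_vector_field; exact: mb_skew.
Qed.

Lemma herm_lin_r (c d : R[i]) f f' f'' :
  herm f (fun k => c * f' k + d * f'' k) = Num.conj c * herm f f' + Num.conj d * herm f f''.
Proof.
rewrite /herm !mulr_sumr -big_split /=; apply: eq_bigr => k _.
by rewrite rmorphD !rmorphM /=; ring.
Qed.

Lemma herm0l f : herm (fun _ : 'I_m => 0) f = 0.
Proof. by apply: big1 => k _; rewrite mul0r. Qed.

End TangentVectorsAtOrigin.

(** * Invariant metrics in coordinates *)

Section InvariantStructures.
Context {R : realType} {m : nat}.
Notation mat := ('M[R[i]]_m.+2).
Notation amb := (ambient (R := R) m.+1).
Variable r : R.
Hypothesis r0 : r != 0.
Notation M := (TrCP (n := m.+1) r).
Notation o := (o_H m.+1 r).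
Implicit Types (p q u v w : amb) (A B : mat).
Implicit Types (x y z : R) (f h : 'I_m -> R[i]).

Variables (g : amb -> amb -> amb -> R) (a b : R).
Hypothesis ig : invariant_metric r g a b.

Let g_riem : riemannian_metric M g. Proof. by case: ig. Qed.

Lemma g_gact c p u v : SU c -> M p -> tangent M p u -> tangent M p v ->
  g (gact c p) (gact c u) (gact c v) = g p u v.
Proof.
by move=> Sc Mp tu tv; rewrite -!(actE _ (SU_unitary Sc)); case: ig => _ H _ _ _; exact: H.
Qed.

Lemma a_gt0 : 0 < a. Proof. by case: ig. Qed.
Lemma b_gt0 : 0 < b. Proof. by case: ig. Qed.

Let n0 : 'I_m -> R[i] := fun _ => 0.

Lemma g_nvec_r v x y z : tangent M o v ->
  g o v (tvec r x y z n0 n0) =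
  x * g o v (tvec r 1 0 0 n0 n0) + y * g o v (tvec r 0 1 0 n0 n0)
  + z * g o v (tvec r 0 0 1 n0 n0).
Proof.
have [_ lin _ _] := g_riem => tv.
have Mo := @TrCP_o R m r; have tt := @tvec_tangent R m r.
have -> : tvec r x y z n0 n0 = x *: tvec r 1 0 0 n0 n0 +
    (y *: tvec r 0 1 0 n0 n0 + (z *: tvec r 0 0 1 n0 n0 + tvec r 0 0 0 n0 n0)).
  rewrite !tvec_linear.
  by apply: tvec_ext => [|||k|k]; rewrite /n0 ?mulr0 ?mulr1 ?addr0 ?add0r.
have g0 : g o v (tvec r 0 0 0 n0 n0) = 0.
  have := lin o 1 v _ _ Mo tv (tt 0 0 0 n0 n0) (tt 0 0 0 n0 n0); rewrite tvec_linear.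
  rewrite [X in g o v X](_ : _ = tvec r 0 0 0 n0 n0); last first.
    by apply: tvec_ext => *; rewrite /n0 ?mulr0 addr0.
  by move=> e; apply: (@addrI _ (g o v (tvec r 0 0 0 n0 n0))); rewrite addr0 [RHS]e mul1r.
rewrite (lin _ _ _ _ _ Mo tv (tt _ _ _ _ _)); last by rewrite !tvec_linear; exact: tt.
rewrite (lin _ _ _ _ _ Mo tv (tt _ _ _ _ _)); last by rewrite tvec_linear; exact: tt.
by rewrite (lin _ _ _ _ _ Mo tv (tt _ _ _ _ _) (tt _ _ _ _ _)) g0 addr0 addrA.
Qed.

Notation X := (vX m.+1 : mat).
Notation mu := (vmu m.+1 : mat).
Notation nu := (vnu m.+1 : mat).
Notation G := (gram_form (g_o r g X X) (g_o r g mu mu) (g_o r g nu nu)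
  (g_o r g X mu) (g_o r g X nu) (g_o r g mu nu)).

Lemma g_gram x y z x' y' z' :
  g o (tvec r x y z n0 n0) (tvec r x' y' z' n0 n0) = G x y z x' y' z'.
Proof.
have [sym _ _ _] := g_riem.
have Mo := @TrCP_o R m r; have tt := @tvec_tangent R m r.
pose tX := tvec r 1 0 0 n0 n0; pose tmu := tvec r 0 1 0 n0 n0; pose tnu := tvec r 0 0 1 n0 n0.
have eX : tX = at_o r X by rewrite at_o_vX.
have emu : tmu = at_o r mu by rewrite at_o_vmu.
have enu : tnu = at_o r nu by rewrite at_o_vnu.
have s (x1 y1 z1 x2 y2 z2 : R) := sym o (tvec r x1 y1 z1 n0 n0) (tvec r x2 y2 z2 n0 n0) Mo
  (tt _ _ _ _ _) (tt _ _ _ _ _).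
rewrite (g_nvec_r x' y' z' (tt x y z n0 n0)) (s x y z 1 0 0) (s x y z 0 1 0) (s x y z 0 0 1).
rewrite !(g_nvec_r x y z (tt _ _ _ n0 n0)) (s 0 1 0 1 0 0) (s 0 0 1 1 0 0) (s 0 0 1 0 1 0).
transitivity (gram_form (g o tX tX) (g o tmu tmu) (g o tnu tnu) (g o tX tmu) (g o tX tnu)
  (g o tmu tnu) x y z x' y' z'); first by rewrite /gram_form; ring.
by congr (gram_form _ _ _ _ _ _ _ _ _ _ _ _); rewrite ?eX ?emu ?enu.
Qed.

Variables P U S V W T : R.
Hypothesis gramE : inner_values r g (P ^+ 2) (U ^+ 2 + S ^+ 2) (V ^+ 2 + W ^+ 2 + T ^+ 2)
  (P * U) (P * V) (U * V + S * W).

Lemma g_nvec x y z x' y' z' : g o (tvec r x y z n0 n0) (tvec r x' y' z' n0 n0) =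
  (P * x + U * y + V * z) * (P * x' + U * y' + V * z')
  + (S * y + W * z) * (S * y' + W * z') + (T * z) * (T * z').
Proof.
rewrite g_gram; transitivity (gram_form (P ^+ 2) (U ^+ 2 + S ^+ 2) (V ^+ 2 + W ^+ 2 + T ^+ 2)
  (P * U) (P * V) (U * V + S * W) x y z x' y' z'); last by rewrite /gram_form; ring.
by case: gramE => -[e1 e2 e3] [e4 e5 e6]; congr (gram_form _ _ _ _ _ _ _ _ _ _ _ _).
Qed.

Lemma g_tvec x y z f h x' y' z' f' h' :
  g o (tvec r x y z f h) (tvec r x' y' z' f' h') =
  (P * x + U * y + V * z) * (P * x' + U * y' + V * z')
  + (S * y + W * z) * (S * y' + W * z') + (T * z) * (T * z')
  + 4 * a * complex.Re (herm f f') + 4 * b * complex.Re (herm h h').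
Proof.
have split_mb (x1 y1 z1 : R) (f1 h1 : 'I_m -> R[i]) : mb x1 y1 z1 f1 h1 =
    nvec m.+1 x1 y1 z1 + mb 0 0 0 f1 (fun _ => 0) + mb 0 0 0 (fun _ => 0) h1.
  by rewrite nvecE !mbD; apply: mb_ext => [|||k|k]; rewrite ?addr0 ?add0r.
have nn (x1 y1 z1 : R) : n_bar (nvec m.+1 x1 y1 z1) by exists x1, y1, z1.
have mm f1 : m_half (mb 0 0 0 f1 (fun _ => 0)) by apply/m_halfE; exists f1.
have kk h1 : k_half (mb 0 0 0 (fun _ => 0) h1) by apply/k_halfE; exists h1.
have [_ _ _ _ H] := ig.
have := H _ _ _ _ _ _ (nn x y z) (nn x' y' z') (mm f) (mm f') (kk h) (kk h').
rewrite -!split_mb /g_o !at_o_mb !at_o_nvec g_nvec => ->; rewrite !ip_half.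
rewrite -!Re_sum -!/(herm _ _) !herm0l; ring.
Qed.

End InvariantStructures.

(** * The tensor phi *)

Section ContactOperator.
Context {R : realType} {m : nat}.
Notation mat := ('M[R[i]]_m.+2).
Notation amb := (ambient (R := R) m.+1).
Variable r : R.
Hypothesis r0 : r != 0.
Notation M := (TrCP (n := m.+1) r).
Notation o := (o_H m.+1 r).
Implicit Types (p q u v w : amb) (A B : mat).
Implicit Types (x y z : R) (f h : 'I_m -> R[i]).

Variables (a b P U S V W T c1 c2 c3 : R).
Hypotheses (a0 : a != 0) (b0 : b != 0) (P0 : P != 0) (S0 : S != 0) (T0 : T != 0).

(** The coordinates of a vector of n_bar in the adapted basis. *)
Definition Y1 x y z := P * x + U * y + V * z.
Definition Y2 y z := S * y + W * z.
Definition Y3 z := T * z.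

Definition e1 := P * c1.
Definition e2 := U * c1 + S * c2.
Definition e3 := V * c1 + W * c2 + T * c3.

(** On n_bar, d eta is the triple product with the vector kappa, so that phi is
    the vector product with kappa (in adapted coordinates). *)
Definition kap1 := (P * e1 + U * e2 + V * e3) / (2 * (P * S * T)).
Definition kap2 := (S * e2 + W * e3) / (2 * (P * S * T)).
Definition kap3 := T * e3 / (2 * (P * S * T)).

Definition phi_z x y z := (Y1 x y z * kap2 - Y2 y z * kap1) / T.
Definition phi_y x y z := (Y3 z * kap1 - Y1 x y z * kap3 - W * phi_z x y z) / S.
Definition phi_x x y z :=
  (Y2 y z * kap3 - Y3 z * kap2 - U * phi_y x y z - V * phi_z x y z) / P.

(** The 2 x 2 block by which phi acts on the coordinates f k and h k of m_half
    and k_half. *)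
Definition ff : R[i] := (0 +i* (- (e3 / (4 * a))))%C.
Definition fh : R[i] := ((e1 / (4 * a)) +i* (e2 / (4 * a)))%C.
Definition hh : R[i] := (0 +i* (e3 / (4 * b)))%C.
Definition hf : R[i] := ((- (e1 / (4 * b))) +i* (e2 / (4 * b)))%C.

Definition phi_f f h : 'I_m -> R[i] := fun k => ff * f k + fh * h k.
Definition phi_h f h : 'I_m -> R[i] := fun k => hh * h k + hf * f k.

Lemma Y1_phi x y z : Y1 (phi_x x y z) (phi_y x y z) (phi_z x y z) = Y2 y z * kap3 - Y3 z * kap2.
Proof. by rewrite /Y1 /phi_x; field. Qed.
Lemma Y2_phi x y z : Y2 (phi_y x y z) (phi_z x y z) = Y3 z * kap1 - Y1 x y z * kap3.
Proof. by rewrite /Y2 /phi_y; field. Qed.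
Lemma Y3_phi x y z : Y3 (phi_z x y z) = Y1 x y z * kap2 - Y2 y z * kap1.
Proof. by rewrite /Y3 /phi_z; field. Qed.

Lemma Y_inj x y z x' y' z' : Y1 x y z = Y1 x' y' z' -> Y2 y z = Y2 y' z' -> Y3 z = Y3 z' ->
  [/\ x = x', y = y' & z = z'].
Proof.
rewrite /Y1 /Y2 /Y3 => E1 E2 /(mulfI T0) zE; rewrite zE in E1 E2 *.
have yE : y = y' by apply: (mulfI S0); apply: (addIr (W * z')).
by rewrite yE in E1 *; split=> //; apply: (mulfI P0); apply: (addIr (U * y' + V * z')); rewrite !addrA.
Qed.

Definition phi_mat p v : mat :=
  let x := cx r p v in let y := cy r p v in let z := cz r p v in
  let F := ff *: pf r p v + fh *: (pE12 r p *m ph r p v) in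
  let H := hh *: ph r p v + hf *: (pE21 r p *m pf r p v) in
  pn r p (phi_x x y z) (phi_y x y z) (phi_z x y z) + (F - F ^t*) + (H - H ^t*).

Definition phi p v : amb := fund (phi_mat p v) p.

Lemma phi_gact c p v : unitary c -> phi (gact c p) (gact c v) = gact c (phi p v).
Proof.
move=> uc; rewrite /phi (gact_fund _ _ uc); congr fund; rewrite /phi_mat /=.
have cjE N F H : cj c N + (cj c F - (cj c F)^t*) + (cj c H - (cj c H)^t*) =
    cj c (N + (F - F ^t*) + (H - H ^t*)) by rewrite !cj_adj !cjD !cjN.
have lin (d d' : R[i]) (F F' : mat) : d *: cj c F + d' *: cj c F' = cj c (d *: F + d' *: F').
  by rewrite cjD !cjZ.
rewrite (cx_gact _ uc) (cy_gact _ uc) (cz_gact _ uc) (pn_gact r uc) (pE12_gact r uc).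
rewrite (pE21_gact r uc) (pf_gact r uc) (ph_gact r uc).
by rewrite -(cjM (pE12 r p) _ uc) -(cjM (pE21 r p) _ uc) (lin ff) (lin hh) cjE.
Qed.

Lemma phi_o x y z f h : phi o (tvec r x y z f h) =
  tvec r (phi_x x y z) (phi_y x y z) (phi_z x y z) (phi_f f h) (phi_h f h).
Proof.
rewrite -[RHS]fund_mb /phi; congr fund; rewrite /phi_mat.
rewrite cx_tvec // cy_tvec // cz_tvec // pf_tvec // ph_tvec // pE12_o // pE21_o //.
by rewrite !row_at_mul !row_atZ !row_atD mb_rows.
Qed.

Lemma smooth_phi U' : smooth U' -> smooth (fun q => phi q (U' q)).
Proof.
move=> sU; apply: smooth_fund.
have sx := smooth_cx r sU; have sy := smooth_cy r sU; have sz := smooth_cz r sU.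
have sc (c : R) (k : amb -> R) : smooth k -> smooth (fun q => c * k q).
  by move=> sk; apply: smooth_mul => //; exact: smooth_cst.
have sc' (c : R) (k : amb -> R) : smooth k -> smooth (fun q => k q * c).
  by move=> sk; apply: smooth_mul => //; exact: smooth_cst.
have sB (k k' : amb -> R) : smooth k -> smooth k' -> smooth (fun q => k q - k' q).
  by move=> sk sk'; apply: smooth_add => //; exact: smooth_opp.
have s3 := sc T _ sz.
have s2 : smooth (fun q => Y2 (cy r q (U' q)) (cz r q (U' q))) by apply: smooth_add; exact: sc.
have s1 : smooth (fun q => Y1 (cx r q (U' q)) (cy r q (U' q)) (cz r q (U' q))).
  by apply: smooth_add; [apply: smooth_add|]; exact: sc.
have pz : smooth (fun q => phi_z (cx r q (U' q)) (cy r q (U' q)) (cz r q (U' q))).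
  by apply: (sc' _ _ _); apply: (sB _ _ _ _); exact: sc'.
have py : smooth (fun q => phi_y (cx r q (U' q)) (cy r q (U' q)) (cz r q (U' q))).
  by apply: (sc' _ _ _); apply: (sB _ _ _ _); [apply: (sB _ _ _ _); exact: sc'|exact: sc].
have px : smooth (fun q => phi_x (cx r q (U' q)) (cy r q (U' q)) (cz r q (U' q))).
  apply: (sc' _ _ _); apply: (sB _ _ _ _); last exact: sc.
  by apply: (sB _ _ _ _); [apply: (sB _ _ _ _); exact: sc'|exact: sc].
have sf := msmooth_pf r sU; have sh := msmooth_ph r sU.
have sfh := msmoothM (msmooth_pE12 r) sh; have shf := msmoothM (msmooth_pE21 r) sf.
have sF := msmoothD (msmoothZ ff sf) (msmoothZ fh sfh).
have sH := msmoothD (msmoothZ hh sh) (msmoothZ hf shf).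
apply: msmoothD (msmoothD sH (msmoothN (msmooth_adj sH))).
apply: msmoothD (msmoothD sF (msmoothN (msmooth_adj sF))).
exact: msmooth_pn.
Qed.

Lemma phi_tangent p v : tangent M p v -> tangent M p (phi p v).
Proof.
move=> tv; have Mp := tangent_mono tv.
have [c [_ uc pE fr]] := TrCP_frame r0 Mp; have [x [y [z [f [h ->]]]]] := fr _ tv.
rewrite pE phi_gact // phi_o; apply: tangent_gact => //; exact: tvec_tangent.
Qed.

Lemma phi_linear p (k : R) u v : tangent M p u -> tangent M p v ->
  phi p (k *: u + v) = k *: phi p u + phi p v.
Proof.
move=> tu tv; have Mp := tangent_mono tv.
have [c [_ uc pE fr]] := TrCP_frame r0 Mp.
have [x [y [z [f [h ->]]]]] := fr _ tu; have [x' [y' [z' [f' [h' ->]]]]] := fr _ tv.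
rewrite pE -gactZ -gactD tvec_linear !phi_gact // -gactZ -gactD !phi_o tvec_linear.
congr gact; apply: tvec_ext => [|||j|j].
- by rewrite /phi_x /phi_y /phi_z /Y1 /Y2 /Y3; field; rewrite P0 S0 T0.
- by rewrite /phi_y /phi_z /Y1 /Y2 /Y3; field; rewrite S0 T0.
- by rewrite /phi_z /Y1 /Y2 /Y3; field.
- by rewrite /phi_f; ring.
- by rewrite /phi_h; ring.
Qed.

Lemma tensor_phi : tensor_1_1 M phi.
Proof.
split.
- by move=> p u _; exact: phi_tangent.
- by move=> p k u v _; exact: phi_linear.
- move=> X [tX [X' [sX' XX']]]; split=> [p Mp|]; first by apply: phi_tangent; exact: tX.
  exists (fun q => phi q (X' q)); split; first exact: smooth_phi.
  by move=> p Mp; rewrite XX'.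
Qed.

End ContactOperator.

(** * Reduction of the contact metric condition to phi *)

Section ContactEquivalence.
Context {R : realType} {m : nat}.
Notation mat := ('M[R[i]]_m.+2).
Notation amb := (ambient (R := R) m.+1).
Variable r : R.
Hypothesis r0 : r != 0.
Notation M := (TrCP (n := m.+1) r).
Notation o := (o_H m.+1 r).
Implicit Types (p q u v w : amb) (A B : mat).
Implicit Types (x y z : R) (f h : 'I_m -> R[i]).

Variables (xi : amb -> amb) (g : amb -> amb -> amb -> R) (a b : R).
Hypothesis inv : invariant_pair r xi g a b.
Let ixi : invariant_vector_field r xi := inv.1.
Let ig : invariant_metric r g a b := inv.2.
Let a0 : a != 0 := lt0r_neq0 (a_gt0 ig).
Let b0 : b != 0 := lt0r_neq0 (b_gt0 ig).
Let n0 : 'I_m -> R[i] := fun _ => 0.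

Variables P U S V W T x0 y0 z0 : R.
Hypotheses (P_gt0 : 0 < P) (S_gt0 : 0 < S) (T_gt0 : 0 < T).
Let P0 : P != 0 := lt0r_neq0 P_gt0.
Let S0 : S != 0 := lt0r_neq0 S_gt0.
Let T0 : T != 0 := lt0r_neq0 T_gt0.
Hypothesis gramE : inner_values r g (P ^+ 2) (U ^+ 2 + S ^+ 2) (V ^+ 2 + W ^+ 2 + T ^+ 2)
  (P * U) (P * V) (U * V + S * W).
Hypothesis xi_o : xi o = tvec r x0 y0 z0 n0 n0.

Let c1 := Y1 P U V x0 y0 z0.
Let c2 := Y2 S W y0 z0.
Let c3 := Y3 T z0.
Notation E1 := (e1 P c1).
Notation E2 := (e2 U S c1 c2).
Notation E3 := (e3 V W T c1 c2 c3).
Notation eta := (eta_poly r E1 E2 E3).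
Notation dE := (deta r E1 E2 E3).
Notation Phi := (phi r a b P U S V W T c1 c2 c3).

Let Mo := @TrCP_o R m r.

Lemma xi_tangent p : M p -> tangent M p (xi p).
Proof. by move=> Mp; case: ixi => [[tx _] _]; exact: tx. Qed.

Lemma xi_gact c : SU c -> xi (gact c o) = gact c (xi o).
Proof.
move=> Sc; rewrite -!(actE _ (SU_unitary Sc)); case: ixi => _ H; exact: H.
Qed.

Lemma eta_tvec x y z f h : eta o (tvec r x y z f h) =
  c1 * Y1 P U V x y z + c2 * Y2 S W y z + c3 * Y3 T z.
Proof.
rewrite /eta_poly cx_tvec // cy_tvec // cz_tvec // /e1 /e2 /e3 /Y1 /Y2 /Y3; ring.
Qed.

Lemma eta_xi p v : tangent M p v -> g p (xi p) v = eta p v.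
Proof.
move=> tv; have Mp := tangent_mono tv.
have [c [Sc uc pE fr]] := TrCP_frame r0 Mp; have [x [y [z [f [h vE]]]]] := fr _ tv.
rewrite vE pE xi_gact // (g_gact ig Sc Mo (xi_tangent Mo) (tvec_tangent _ _ _ _ _ _)).
rewrite eta_poly_gact // eta_tvec xi_o (g_tvec ig gramE) !herm0l /= /c1 /c2 /c3 /Y1 /Y2 /Y3.
by ring.
Qed.

Lemma g_phi_o x y z f h x' y' z' f' h' :
  g o (tvec r x y z f h) (Phi o (tvec r x' y' z' f' h')) =
  dE o (tvec r x y z f h) (tvec r x' y' z' f' h').
Proof.
rewrite phi_o // (g_tvec ig gramE) deta_tvec //.
rewrite -!/(Y1 P U V _ _ _) -!/(Y2 S W _ _) -!/(Y3 T _) Y1_phi // Y2_phi // Y3_phi //.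
rewrite /phi_f /phi_h !herm_lin_r (hermC f' h) (hermC h' f).
rewrite !(Re_add, Re_mul, Im_add, Im_mul, Re_conjc, Im_conjc) /ff /fh /hh /hf /=.
rewrite /kap1 /kap2 /kap3 /Y1 /Y2 /Y3.
by field; rewrite ?a0 ?b0 ?P0 ?S0 ?T0.
Qed.

Lemma g_phi p u v : tangent M p u -> tangent M p v -> g p u (Phi p v) = dE p u v.
Proof.
move=> tu tv; have Mp := tangent_mono tv.
have [c [Sc uc pE fr]] := TrCP_frame r0 Mp.
have [x [y [z [f [h ->]]]]] := fr _ tu; have [x' [y' [z' [f' [h' ->]]]]] := fr _ tv.
have tt := @tvec_tangent R m r.
rewrite pE phi_gact // (g_gact ig Sc Mo (tt _ _ _ _ _) (phi_tangent r0 _ _ _ _ _ _ _ _ _ _ _ (tt _ _ _ _ _))).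
by rewrite g_phi_o deta_gact.
Qed.

Lemma tangent_linear p (k : R) u v : tangent M p u -> tangent M p v -> tangent M p (k *: u + v).
Proof.
move=> tu tv; have Mp := tangent_mono tv.
have [c [_ uc pE fr]] := TrCP_frame r0 Mp.
have [x [y [z [f [h ->]]]]] := fr _ tu; have [x' [y' [z' [f' [h' ->]]]]] := fr _ tv.
rewrite pE -gactZ -gactD tvec_linear; apply: tangent_gact => //; exact: tvec_tangent.
Qed.

Lemma dE_ext U' W' p : vector_field M U' -> vector_field M W' -> M p ->
  ext_der M (fun p v => g p (xi p) v) U' W' p = dE p (U' p) (W' p).
Proof. by move=> vU vW Mp; apply: ext_der_deta => // q v; exact: eta_xi. Qed.

Lemma dE_antisym p u v : dE p u v = - dE p v u.
Proof. by rewrite /deta -mulNr opprB. Qed.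

(** Since g is nondegenerate, Phi is the only candidate for phi. It is a smooth
    tensor with g(u, Phi v) = d eta(u, v), so that phi^2 = - id + eta xi and
    eta(xi) = 1 are the only conditions; by invariance they may be checked at
    o_H, and they imply the compatibility of g with phi because d eta is
    antisymmetric. *)
Lemma contact_metric_phi : contact_metric M xi g <->
  (forall x y z f h, Phi o (Phi o (tvec r x y z f h)) =
     - tvec r x y z f h + eta o (tvec r x y z f h) *: xi o) /\ eta o (xi o) = 1.
Proof.
have [sym lin pos _] : riemannian_metric M g by case: ig.
have tt := @tvec_tangent R m r.
split=> [[ph [[tph _ _] sq ee _ dd]]|[sq ee]].
  have gph u x y z f h : tangent M o u ->
      g o u (ph o (tvec r x y z f h)) = g o u (Phi o (tvec r x y z f h)).
    move=> tu; rewrite g_phi //.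
    have [x' [y' [z' [f' [h' uE]]]]] := tangent_tvec r0 tu.
    have [X vX Xo] := tvec_vector_field r x' y' z' f' h'.
    have [Y vY Yo] := tvec_vector_field r x y z f h.
    by have := dd X Y o vX vY Mo; rewrite dE_ext // Xo Yo -uE.
  have phE x y z f h : ph o (tvec r x y z f h) = Phi o (tvec r x y z f h).
    set w := tvec _ _ _ _ _ _.
    have tph' : tangent M o (ph o w) by apply: tph => //; exact: tt.
    have tPhi : tangent M o (Phi o w) by apply: phi_tangent => //; exact: tt.
    have td := tangent_linear (-1) tPhi tph'.
    have gd : g o (-1 *: Phi o w + ph o w) (-1 *: Phi o w + ph o w) = 0.
      by rewrite (lin o (-1) _ _ _ Mo td tPhi tph') /w (gph _ _ _ _ _ _ td) mulN1r addNr.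
    have [d0|dn] := eqVneq (-1 *: Phi o w + ph o w) 0.
      by apply/eqP; rewrite -subr_eq0 addrC -scaleN1r d0.
    by have := pos o _ Mo td dn; rewrite gd ltxx.
  split=> [x y z f h|]; last by rewrite -eta_xi ?ee //; exact: xi_tangent.
  have := sq o (tvec r x y z f h) Mo (tt x y z f h).
  by rewrite phE (phi_o r0) phE -(phi_o r0) (eta_xi (tt x y z f h)).
have sqp p u : tangent M p u -> Phi p (Phi p u) = - u + eta p u *: xi p.
  move=> tu; have Mp := tangent_mono tu.
  have [c [Sc uc pE fr]] := TrCP_frame r0 Mp; have [x [y [z [f [h ->]]]]] := fr _ tu.
  by rewrite pE !phi_gact // sq eta_poly_gact // xi_gact // gactD gactN gactZ.
exists Phi; split.
- exact: tensor_phi.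
- by move=> p u Mp tu; rewrite (sqp p u tu) (eta_xi tu).
- move=> p Mp; rewrite eta_xi; last exact: xi_tangent.
  have [c [Sc uc pE _]] := TrCP_frame r0 Mp.
  by rewrite pE xi_gact // eta_poly_gact.
- move=> p u v Mp tu tv.
  have tPu : tangent M p (Phi p u) by exact: phi_tangent.
  rewrite g_phi // dE_antisym -g_phi // sqp // addrC.
  have t0 : tangent M p 0.
    by have := tangent_linear (-1) tu tu; rewrite scaleN1r addNr.
  have tN : tangent M p (- u).
    by have := tangent_linear (-1) tu t0; rewrite scaleN1r addr0.
  have g0 : g p v 0 = 0.
    have := lin p (-1) v u u Mp tv tu tu.
    by rewrite scaleN1r addNr mulN1r addNr.
  have gN : g p v (- u) = - g p v u.
    have := lin p (-1) v u 0 Mp tv tu t0.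
    by rewrite scaleN1r addr0 mulN1r g0 addr0.
  rewrite (lin p _ _ _ _ Mp tv (xi_tangent Mp) tN) gN (sym p v u) //.
  rewrite (sym p v (xi p)) //; last exact: xi_tangent.
  by rewrite !eta_xi // opprD opprK addrC.
- move=> X Y p vX vY Mp; rewrite dE_ext // g_phi //; [case: vX|case: vY]; by move=> tX _; exact: tX.
Qed.

End ContactEquivalence.

(** * The contact equations *)

Section ContactEquations.
Context {R : realType} {m : nat}.
Notation mat := ('M[R[i]]_m.+2).
Notation amb := (ambient (R := R) m.+1).
Variable r : R.
Hypothesis r0 : r != 0.
Notation M := (TrCP (n := m.+1) r).
Notation o := (o_H m.+1 r).
Implicit Types (p q u v w : amb) (A B : mat).
Implicit Types (x y z : R) (f h : 'I_m -> R[i]).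

Variables (xi : amb -> amb) (g : amb -> amb -> amb -> R) (a b : R).
Hypothesis inv : invariant_pair r xi g a b.
Let ixi : invariant_vector_field r xi := inv.1.
Let ig : invariant_metric r g a b := inv.2.
Let a0 : a != 0 := lt0r_neq0 (a_gt0 ig).
Let b0 : b != 0 := lt0r_neq0 (b_gt0 ig).
Let n0 : 'I_m -> R[i] := fun _ => 0.

Variables P U S V W T x0 y0 z0 : R.
Hypotheses (P_gt0 : 0 < P) (S_gt0 : 0 < S) (T_gt0 : 0 < T).
Let P0 : P != 0 := lt0r_neq0 P_gt0.
Let S0 : S != 0 := lt0r_neq0 S_gt0.
Let T0 : T != 0 := lt0r_neq0 T_gt0.
Hypothesis gramE : inner_values r g (P ^+ 2) (U ^+ 2 + S ^+ 2) (V ^+ 2 + W ^+ 2 + T ^+ 2)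
  (P * U) (P * V) (U * V + S * W).
Hypothesis xi_o : xi o = tvec r x0 y0 z0 n0 n0.

Let c1 := Y1 P U V x0 y0 z0.
Let c2 := Y2 S W y0 z0.
Let c3 := Y3 T z0.
Notation E1 := (e1 P c1).
Notation E2 := (e2 U S c1 c2).
Notation E3 := (e3 V W T c1 c2 c3).
Notation eta := (eta_poly r E1 E2 E3).
Notation dE := (deta r E1 E2 E3).
Notation Phi := (phi r a b P U S V W T c1 c2 c3).

Let D0 : 2 * (P * S * T) != 0.
Proof. by rewrite !mulf_neq0 // pnatr_eq0. Qed.

Lemma tvecZ (k : R) x y z f h : k *: tvec r x y z f h = tvec r (k * x) (k * y) (k * z)
  (fun j => (k +i* 0)%C * f j) (fun j => (k +i* 0)%C * h j).
Proof. by rewrite -!fund_mb -fundZ mbZ. Qed.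

Lemma tvecN x y z f h : - tvec r x y z f h =
  tvec r (- x) (- y) (- z) (fun j => - f j) (fun j => - h j).
Proof.
rewrite -scaleN1r tvecZ; apply: tvec_ext => [|||j|j]; rewrite ?mulN1r //.
- by apply: complexP; rewrite ?(Re_mul, Im_mul, Re_opp, Im_opp) /=; ring.
- by apply: complexP; rewrite ?(Re_mul, Im_mul, Re_opp, Im_opp) /=; ring.
Qed.

Lemma tvecD x y z f h x' y' z' f' h' : tvec r x y z f h + tvec r x' y' z' f' h' =
  tvec r (x + x') (y + y') (z + z') (fun j => f j + f' j) (fun j => h j + h' j).
Proof. by rewrite -!fund_mb -fundD mbD. Qed.

Lemma n_bar_surj Z1 Z2 Z3 : exists x y z, [/\ Y1 P U V x y z = Z1, Y2 S W y z = Z2 & Y3 T z = Z3].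
Proof.
pose z := Z3 / T; pose y := (Z2 - W * z) / S; pose x := (Z1 - U * y - V * z) / P.
exists x, y, z; rewrite /Y1 /Y2 /Y3 /x /y /z.
by split; field; rewrite ?P0 ?S0 ?T0.
Qed.

Notation K1 := (kap1 P U S V W T c1 c2 c3).
Notation K2 := (kap2 P U S V W T c1 c2 c3).
Notation K3 := (kap3 P S V W T c1 c2 c3).
Notation Pf := (phi_f a P U S V W T c1 c2 c3).
Notation Ph := (phi_h b P U S V W T c1 c2 c3).

(** In adapted coordinates phi^2 = - id + eta xi splits into an identity for
    vector products on n_bar and one for the 2 x 2 blocks on m_half + k_half. *)
Lemma phi_sqr_o x y z f h :
  Phi o (Phi o (tvec r x y z f h)) = - tvec r x y z f h + eta o (tvec r x y z f h) *: xi o <->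
  (let d := c1 * Y1 P U V x y z + c2 * Y2 S W y z + c3 * Y3 T z in
   let Z1 := Y2 S W y z * K3 - Y3 T z * K2 in
   let Z2 := Y3 T z * K1 - Y1 P U V x y z * K3 in
   let Z3 := Y1 P U V x y z * K2 - Y2 S W y z * K1 in
   [/\ Z2 * K3 - Z3 * K2 = - Y1 P U V x y z + d * c1,
       Z3 * K1 - Z1 * K3 = - Y2 S W y z + d * c2 &
       Z1 * K2 - Z2 * K1 = - Y3 T z + d * c3]) /\
  (forall j, Pf (Pf f h) (Ph f h) j = - f j /\ Ph (Pf f h) (Ph f h) j = - h j).
Proof.
rewrite !phi_o // eta_tvec // xi_o tvecN tvecZ tvecD.
set d := c1 * _ + _ + _; cbv zeta.
have Y1E := Y1_phi U S V W T c1 c2 c3 P0; have Y2E := Y2_phi P U V W T c1 c2 c3 S0.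
have Y3E := Y3_phi P U S V W c1 c2 c3 T0.
rewrite -(Y1E x y z) -(Y2E x y z) -(Y3E x y z).
set x1 := phi_x _ _ _ _ _ _ _ _ _ x y z; set y1 := phi_y _ _ _ _ _ _ _ _ _ x y z.
set z1 := phi_z _ _ _ _ _ _ _ _ _ x y z.
rewrite -(Y1E x1 y1 z1) -(Y2E x1 y1 z1) -(Y3E x1 y1 z1).
have n00 (u : R[i]) : - u + (d +i* 0)%C * 0 = - u by rewrite mulr0 addr0.
split=> [/(tvec_inj r0) [xE yE zE fE hE]|[[E1' E2' E3'] E]].
  split; last by move=> j; have := congr1 (@^~ j) fE; have := congr1 (@^~ j) hE; rewrite /n0 !n00.
  by split; rewrite ?xE ?yE ?zE /c1 /c2 /c3 /Y1 /Y2 /Y3; ring.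
suff [xE yE zE] : [/\ phi_x P U S V W T c1 c2 c3 x1 y1 z1 = - x + d * x0,
    phi_y P U S V W T c1 c2 c3 x1 y1 z1 = - y + d * y0 &
    phi_z P U S V W T c1 c2 c3 x1 y1 z1 = - z + d * z0].
  by apply: tvec_ext => // j; [rewrite (E j).1 n00|rewrite (E j).2 n00].
apply: (@Y_inj R P U S V W T P0 S0 T0).
- by rewrite E1' /c1 /Y1; ring.
- by rewrite E2' /c2 /Y2; ring.
- by rewrite E3' /c3 /Y3; ring.
Qed.

Notation ffc := (ff a V W T c1 c2 c3).
Notation fhc := (fh a P U S c1 c2).
Notation hhc := (hh b V W T c1 c2 c3).
Notation hfc := (hf b P U S c1 c2).

Lemma half_sqr : c1 ^+ 2 + c2 ^+ 2 + c3 ^+ 2 = 1 -> contact_eqs P U S V W T c1 c2 c3 ->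
  (forall f h j, Pf (Pf f h) (Ph f h) j = - f j /\ Ph (Pf f h) (Ph f h) j = - h j) <->
  half_eqs m.+1 P S T c3 a b.
Proof.
move=> cc E; have N := covector_norm cc E; have E3' := contact_eq3 T_gt0 E.
have hb := half_blocks (a_gt0 ig) (b_gt0 ig) N.
have e3E : E3 = 2 * (P * S) * c3 by [].
have ffE : ffc * ffc + fhc * hfc =
    ((- (E3 ^+ 2 / (16 * a ^+ 2) + (E1 ^+ 2 + E2 ^+ 2) / (16 * (a * b)))) +i* 0)%C.
  apply: complexP; rewrite !(Re_add, Im_add, Re_mul, Im_mul) /ff /fh /hf /=.
    by field; rewrite a0 b0.
  by field; rewrite a0 b0.
have hhE : hhc * hhc + hfc * fhc =
    ((- (E3 ^+ 2 / (16 * b ^+ 2) + (E1 ^+ 2 + E2 ^+ 2) / (16 * (a * b)))) +i* 0)%C.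
  apply: complexP; rewrite !(Re_add, Im_add, Re_mul, Im_mul) /hh /fh /hf /=.
    by field; rewrite a0 b0.
  by field; rewrite a0 b0.
split=> [H m1|H f h j].
  have k : 'I_m := Ordinal (m1 : (0 < m)%N).
  have [H1 _] := H (fun _ => 1) n0 k; have [_ H2] := H n0 (fun _ => 1) k.
  rewrite /phi_f /phi_h /n0 in H1 H2.
  have A : ffc * ffc + fhc * hfc = -1 by rewrite -H1; ring.
  have B : hhc * hhc + hfc * fhc = -1 by rewrite -H2; ring.
  rewrite ffE in A; rewrite hhE in B.
  have A' := congr1 (@complex.Re R) A; have B' := congr1 (@complex.Re R) B.
  rewrite /= in A' B'.
  have [ab eab] : 16 * (a * b) = 2 * (P * S * T) /\ (E3 != 0 -> a = b).
    by apply/hb; split; apply: oppr_inj; rewrite ?A' ?B'.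
  split; first by lra.
  by move=> c30; apply: eab; rewrite e3E; do ![apply: mulf_neq0 => //]; rewrite pnatr_eq0.
have m1 : (1 < m.+1)%N by rewrite ltnS (leq_ltn_trans _ (ltn_ord j)).
have [ab eab] := H m1.
have eab' : E3 != 0 -> a = b.
  by move=> e30; apply: eab; apply: contraNneq e30 => c30; rewrite e3E c30 mulr0.
have ab2 : 16 * (a * b) = 2 * (P * S * T) by lra.
have [A B] := hb.2 (conj ab2 eab').
have ffhh : ffc + hhc = 0.
  apply: complexP; rewrite !(Re_add, Im_add) /ff /hh /=; first by rewrite addr0.
  have [->|/eab' ->] := eqVneq E3 0; last by rewrite addNr.
  by rewrite !mul0r oppr0 addr0.
have m1E : (-1 +i* 0)%C = -1 :> R[i] by apply: complexP; rewrite ?(Re_opp, Im_opp) /= ?oppr0.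
rewrite A m1E in ffE; rewrite B m1E in hhE.
rewrite /phi_f /phi_h; split.
  transitivity ((ffc * ffc + fhc * hfc) * f j + fhc * (ffc + hhc) * h j); first by ring.
  by rewrite ffE ffhh mulr0 mul0r addr0 mulN1r.
transitivity ((hhc * hhc + hfc * fhc) * h j + hfc * (ffc + hhc) * f j); first by ring.
by rewrite hhE ffhh mulr0 mul0r addr0 mulN1r.
Qed.

Lemma kap_eq e : (K1 = e * c1 /\ K2 = e * c2) /\ K3 = e * c3 <->
  [/\ P * E1 + U * E2 + V * E3 = 2 * (P * S * T) * (e * c1),
      S * E2 + W * E3 = 2 * (P * S * T) * (e * c2) & T * E3 = 2 * (P * S * T) * (e * c3)].
Proof.
have div (x y : R) : x / (2 * (P * S * T)) = y <-> x = 2 * (P * S * T) * y.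
  by split=> [<-|->]; field; rewrite ?P0 ?S0 ?T0.
split=> [[[/div A /div B] /div C]|[/div A /div B /div C]]; first by split.
by split; [split|].
Qed.

(** The contact condition in adapted coordinates: kappa = c together with the
    condition on the blocks of phi on m_half + k_half. *)
Theorem contact_metric_eqs : c1 ^+ 2 + c2 ^+ 2 + c3 ^+ 2 = 1 ->
  contact_metric M xi g <->
  contact_eqs P U S V W T c1 c2 c3 /\ half_eqs m.+1 P S T c3 a b.
Proof.
move=> cc; rewrite (contact_metric_phi r0 inv P_gt0 S_gt0 T_gt0 gramE xi_o).
split=> [[sq _]|[E hab]].
  have sq' x y z f h := (phi_sqr_o x y z f h).1 (sq x y z f h).
  have [|e ee [k1 k2 k3]] := @vector_product_sqr R K1 K2 K3 c1 c2 c3 cc.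
    move=> Z1 Z2 Z3; have [x [y [z [<- <- <-]]]] := n_bar_surj Z1 Z2 Z3.
    by have [] := sq' x y z n0 n0.
  have E := (kap_eq e).1 (conj (conj k1 k2) k3).
  have e1 := kappa_eq P_gt0 S_gt0 T_gt0 cc ee E.
  have E' : contact_eqs P U S V W T c1 c2 c3.
    by case: E; rewrite e1 !mul1r.
  by split=> //; apply/(half_sqr cc E') => f h j; have [_] := sq' 0 0 0 f h; exact.
have [[k1 k2] k3] : (K1 = 1 * c1 /\ K2 = 1 * c2) /\ K3 = 1 * c3.
  by apply/kap_eq; case: E => *; rewrite !mul1r.
rewrite !mul1r in k1 k2 k3.
split=> [x y z f h|]; last by rewrite xi_o eta_tvec // -!expr2.
apply/phi_sqr_o; split; last by move=> j; exact: (half_sqr cc E).2 hab f h j.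
rewrite k1 k2 k3; cbv zeta.
have cc' : c2 ^+ 2 + c3 ^+ 2 + c1 ^+ 2 = 1 by rewrite addrC addrA.
have cc'' : c3 ^+ 2 + c1 ^+ 2 + c2 ^+ 2 = 1 by rewrite -addrA addrC.
split; last exact: unit_vector_product.
  by rewrite (unit_vector_product _ _ _ cc'); congr (_ + _ * _); ring.
by rewrite (unit_vector_product _ _ _ cc''); congr (_ + _ * _); ring.
Qed.

End ContactEquations.

(** * Adapted bases *)

Section AdaptedBasis.
Context {R : realType} {m : nat}.
Notation mat := ('M[R[i]]_m.+2).
Notation amb := (ambient (R := R) m.+1).
Variable r : R.
Hypothesis r0 : r != 0.
Notation M := (TrCP (n := m.+1) r).
Notation o := (o_H m.+1 r).
Implicit Types x y z : R.

Variables (xi : amb -> amb) (g : amb -> amb -> amb -> R) (a b : R).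
Hypothesis inv : invariant_pair r xi g a b.
Let ig : invariant_metric r g a b := inv.2.
Let n0 : 'I_m -> R[i] := fun _ => 0.
Notation X := (vX m.+1 : mat).
Notation mu := (vmu m.+1 : mat).
Notation nu := (vnu m.+1 : mat).
Notation G := (gram_form (g_o r g X X) (g_o r g mu mu) (g_o r g nu nu)
  (g_o r g X mu) (g_o r g X nu) (g_o r g mu nu)).

Lemma nvec_inj x y z x' y' z' : nvec m.+1 x y z = nvec m.+1 x' y' z' -> [/\ x = x', y = y' & z = z'].
Proof.
by move=> /(congr1 (at_o r)); rewrite !(at_o_nvec r) => /(tvec_inj r0) [].
Qed.

Lemma nvec_lin c1 c2 c3 (x1 y1 z1 x2 y2 z2 x3 y3 z3 : R) :
  rscale c1 (nvec m.+1 x1 y1 z1) + rscale c2 (nvec m.+1 x2 y2 z2) + rscale c3 (nvec m.+1 x3 y3 z3)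
  = nvec m.+1 (c1 * x1 + c2 * x2 + c3 * x3) (c1 * y1 + c2 * y2 + c3 * y3)
      (c1 * z1 + c2 * z2 + c3 * z3).
Proof.
by rewrite !nvecE !mbZ !mbD; apply: mb_ext => [|||k|k]; rewrite ?mulr0 ?addr0.
Qed.

(** The rows of the inverse of the Cholesky factor. *)
Definition cholesky_basis (P U S V W T : R) : 'M[R]_3 :=
  \matrix_(i, j) nth 0 (nth [::] [:: [:: P^-1; 0; 0]; [:: - (U / (P * S)); S^-1; 0];
     [:: (U * W - V * S) / (P * S * T); - (W / (S * T)); T^-1]] i) j.

Lemma matrix3P (A B : 'M[R]_3) :
  [/\ A 0 0 = B 0 0, A 0 1 = B 0 1 & A 0 2 = B 0 2] ->
  [/\ A 1 0 = B 1 0, A 1 1 = B 1 1 & A 1 2 = B 1 2] ->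
  [/\ A 2 0 = B 2 0, A 2 1 = B 2 1 & A 2 2 = B 2 2] -> A = B.
Proof.
have I3 (i : 'I_3) : [\/ i = 0, i = 1 | i = 2].
  by case: i => [[|[|[|//]]] ?]; [constructor 1|constructor 2|constructor 3]; apply: val_inj.
move=> [? ? ?] [? ? ?] [? ? ?]; apply/matrixP => i j.
by have [->|->|->] := I3 i; have [->|->|->] := I3 j.
Qed.

Lemma det_trig2 (A : 'M[R]_2) : A 0 1 = 0 -> \det A = A 0 0 * A 1 1.
Proof.
move=> A0; rewrite det_trig; last first.
  apply/is_trig_mxP => -[[|[|//]] ?] [[|[|//]] ?] //= _; rewrite -A0; congr (A _ _); exact: val_inj.
by rewrite !big_ord_recl big_ord0 mulr1; congr (_ * A _ _); apply: val_inj.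
Qed.

Lemma det_trig3 (A : 'M[R]_3) : A 0 1 = 0 -> A 0 2 = 0 -> A 1 2 = 0 ->
  \det A = A 0 0 * A 1 1 * A 2 2.
Proof.
move=> A01 A02 A12; rewrite det_trig; last first.
  apply/is_trig_mxP => -[[|[|[|//]]] ?] [[|[|[|//]]] ?] //= _;
  [rewrite -A01|rewrite -A02|rewrite -A12]; congr (A _ _); exact: val_inj.
by rewrite !big_ord_recl big_ord0 mulr1 mulrA; congr (_ * A _ _ * A _ _); apply: val_inj.
Qed.

Lemma ulsub (B : 'M[R]_3) (i j : 'I_2) :
  ulsubmx (B : 'M[R]_(2 + 1)) i j = B (widen_ord (leqnSn 2) i) (widen_ord (leqnSn 2) j).
Proof. by rewrite !mxE; congr (B _ _); apply: val_inj. Qed.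

Lemma det_ulsub (B : 'M[R]_3) : B 0 1 = 0 ->
  \det (ulsubmx (B : 'M[R]_(2 + 1))) = B 0 0 * B 1 1.
Proof.
move=> B01; rewrite det_trig2 !ulsub.
  by congr (B _ _ * B _ _); apply: val_inj.
by rewrite -B01; congr (B _ _); apply: val_inj.
Qed.

(** The orientation conditions are the positivity of the diagonal of B, which is
    lower triangular because the first vectors lie in R X and R {X, mu}. *)
Lemma adapted_cholesky B : adapted_basis r g B ->
  exists P U S V W T, [/\ [/\ 0 < P, 0 < S & 0 < T], B = cholesky_basis P U S V W T &
    inner_values r g (P ^+ 2) (U ^+ 2 + S ^+ 2) (V ^+ 2 + W ^+ 2 + T ^+ 2)
      (P * U) (P * V) (U * V + S * W)].
Proof.
move=> [on [rho rho0 b0] [x [y b1]] d2 d3].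
have [|B00 B01 B02] := @nvec_inj (B 0 0) (B 0 1) (B 0 2) rho^-1 0 0.
  rewrite -[LHS]/(xi_vec m.+1 B 0) b0 vXE nvecE mbZ.
  by apply: mb_ext => [|||k|k]; rewrite ?mulr1 ?mulr0.
have [_ _ B12] := nvec_inj b1.
rewrite det_ulsub // B00 pmulr_rgt0 ?invr_gt0 // in d2.
rewrite det_trig3 // B00 pmulr_rgt0 ?mulr_gt0 ?invr_gt0 // in d3.
have on' i j : G (B i 0) (B i 1) (B i 2) (B j 0) (B j 1) (B j 2) = (i == j)%:R.
  by rewrite -(g_gram ig) -on /g_o /xi_vec !(at_o_nvec r).
have := @triangular_orthonormal R (g_o r g X X) (g_o r g mu mu) (g_o r g nu nu)
  (g_o r g X mu) (g_o r g X nu) (g_o r g mu nu)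
  rho^-1 (B 1 0) (B 1 1) (B 2 0) (B 2 1) (B 2 2) _ d2 d3.
have := (on' 0 0, on' 0 1, on' 1 1, on' 0 2, on' 1 2, on' 2 2); rewrite B00 B01 B02 B12 /=.
case=> [[[[[e1 e2] e3] e4] e5] e6]; rewrite invr_gt0.
case/(_ rho0 e1 e2 e3 e4 e5 e6) => [P [U [S [V [W [T [pos [b11 b21 b22] [b31 b32 b33] gr1 gr2]]]]]]].
exists P, U, S, V, W, T; split=> //.
by apply: matrix3P; rewrite !mxE /= ?B00 ?B01 ?B02 ?B12.
Qed.

Lemma cholesky_adapted P U S V W T : 0 < P -> 0 < S -> 0 < T ->
  inner_values r g (P ^+ 2) (U ^+ 2 + S ^+ 2) (V ^+ 2 + W ^+ 2 + T ^+ 2)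
      (P * U) (P * V) (U * V + S * W) -> adapted_basis r g (cholesky_basis P U S V W T).
Proof.
move=> P0 S0 T0 gr; set B := cholesky_basis _ _ _ _ _ _.
have P1 := lt0r_neq0 P0; have S1 := lt0r_neq0 S0; have T1 := lt0r_neq0 T0.
have Y1B i : Y1 P U V (B i 0) (B i 1) (B i 2) = (i == 0)%:R.
  rewrite /Y1 !mxE; case: i => [[|[|[|//]]] ?] /=; field; by rewrite ?P1 ?S1 ?T1.
have Y2B i : Y2 S W (B i 1) (B i 2) = (i == 1)%:R.
  rewrite /Y2 !mxE; case: i => [[|[|[|//]]] ?] /=; field; by rewrite ?P1 ?S1 ?T1.
have Y3B i : Y3 T (B i 2) = (i == 2)%:R.
  rewrite /Y3 !mxE; case: i => [[|[|[|//]]] ?] /=; field; by rewrite ?P1 ?S1 ?T1.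
split.
- move=> i j; rewrite /g_o /xi_vec !(at_o_nvec r) (g_nvec ig gr).
  rewrite -!/(Y1 P U V _ _ _) -!/(Y2 S W _ _) -!/(Y3 T _) !Y1B !Y2B !Y3B.
  case: i => [[|[|[|//]]] ?]; case: j => [[|[|[|//]]] ?];
    by rewrite -!val_eqE /= ?(mulr0, mul0r, mulr1, addr0, add0r).
- exists P => //; rewrite /xi_vec !mxE /= vXE nvecE mbZ.
  by apply: mb_ext => [|||k|k]; rewrite ?mulr1 ?mulr0.
- by exists (B 1 0), (B 1 1); rewrite /xi_vec; congr nvec; rewrite mxE.
- by rewrite det_ulsub ?mxE //= mulr_gt0 // invr_gt0.
- by rewrite det_trig3 ?mxE //= !mulr_gt0 // invr_gt0.
Qed.

Definition metric_data x y z : pair_data (R := R) :=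
  PairData x y z (g_o r g X X) (g_o r g mu mu) (g_o r g nu nu)
    (g_o r g X mu) (g_o r g X nu) (g_o r g mu nu).

(** The adapted basis and the contact equations only involve the Cholesky factor
    L, and for given c the equations determine xi, as L c / (2 det L). *)
Theorem contact_with_realizes c1 c2 c3 : c1 ^+ 2 + c2 ^+ 2 + c3 ^+ 2 = 1 ->
  contact_with r xi g c1 c2 c3 <->
  exists x y z, xi_is r xi x y z /\ realizes m.+1 c1 c2 c3 (metric_data x y z) a b.
Proof.
move=> cc; split.
  move=> [cm [B aB]]; rewrite /xi_vec nvec_lin.
  have [P [U [S [V [W [T [[P0 S0 T0] BE gr]]]]]]] := adapted_cholesky aB.
  have P1 := lt0r_neq0 P0; have S1 := lt0r_neq0 S0; have T1 := lt0r_neq0 T0.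
  set x := c1 * B 0 0 + _ + _; set y := c1 * B 0 1 + _ + _; set z := c1 * B 0 2 + _ + _.
  move=> xiE; have xiE' : xi o = tvec r x y z n0 n0 by rewrite xiE (at_o_nvec r).
  have C1 : Y1 P U V x y z = c1.
    by rewrite /Y1 /x /y /z BE !mxE /=; field; rewrite ?P1 ?S1 ?T1.
  have C2 : Y2 S W y z = c2 by rewrite /Y2 /y /z BE !mxE /=; field; rewrite ?P1 ?S1 ?T1.
  have C3 : Y3 T z = c3 by rewrite /Y3 /z BE !mxE /=; field; rewrite ?P1 ?S1 ?T1.
  have := contact_metric_eqs r0 inv P0 S0 T0 gr xiE'; rewrite C1 C2 C3.
  case/(_ cc) => /(_ cm) [E hab] _.
  exists x, y, z; split=> //; exists P, U, S, V, W, T; split=> //.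
  case: E => E1 E2 E3; case: gr => -[g1 g2 g3] [g4 g5 g6].
  rewrite /metric_data g1 g2 g3 g4 g5 g6 /cholesky_data.
  have D0 : 2 * (P * S * T) != 0 by rewrite !mulf_neq0 // pnatr_eq0.
  have [-> -> ->] // : [/\ x = P * c1 / (2 * (P * S * T)), y = (U * c1 + S * c2) / (2 * (P * S * T)) &
      z = (V * c1 + W * c2 + T * c3) / (2 * (P * S * T))].
  apply: (@Y_inj R P U S V W T P1 S1 T1).
  - rewrite C1 -[LHS](mulKf D0) -E1 /Y1; field; by rewrite ?P1 ?S1 ?T1.
  - rewrite C2 -[LHS](mulKf D0) -E2 /Y2; field; by rewrite ?P1 ?S1 ?T1.
  - rewrite C3 -[LHS](mulKf D0) -E3 /Y3; field; by rewrite ?P1 ?S1 ?T1.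
move=> [x [y [z [xiE [P [U [S [V [W [T [[P0 S0 T0] E DE hab]]]]]]]]]]].
have P1 := lt0r_neq0 P0; have S1 := lt0r_neq0 S0; have T1 := lt0r_neq0 T0.
have D0 : 2 * (P * S * T) != 0 by rewrite !mulf_neq0 // pnatr_eq0.
case: DE => xE yE zE g1 g2 g3 g4 g5 g6.
have gr : inner_values r g (P ^+ 2) (U ^+ 2 + S ^+ 2) (V ^+ 2 + W ^+ 2 + T ^+ 2)
      (P * U) (P * V) (U * V + S * W) by [].
have xiE' : xi o = tvec r x y z n0 n0 by rewrite xiE (at_o_nvec r).
case: (E) => E1 E2 E3.
have C1 : Y1 P U V x y z = c1.
  rewrite -[RHS](mulKf D0) -E1 /Y1 xE yE zE; field; by rewrite ?P1 ?S1 ?T1.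
have C2 : Y2 S W y z = c2.
  rewrite -[RHS](mulKf D0) -E2 /Y2 yE zE; field; by rewrite ?P1 ?S1 ?T1.
have C3 : Y3 T z = c3.
  rewrite -[RHS](mulKf D0) -E3 /Y3 zE; field; by rewrite ?P1 ?S1 ?T1.
split.
  have := contact_metric_eqs r0 inv P0 S0 T0 gr xiE'; rewrite C1 C2 C3.
  by case/(_ cc) => _; apply.
pose B := cholesky_basis P U S V W T.
have ex : c1 * B 0 0 + c2 * B 1 0 + c3 * B 2 0 = x.
  by rewrite -C1 -C2 -C3 /Y1 /Y2 /Y3 !mxE /=; field; rewrite ?P1 ?S1 ?T1.
have ey : c1 * B 0 1 + c2 * B 1 1 + c3 * B 2 1 = y.
  by rewrite -C1 -C2 -C3 /Y1 /Y2 /Y3 !mxE /=; field; rewrite ?P1 ?S1 ?T1.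
have ez : c1 * B 0 2 + c2 * B 1 2 + c3 * B 2 2 = z.
  by rewrite -C1 -C2 -C3 /Y1 /Y2 /Y3 !mxE /=; field; rewrite ?P1 ?S1 ?T1.
exists B; first exact: cholesky_adapted.
by rewrite xiE /xi_vec nvec_lin ex ey ez.
Qed.

End AdaptedBasis.

(** * Invariant pairs with prescribed values *)

Section PrescribedStructure.
Context {R : realType} {m : nat}.
Notation mat := ('M[R[i]]_m.+2).
Notation amb := (ambient (R := R) m.+1).
Variable r : R.
Hypothesis r0 : r != 0.
Notation M := (TrCP (n := m.+1) r).
Notation o := (o_H m.+1 r).
Implicit Types (p q u v w : amb) (A B : mat).
Implicit Types (x y z : R) (f h : 'I_m -> R[i]).

Variables a b P U S V W T x0 y0 z0 : R.
Hypotheses (a_gt0 : 0 < a) (b_gt0 : 0 < b).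
Hypotheses (P_gt0 : 0 < P) (S_gt0 : 0 < S) (T_gt0 : 0 < T).
Let P0 : P != 0 := lt0r_neq0 P_gt0.
Let S0 : S != 0 := lt0r_neq0 S_gt0.
Let T0 : T != 0 := lt0r_neq0 T_gt0.
Let n0 : 'I_m -> R[i] := fun _ => 0.
Let Mo := @TrCP_o R m r.

(** The polynomial frame turns coordinates at o_H into an invariant field. *)
Definition inv_field p : amb := fund (pn r p x0 y0 z0) p.

Definition Y1v p v := Y1 P U V (cx r p v) (cy r p v) (cz r p v).
Definition Y2v p v := Y2 S W (cy r p v) (cz r p v).
Definition Y3v p v := Y3 T (cz r p v).

(** On m_half and k_half, <.,.> is four times the trace form of the rows, whence
    the factors 4 a and 4 b. *)
Definition inv_metric p u v : R :=
  Y1v p u * Y1v p v + Y2v p u * Y2v p v + Y3v p u * Y3v p v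
  + 4 * a * complex.Re (\tr (pf r p u *m (pf r p v) ^t*))
  + 4 * b * complex.Re (\tr (ph r p u *m (ph r p v) ^t*)).

Lemma inv_field_o : inv_field o = tvec r x0 y0 z0 n0 n0.
Proof. by rewrite /inv_field pn_o // fund_mb. Qed.

Lemma inv_field_gact c p : unitary c -> inv_field (gact c p) = gact c (inv_field p).
Proof. by move=> uc; rewrite /inv_field (pn_gact r uc) (gact_fund _ _ uc). Qed.

Lemma inv_field_invariant : invariant_vector_field r inv_field.
Proof.
split; last first.
  by move=> c p Sc _; rewrite !(actE _ (SU_unitary Sc)) inv_field_gact //; exact: SU_unitary.
split=> [p Mp|].
  have [c [_ uc -> _]] := TrCP_frame r0 Mp.
  rewrite inv_field_gact // inv_field_o; apply: tangent_gact => //; exact: tvec_tangent.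
exists inv_field; split=> //; apply: smooth_fund.
by apply: msmooth_pn; exact: smooth_cst.
Qed.

Lemma inv_metric_gact c p u v : unitary c ->
  inv_metric (gact c p) (gact c u) (gact c v) = inv_metric p u v.
Proof.
move=> uc; rewrite /inv_metric /Y1v /Y2v /Y3v !(cx_gact _ uc) !(cy_gact _ uc) !(cz_gact _ uc).
by rewrite !(pf_gact r uc) !(ph_gact r uc) !cj_adj -!(cjM _ _ uc) !(tr_cj _ uc).
Qed.

Lemma inv_metric_o x y z f h x' y' z' f' h' :
  inv_metric o (tvec r x y z f h) (tvec r x' y' z' f' h') =
  Y1 P U V x y z * Y1 P U V x' y' z' + Y2 S W y z * Y2 S W y' z' + Y3 T z * Y3 T z'
  + 4 * a * complex.Re (herm f f') + 4 * b * complex.Re (herm h h').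
Proof.
rewrite /inv_metric /Y1v /Y2v /Y3v !cx_tvec // !cy_tvec // !cz_tvec // !pf_tvec // !ph_tvec //.
by rewrite !tr_row_at.
Qed.

Lemma hermr_ge0 f : 0 <= complex.Re (herm f f).
Proof.
rewrite /herm Re_sum; apply: sumr_ge0 => k _.
by rewrite Re_mul Re_conjc Im_conjc mulrN opprK -!expr2 addr_ge0 ?sqr_ge0.
Qed.

Lemma herm_eq0 f : complex.Re (herm f f) = 0 -> f =1 n0.
Proof.
rewrite /herm Re_sum => /eqP; rewrite psumr_eq0 => [/allP H k|k _].
  have /= := H k (mem_index_enum _).
  rewrite Re_mul Re_conjc Im_conjc mulrN opprK -!expr2 paddr_eq0 ?sqr_ge0 //.
  by rewrite !sqrf_eq0 => /andP[/eqP e /eqP e']; apply: complexP; rewrite ?e ?e'.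
by rewrite Re_mul Re_conjc Im_conjc mulrN opprK -!expr2 addr_ge0 ?sqr_ge0.
Qed.

Lemma smooth_inv_metric X Y : smooth X -> smooth Y -> smooth (fun q => inv_metric q (X q) (Y q)).
Proof.
move=> sX sY.
have sc (c : R) (k : amb -> R) : smooth k -> smooth (fun q => c * k q).
  by move=> sk; apply: smooth_mul => //; exact: smooth_cst.
have sY3 Z : smooth Z -> smooth (fun q => Y3v q (Z q)).
  by move=> sZ; apply: sc; exact: smooth_cz.
have sY2 Z : smooth Z -> smooth (fun q => Y2v q (Z q)).
  by move=> sZ; apply: smooth_add; apply: (sc _ _ _); [exact: smooth_cy|exact: smooth_cz].
have sY1 Z : smooth Z -> smooth (fun q => Y1v q (Z q)).
  move=> sZ; apply: smooth_add; last by apply: (sc _ _ _); exact: smooth_cz.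
  by apply: smooth_add; apply: (sc _ _ _); [exact: smooth_cx|exact: smooth_cy].
apply: smooth_add; [apply: smooth_add; [apply: smooth_add; [apply: smooth_add|]|]|].
- by apply: smooth_mul; exact: sY1.
- by apply: smooth_mul; exact: sY2.
- by apply: smooth_mul; exact: sY3.
- apply: (sc _ _ _); apply: smooth_Re_trace; apply: msmoothM; last apply: msmooth_adj.
    exact: msmooth_pf.
  exact: msmooth_pf.
- apply: (sc _ _ _); apply: smooth_Re_trace; apply: msmoothM; last apply: msmooth_adj.
    exact: msmooth_ph.
  exact: msmooth_ph.
Qed.

Lemma inv_metric_riemannian : riemannian_metric M inv_metric.
Proof.
split.
- move=> p u v Mp tu tv; have [c [_ uc pE fr]] := TrCP_frame r0 Mp.
  have [x [y [z [f [h ->]]]]] := fr _ tu; have [x' [y' [z' [f' [h' ->]]]]] := fr _ tv.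
  rewrite pE !(inv_metric_gact _ _ _ uc) !inv_metric_o (hermC f f') (hermC h h') !Re_conjc.
  by ring.
- move=> p k u v w Mp tu tv tw; have [c [_ uc pE fr]] := TrCP_frame r0 Mp.
  have [x [y [z [f [h ->]]]]] := fr _ tu; have [x' [y' [z' [f' [h' ->]]]]] := fr _ tv.
  have [x'' [y'' [z'' [f'' [h'' ->]]]]] := fr _ tw.
  rewrite pE -gactZ -gactD tvec_linear !(inv_metric_gact _ _ _ uc) !inv_metric_o.
  have hl (e e' e'' : 'I_m -> R[i]) :
      complex.Re (herm e (fun j => (k +i* 0)%C * e' j + e'' j)) =
      k * complex.Re (herm e e') + complex.Re (herm e e'').
    have -> : (fun j => (k +i* 0)%C * e' j + e'' j) = (fun j => (k +i* 0)%C * e' j + 1 * e'' j).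
      by apply/funext => j; rewrite mul1r.
    rewrite herm_lin_r rmorph1 mul1r Re_add Re_mul Re_conjc Im_conjc /=; ring.
  by rewrite !hl /Y1 /Y2 /Y3; ring.
- move=> p u Mp tu; have [c [_ uc pE fr]] := TrCP_frame r0 Mp.
  have [x [y [z [f [h ->]]]]] := fr _ tu => u0.
  rewrite pE (inv_metric_gact _ _ _ uc) inv_metric_o -!expr2.
  have pf0 : 0 <= 4 * a * complex.Re (herm f f) by rewrite !mulr_ge0 ?hermr_ge0 // ltW.
  have ph0 : 0 <= 4 * b * complex.Re (herm h h) by rewrite !mulr_ge0 ?hermr_ge0 // ltW.
  rewrite lt0r !addr_ge0 ?sqr_ge0 // andbT; apply: contraNneq u0.
  move=> /eqP; rewrite !paddr_eq0 ?addr_ge0 ?sqr_ge0 // !sqrf_eq0.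
  case/andP=> /andP[/andP[/andP[/eqP y1 /eqP y2] /eqP y3] /eqP hf] /eqP hh.
  have a1 : 4 * a != 0 by rewrite mulf_neq0 ?pnatr_eq0 // gt_eqF.
  have b1 : 4 * b != 0 by rewrite mulf_neq0 ?pnatr_eq0 // gt_eqF.
  have f0 := herm_eq0 (mulf_cancel a1 (etrans hf (esym (mulr0 _)))).
  have h0 := herm_eq0 (mulf_cancel b1 (etrans hh (esym (mulr0 _)))).
  have [|||-> -> ->] := @Y_inj R P U S V W T P0 S0 T0 x y z 0 0 0.
  + by rewrite y1 /Y1 !mulr0 !addr0.
  + by rewrite y2 /Y2 !mulr0 !addr0.
  + by rewrite y3 /Y3 mulr0.
  rewrite (tvec_ext r (erefl 0) (erefl 0) (erefl 0) f0 h0).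
  have -> : tvec r 0 0 0 n0 n0 = 0 :> amb.
    have := tvec_linear r (-1) 0 0 0 n0 n0 0 0 0 n0 n0; rewrite scaleN1r addNr => ->.
    by apply: tvec_ext => [|||j|j]; rewrite ?mulr0 ?addr0.
  by apply/eqP; have := gactZ c 0 (0 : amb); rewrite !scale0r.
- move=> X Y [tX [X' [sX XX]]] [tY [Y' [sY YY]]].
  exists (fun q => inv_metric q (X' q) (Y' q)); split; first exact: smooth_inv_metric.
  by move=> p Mp; rewrite (XX p Mp) (YY p Mp).
Qed.

Lemma inv_metric_invariant : invariant_metric r inv_metric a b.
Proof.
split; [exact: inv_metric_riemannian| |exact: a_gt0|exact: b_gt0|].
  move=> c p u v Sc _ _ _; have uc := SU_unitary Sc.
  by rewrite !(actE _ uc) inv_metric_gact.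
move=> A A' B B' D D' [x [y [z ->]]] [x' [y' [z' ->]]].
move=> /m_halfE [f ->] /m_halfE [f' ->] /k_halfE [h ->] /k_halfE [h' ->].
have sum_mb (x1 y1 z1 : R) (f1 h1 : 'I_m -> R[i]) :
    nvec m.+1 x1 y1 z1 + mb 0 0 0 f1 (fun _ => 0) + mb 0 0 0 (fun _ => 0) h1 = mb x1 y1 z1 f1 h1.
  by rewrite nvecE !mbD; apply: mb_ext => [|||k|k]; rewrite ?addr0 ?add0r.
rewrite !sum_mb /g_o !at_o_mb !at_o_nvec !inv_metric_o !ip_half.
rewrite -!Re_sum -!/(herm _ _) !herm0l /=; ring.
Qed.

Lemma inv_pair : invariant_pair r inv_field inv_metric a b.
Proof. by split; [exact: inv_field_invariant|exact: inv_metric_invariant]. Qed.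

Lemma inv_field_xi : xi_is r inv_field x0 y0 z0.
Proof. by rewrite /xi_is inv_field_o at_o_nvec. Qed.

Lemma inv_metric_values : inner_values r inv_metric
  (P ^+ 2) (U ^+ 2 + S ^+ 2) (V ^+ 2 + W ^+ 2 + T ^+ 2) (P * U) (P * V) (U * V + S * W).
Proof.
have eX : at_o r (vX m.+1 : mat) = tvec r 1 0 0 n0 n0 by rewrite at_o_vX.
have emu : at_o r (vmu m.+1 : mat) = tvec r 0 1 0 n0 n0 by rewrite at_o_vmu.
have enu : at_o r (vnu m.+1 : mat) = tvec r 0 0 1 n0 n0 by rewrite at_o_vnu.
have g (A A' : mat) x y z x' y' z' : at_o r A = tvec r x y z n0 n0 ->
    at_o r A' = tvec r x' y' z' n0 n0 -> g_o r inv_metric A A' =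
    Y1 P U V x y z * Y1 P U V x' y' z' + Y2 S W y z * Y2 S W y' z' + Y3 T z * Y3 T z'.
  by move=> e e'; rewrite /g_o e e' inv_metric_o !herm0l !mulr0 !addr0.
split; split.
- by rewrite (g _ _ _ _ _ _ _ _ eX eX) /Y1 /Y2 /Y3; ring.
- by rewrite (g _ _ _ _ _ _ _ _ emu emu) /Y1 /Y2 /Y3; ring.
- by rewrite (g _ _ _ _ _ _ _ _ enu enu) /Y1 /Y2 /Y3; ring.
- by rewrite (g _ _ _ _ _ _ _ _ eX emu) /Y1 /Y2 /Y3; ring.
- by rewrite (g _ _ _ _ _ _ _ _ eX enu) /Y1 /Y2 /Y3; ring.
- by rewrite (g _ _ _ _ _ _ _ _ emu enu) /Y1 /Y2 /Y3; ring.
Qed.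

End PrescribedStructure.

(** * The types *)

Section GenericAngles.
Context {R : realType}.
Implicit Types th ph : R.

Lemma generic_angle_cos th : generic_angle th -> cos th != 0.
Proof.
have pi0 := pi_gt0 R; move=> [/andP[t0 t2] tpi2 _ tpi32].
have [t1|t1|tE] := ltgtP th (pi / 2); last by rewrite tE eqxx in tpi2.
  by rewrite gt_eqF // cos_gt0_pihalf //; apply/andP; split; lra.
have [t3|t3|tE] := ltgtP th (3 * pi / 2); last by rewrite tE eqxx in tpi32.
  have -> : th = (th - pi) + pi by rewrite subrK.
  by rewrite cosDpi oppr_eq0 gt_eqF // cos_gt0_pihalf //; apply/andP; split; lra.
have -> : th = (th - pi - pi) + pi + pi by rewrite !subrK.
by rewrite !cosDpi opprK gt_eqF // cos_gt0_pihalf //; apply/andP; split; lra.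
Qed.

Lemma generic_angle_sin th : generic_angle th -> sin th != 0.
Proof.
have pi0 := pi_gt0 R; move=> [/andP[t0 t2] _ tpi _].
have [t1|t1|tE] := ltgtP th pi; last by rewrite tE eqxx in tpi.
  by rewrite gt_eqF // sin_gt0_pi // t0.
have -> : th = (th - pi) + pi by rewrite subrK.
by rewrite sinDpi oppr_eq0 gt_eqF // sin_gt0_pi //; apply/andP; split; lra.
Qed.

Lemma generic_angle2_cos ph : generic_angle2 ph -> cos ph != 0.
Proof. by move=> [ph2 _]; rewrite gt_eqF // cos_gt0_pihalf. Qed.

Lemma generic_angle2_sin ph : generic_angle2 ph -> sin ph != 0.
Proof.
have pi0 := pi_gt0 R; move=> [/andP[p1 p2] p0].
have [pn|pp|pE] := ltgtP ph 0; last by rewrite pE eqxx in p0.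
  by rewrite -oppr_eq0 -sinN gt_eqF // sin_gt0_pi //; apply/andP; split; lra.
by rewrite gt_eqF // sin_gt0_pi //; apply/andP; split; lra.
Qed.

End GenericAngles.

Section Classification.
Context {R : realType} {m : nat}.
Notation mat := ('M[R[i]]_m.+2).
Notation amb := (ambient (R := R) m.+1).
Variable r : R.
Hypothesis r0 : r != 0.
Notation n := m.+1.
Implicit Types (xi : amb -> amb) (g : amb -> amb -> amb -> R) (D : pair_data (R := R)).
Implicit Types a b k q al be de th ph : R.

Definition has_data xi g D : Prop :=
  xi_is r xi (xi_X D) (xi_mu D) (xi_nu D) /\
  inner_values r g (in_XX D) (in_mumu D) (in_nunu D) (in_Xmu D) (in_Xnu D) (in_munu D).

Lemma metric_data_has xi g D : has_data xi g D ->
  metric_data r g (xi_X D) (xi_mu D) (xi_nu D) = D.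
Proof. by case: D => x y z g1 g2 g3 g4 g5 g6 [_ [[e1 e2 e3] [e4 e5 e6]]]; congr PairData. Qed.

Lemma contact_with_data xi g a b c1 c2 c3 : invariant_pair r xi g a b ->
  c1 ^+ 2 + c2 ^+ 2 + c3 ^+ 2 = 1 ->
  contact_with r xi g c1 c2 c3 <->
  exists2 D, has_data xi g D & realizes n c1 c2 c3 D a b.
Proof.
move=> inv cc; rewrite (contact_with_realizes r0 inv cc); split.
  by move=> [x [y [z [xiE rl]]]]; exists (metric_data r g x y z).
move=> [D hD rl]; exists (xi_X D), (xi_mu D), (xi_nu D).
by rewrite (metric_data_has hD); case: hD.
Qed.

(** The entries of the Cholesky factor are the coefficients from which inv_metric
    is built. *)
Lemma realizes_exists a b c1 c2 c3 D : c1 ^+ 2 + c2 ^+ 2 + c3 ^+ 2 = 1 -> 0 < a -> 0 < b ->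
  realizes n c1 c2 c3 D a b -> exists xi g,
    [/\ invariant_pair r xi g a b, contact_with r xi g c1 c2 c3 & has_data xi g D].
Proof.
move=> cc a0 b0 rl; case: (rl) => p [u [s [v [w [t [[p0 s0 t0] _ DE _]]]]]].
have inv := @inv_pair R m r r0 a b p u s v w t (xi_X D) (xi_mu D) (xi_nu D) a0 b0 p0 s0 t0.
have hD : has_data (inv_field r (xi_X D) (xi_mu D) (xi_nu D)) (inv_metric r a b p u s v w t) D.
  split; first exact: inv_field_xi.
  by rewrite DE; exact: inv_metric_values.
exists (inv_field r (xi_X D) (xi_mu D) (xi_nu D)), (inv_metric r a b p u s v w t).
exact: And3 inv ((contact_with_data inv cc).2 (ex_intro2 _ _ D hD rl)) hD.
Qed.

Section GivenPair.
Variables (xi : amb -> amb) (g : amb -> amb -> amb -> R) (a b : R).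
Hypothesis inv : invariant_pair r xi g a b.
Let a_gt0 : 0 < a := a_gt0 inv.2.
Let b_gt0 : 0 < b := b_gt0 inv.2.

Lemma sign_norm (e : R) : e = 1 \/ e = -1 -> e ^+ 2 = 1.
Proof. by move=> /sign_sqr []. Qed.

Lemma classify_AI : type_AI r xi g <-> exists s k q q' al : R,
  [/\ s = 1 \/ s = -1, 0 < k, 0 < q, 0 < q' & cond_AI r xi g a b s k q q' al].
Proof.
have cc (e : R) : e = 1 \/ e = -1 -> e ^+ 2 + 0 ^+ 2 + 0 ^+ 2 = 1.
  by move=> /sign_norm ->; rewrite expr0n !addr0.
split=> [h|[s [k [q [q' [al [hs k0 q0 q'0 [xiE gE hab]]]]]]]].
  have [e he cw] : exists2 e, e = 1 \/ e = -1 & contact_with r xi g e 0 0.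
    by case: h => h; [exists 1; [left|]|exists (-1); [right|]].
  have [D [xiE gE] rl] := (contact_with_data inv (cc e he)).1 cw.
  have [s [k [q [q' [al [[hs k0 q0 q'0] [DE hab]]]]]]] :=
    (realized_AI n D b a_gt0).1 (ex_intro2 _ _ e he rl).
  by rewrite DE in xiE gE; exists s, k, q, q', al.
have hD : has_data xi g (PairData _ _ _ _ _ _ _ _ _) := conj xiE gE.
have [e he rl] := (realized_AI n _ b a_gt0).2 (ex_intro _ s (ex_intro _ k (ex_intro _ q
  (ex_intro _ q' (ex_intro _ al (conj (And4 hs k0 q0 q'0) (conj erefl hab))))))).
have cw := (contact_with_data inv (cc e he)).2 (ex_intro2 _ _ _ hD rl).
by case: he cw => ->; [left|right].
Qed.

Lemma classify_AII : type_AII r xi g <-> exists s k q q' al : R,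
  [/\ s = 1 \/ s = -1, 0 < k, 0 < q, 0 < q' & cond_AII r xi g a b s k q q' al].
Proof.
have cc (e : R) : e = 1 \/ e = -1 -> 0 ^+ 2 + e ^+ 2 + 0 ^+ 2 = 1.
  by move=> /sign_norm ->; rewrite expr0n add0r addr0.
split=> [h|[s [k [q [q' [al [hs k0 q0 q'0 [xiE gE hab]]]]]]]].
  have [e he cw] : exists2 e, e = 1 \/ e = -1 & contact_with r xi g 0 e 0.
    by case: h => h; [exists 1; [left|]|exists (-1); [right|]].
  have [D [xiE gE] rl] := (contact_with_data inv (cc e he)).1 cw.
  have [s [k [q [q' [al [[hs k0 q0 q'0] [DE hab]]]]]]] :=
    (realized_AII n D b a_gt0).1 (ex_intro2 _ _ e he rl).
  by rewrite DE in xiE gE; exists s, k, q, q', al.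
have hD : has_data xi g (PairData _ _ _ _ _ _ _ _ _) := conj xiE gE.
have [e he rl] := (realized_AII n _ b a_gt0).2 (ex_intro _ s (ex_intro _ k (ex_intro _ q
  (ex_intro _ q' (ex_intro _ al (conj (And4 hs k0 q0 q'0) (conj erefl hab))))))).
have cw := (contact_with_data inv (cc e he)).2 (ex_intro2 _ _ _ hD rl).
by case: he cw => ->; [left|right].
Qed.

Lemma classify_AIII : type_AIII r xi g <-> exists s k q al : R,
  [/\ s = 1 \/ s = -1, 0 < k, 0 < q & cond_AIII r xi g a b s k q al].
Proof.
have cc (e : R) : e = 1 \/ e = -1 -> 0 ^+ 2 + 0 ^+ 2 + e ^+ 2 = 1.
  by move=> /sign_norm ->; rewrite expr0n !add0r.
split=> [h|[s [k [q [al [hs k0 q0 [xiE gE hab]]]]]]].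
  have [e he cw] : exists2 e, e = 1 \/ e = -1 & contact_with r xi g 0 0 e.
    by case: h => h; [exists 1; [left|]|exists (-1); [right|]].
  have [D [xiE gE] rl] := (contact_with_data inv (cc e he)).1 cw.
  have [s [k [q [al [[hs k0 q0] [DE hab]]]]]] :=
    (realized_AIII n D b a_gt0).1 (ex_intro2 _ _ e he rl).
  by rewrite DE in xiE gE; exists s, k, q, al.
have hD : has_data xi g (PairData _ _ _ _ _ _ _ _ _) := conj xiE gE.
have [e he rl] := (realized_AIII n _ b a_gt0).2 (ex_intro _ s (ex_intro _ k (ex_intro _ q
  (ex_intro _ al (conj (And3 hs k0 q0) (conj erefl hab)))))).
have cw := (contact_with_data inv (cc e he)).2 (ex_intro2 _ _ _ hD rl).
by case: he cw => ->; [left|right].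
Qed.

Section Angle.
Variable th : R.
Hypothesis gth : generic_angle th.
Let CS := cos2Dsin2 th.
Let C0 := generic_angle_cos gth.
Let S0 := generic_angle_sin gth.

Lemma classify_BI : type_BI r xi g th <-> exists k q q' al : R,
  [/\ 0 < k, 0 < q', 0 < q < 1 / sin th ^+ 2 & cond_BI r xi g a b th k q q' al].
Proof.
have cc : cos th ^+ 2 + sin th ^+ 2 + 0 ^+ 2 = 1 by rewrite CS expr0n addr0.
split=> [[_ cw]|[k [q [q' [al [k0 q'0 q0 [xiE gE hab]]]]]]].
  have [D [xiE gE] rl] := (contact_with_data inv cc).1 cw.
  have [k [q [q' [al [[k0 q'0 q0] [DE hab]]]]]] := (realized_BI n D b a_gt0 CS C0 S0).1 rl.
  by rewrite DE in xiE gE; exists k, q, q', al.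
have hD : has_data xi g (PairData _ _ _ _ _ _ _ _ _) := conj xiE gE.
have rl := (realized_BI n _ b a_gt0 CS C0 S0).2 (ex_intro _ k (ex_intro _ q
  (ex_intro _ q' (ex_intro _ al (conj (And3 k0 q'0 q0) (conj erefl hab)))))).
split=> //; exact: (contact_with_data inv cc).2 (ex_intro2 _ _ _ hD rl).
Qed.

Lemma classify_BII : type_BII r xi g th <-> exists k q al : R,
  [/\ 0 < k, 0 < q & cond_BII r xi g a b th k q al].
Proof.
have cc : cos th ^+ 2 + 0 ^+ 2 + sin th ^+ 2 = 1 by rewrite expr0n addr0 CS.
split=> [[_ cw]|[k [q [al [k0 q0 [xiE gE hab]]]]]].
  have [D [xiE gE] rl] := (contact_with_data inv cc).1 cw.
  have [k [q [al [[k0 q0] [DE hab]]]]] := (realized_BII n D b a_gt0 CS C0 S0).1 rl.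
  by rewrite DE in xiE gE; exists k, q, al.
have hD : has_data xi g (PairData _ _ _ _ _ _ _ _ _) := conj xiE gE.
have rl := (realized_BII n _ b a_gt0 CS C0 S0).2 (ex_intro _ k (ex_intro _ q
  (ex_intro _ al (conj (conj k0 q0) (conj erefl hab))))).
split=> //; exact: (contact_with_data inv cc).2 (ex_intro2 _ _ _ hD rl).
Qed.

Lemma classify_BIII : type_BIII r xi g th <-> exists k q al : R,
  [/\ 0 < k, 0 < q & cond_BIII r xi g a b th k q al].
Proof.
have cc : 0 ^+ 2 + cos th ^+ 2 + sin th ^+ 2 = 1 by rewrite expr0n add0r CS.
split=> [[_ cw]|[k [q [al [k0 q0 [xiE gE hab]]]]]].
  have [D [xiE gE] rl] := (contact_with_data inv cc).1 cw.
  have [k [q [al [[k0 q0] [DE hab]]]]] := (realized_BIII n D b a_gt0 CS C0 S0).1 rl.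
  by rewrite DE in xiE gE; exists k, q, al.
have hD : has_data xi g (PairData _ _ _ _ _ _ _ _ _) := conj xiE gE.
have rl := (realized_BIII n _ b a_gt0 CS C0 S0).2 (ex_intro _ k (ex_intro _ q
  (ex_intro _ al (conj (conj k0 q0) (conj erefl hab))))).
split=> //; exact: (contact_with_data inv cc).2 (ex_intro2 _ _ _ hD rl).
Qed.

Lemma classify_C ph : generic_angle2 ph -> type_C r xi g th ph <-> exists k q al be de : R,
  [/\ 0 < k, 0 < q, rho_C th ph q al * cos th ^+ 2 * cos ph ^+ 2 <= k ^+ 2,
      root_C th ph k q al be de & cond_C r xi g a b th ph k q al be de].
Proof.
move=> gph; have KZ := cos2Dsin2 ph; have Z0 := generic_angle2_sin gph.
have cc : (cos th * cos ph) ^+ 2 + (sin th * cos ph) ^+ 2 + sin ph ^+ 2 = 1.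
  by rewrite !exprMn -mulrDl CS mul1r KZ.
split=> [[_ _ cw]|[k [q [al [be [de [k0 q0 disc root [xiE gE hab]]]]]]]].
  have [D [xiE gE] rl] := (contact_with_data inv cc).1 cw.
  have [k [q [al [be [de [[k0 q0 disc root] [DE hab]]]]]]] :=
    (realized_C n D a_gt0 b_gt0 CS KZ Z0).1 rl.
  by rewrite DE in xiE gE; exists k, q, al, be, de.
have hD : has_data xi g (PairData _ _ _ _ _ _ _ _ _) := conj xiE gE.
have rl := (realized_C n _ a_gt0 b_gt0 CS KZ Z0).2 (ex_intro _ k (ex_intro _ q
  (ex_intro _ al (ex_intro _ be (ex_intro _ de (conj (And4 k0 q0 disc root) (conj erefl hab))))))).
split=> //; exact: (contact_with_data inv cc).2 (ex_intro2 _ _ _ hD rl).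
Qed.

End Angle.
End GivenPair.

Lemma half_values_refl a b : half_values n a b a b.
Proof. by []. Qed.

Lemma occurs_AI (s k q q' al : R) : s = 1 \/ s = -1 -> 0 < k -> 0 < q -> 0 < q' ->
  exists xi g a b, [/\ invariant_pair r xi g a b, type_AI r xi g &
    cond_AI r xi g a b s k q q' al].
Proof.
move=> hs k0 q0 q'0.
have a0 : 0 < k / (4 * q') by rewrite divr_gt0 ?mulr_gt0.
have b0 : 0 < k * q' / 4 by rewrite divr_gt0 ?mulr_gt0.
have hab := half_values_refl (k / (4 * q')) (k * q' / 4).
have [e he rl] := (realized_AI n _ _ a0).2 (ex_intro _ s (ex_intro _ k (ex_intro _ q
  (ex_intro _ q' (ex_intro _ al (conj (And4 hs k0 q0 q'0) (conj erefl hab))))))).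
have cc : e ^+ 2 + 0 ^+ 2 + 0 ^+ 2 = 1 by rewrite (sign_norm he) expr0n !addr0.
have [xi [g [inv cw [xiE gE]]]] := realizes_exists cc a0 b0 rl.
exists xi, g, (k / (4 * q')), (k * q' / 4); split=> //.
by case: he cw => ->; [left|right].
Qed.

Lemma occurs_AII (s k q q' al : R) : s = 1 \/ s = -1 -> 0 < k -> 0 < q -> 0 < q' ->
  exists xi g a b, [/\ invariant_pair r xi g a b, type_AII r xi g &
    cond_AII r xi g a b s k q q' al].
Proof.
move=> hs k0 q0 q'0.
have a0 : 0 < k / (4 * q') by rewrite divr_gt0 ?mulr_gt0.
have b0 : 0 < k * q' / 4 by rewrite divr_gt0 ?mulr_gt0.
have hab := half_values_refl (k / (4 * q')) (k * q' / 4).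
have [e he rl] := (realized_AII n _ _ a0).2 (ex_intro _ s (ex_intro _ k (ex_intro _ q
  (ex_intro _ q' (ex_intro _ al (conj (And4 hs k0 q0 q'0) (conj erefl hab))))))).
have cc : 0 ^+ 2 + e ^+ 2 + 0 ^+ 2 = 1 by rewrite (sign_norm he) expr0n add0r addr0.
have [xi [g [inv cw [xiE gE]]]] := realizes_exists cc a0 b0 rl.
exists xi, g, (k / (4 * q')), (k * q' / 4); split=> //.
by case: he cw => ->; [left|right].
Qed.

Lemma occurs_AIII (s k q al : R) : s = 1 \/ s = -1 -> 0 < k -> 0 < q ->
  exists xi g a b, [/\ invariant_pair r xi g a b, type_AIII r xi g &
    cond_AIII r xi g a b s k q al].
Proof.
move=> hs k0 q0.
have a0 : 0 < k / 4 by rewrite divr_gt0.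
have hab := half_values_refl (k / 4) (k / 4).
have [e he rl] := (realized_AIII n _ _ a0).2 (ex_intro _ s (ex_intro _ k (ex_intro _ q
  (ex_intro _ al (conj (And3 hs k0 q0) (conj erefl hab)))))).
have cc : 0 ^+ 2 + 0 ^+ 2 + e ^+ 2 = 1 by rewrite (sign_norm he) expr0n !add0r.
have [xi [g [inv cw [xiE gE]]]] := realizes_exists cc a0 a0 rl.
exists xi, g, (k / 4), (k / 4); split=> //.
by case: he cw => ->; [left|right].
Qed.

Section OccursAngle.
Variable th : R.
Hypothesis gth : generic_angle th.
Let CS := cos2Dsin2 th.
Let C0 := generic_angle_cos gth.
Let S0 := generic_angle_sin gth.

Lemma occurs_BI k q (q' : R) al : 0 < k -> 0 < q' -> 0 < q < 1 / sin th ^+ 2 ->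
  exists xi g a b, [/\ invariant_pair r xi g a b, type_BI r xi g th &
    cond_BI r xi g a b th k q q' al].
Proof.
move=> k0 q'0 hq; have q0 : 0 < q by case/andP: hq.
have a0 : 0 < k * Num.sqrt q / (4 * q') by rewrite divr_gt0 ?mulr_gt0 ?sqrtr_gt0.
have b0 : 0 < k * Num.sqrt q * q' / 4 by rewrite divr_gt0 ?mulr_gt0 ?sqrtr_gt0.
have hab := half_values_refl (k * Num.sqrt q / (4 * q')) (k * Num.sqrt q * q' / 4).
have rl := (realized_BI n _ _ a0 CS C0 S0).2 (ex_intro _ k (ex_intro _ q
  (ex_intro _ q' (ex_intro _ al (conj (And3 k0 q'0 hq) (conj erefl hab)))))).
have cc : cos th ^+ 2 + sin th ^+ 2 + 0 ^+ 2 = 1 by rewrite CS expr0n addr0.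
have [xi [g [inv cw [xiE gE]]]] := realizes_exists cc a0 b0 rl.
by exists xi, g, (k * Num.sqrt q / (4 * q')), (k * Num.sqrt q * q' / 4).
Qed.

Lemma occurs_BII k q al : 0 < k -> 0 < q ->
  exists xi g a b, [/\ invariant_pair r xi g a b, type_BII r xi g th &
    cond_BII r xi g a b th k q al].
Proof.
move=> k0 q0.
set rho := q ^+ 2 * cos th ^+ 2 + 4 * (al ^+ 2 * k ^+ 2 + 1) * sin th ^+ 2.
have rho0 : 0 < rho.
  apply: ltr_pwDl; first by apply: mulr_gt0; [exact: exprn_gt0|rewrite exprn_even_gt0].
  apply: mulr_ge0 (sqr_ge0 _); apply: mulr_ge0 => //; apply: addr_ge0 => //.
  exact: mulr_ge0 (sqr_ge0 _) (sqr_ge0 _).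
have a0 : 0 < k * Num.sqrt rho / (2 * rho) by rewrite divr_gt0 ?mulr_gt0 ?sqrtr_gt0.
have hab := half_values_refl (k * Num.sqrt rho / (2 * rho)) (k * Num.sqrt rho / (2 * rho)).
have rl := (realized_BII n _ _ a0 CS C0 S0).2 (ex_intro _ k (ex_intro _ q
  (ex_intro _ al (conj (conj k0 q0) (conj erefl hab))))).
have cc : cos th ^+ 2 + 0 ^+ 2 + sin th ^+ 2 = 1 by rewrite expr0n addr0 CS.
have [xi [g [inv cw [xiE gE]]]] := realizes_exists cc a0 a0 rl.
by exists xi, g, (k * Num.sqrt rho / (2 * rho)), (k * Num.sqrt rho / (2 * rho)).
Qed.

Lemma occurs_BIII k q al : 0 < k -> 0 < q ->
  exists xi g a b, [/\ invariant_pair r xi g a b, type_BIII r xi g th &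
    cond_BIII r xi g a b th k q al].
Proof.
move=> k0 q0; set rho := cos th ^+ 2 + q ^+ 2 * sin th ^+ 2.
have rho0 : 0 < rho.
  by apply: ltr_pwDl; rewrite ?exprn_even_gt0 // mulr_ge0 ?sqr_ge0.
have a0 : 0 < k * q * Num.sqrt rho / (4 * rho) by rewrite divr_gt0 ?mulr_gt0 ?sqrtr_gt0.
have hab := half_values_refl (k * q * Num.sqrt rho / (4 * rho)) (k * q * Num.sqrt rho / (4 * rho)).
have rl := (realized_BIII n _ _ a0 CS C0 S0).2 (ex_intro _ k (ex_intro _ q
  (ex_intro _ al (conj (conj k0 q0) (conj erefl hab))))).
have cc : 0 ^+ 2 + cos th ^+ 2 + sin th ^+ 2 = 1 by rewrite expr0n add0r CS.
have [xi [g [inv cw [xiE gE]]]] := realizes_exists cc a0 a0 rl.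
by exists xi, g, (k * q * Num.sqrt rho / (4 * rho)), (k * q * Num.sqrt rho / (4 * rho)).
Qed.

Lemma occurs_C ph k q al : generic_angle2 ph -> 0 < k -> 0 < q ->
  rho_C th ph q al * cos th ^+ 2 * cos ph ^+ 2 <= k ^+ 2 ->
  (exists be de, root_C th ph k q al be de) /\
  (forall be de, root_C th ph k q al be de ->
    exists xi g a b, [/\ invariant_pair r xi g a b, type_C r xi g th ph &
      cond_C r xi g a b th ph k q al be de]).
Proof.
move=> gph k0 q0 disc; have KZ := cos2Dsin2 ph.
have K0 := generic_angle2_cos gph; have Z0 := generic_angle2_sin gph.
split; first exact: (root_C_exists C0 K0 k0 q0 disc).
move=> be de root.
pose c := 1 / (16 * de ^+ 2)
  * (q ^+ 2 * de ^+ 2 * cos th ^+ 2 * cos ph ^+ 2 + rho_C th ph q al).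
have c0 : 0 < c.
  have [_ de0 _] := root; apply: mulr_gt0; first by rewrite divr_gt0 ?mulr_gt0 ?exprn_gt0.
  apply: ltr_wpDl; first by rewrite mulr_ge0 ?sqr_ge0 // mulr_ge0 ?sqr_ge0 // mulr_ge0 ?sqr_ge0.
  exact: (rhoC_gt0 _ _ _ Z0 al (lt0r_neq0 q0)).
have a0 : 0 < Num.sqrt c by rewrite sqrtr_gt0.
have c2 : Num.sqrt c ^+ 2 = c by rewrite sqr_sqrtr // ltW.
have rl := (realized_C n _ a0 a0 CS KZ Z0).2 (ex_intro _ k (ex_intro _ q
  (ex_intro _ al (ex_intro _ be (ex_intro _ de (conj (And4 k0 q0 disc root)
    (conj erefl (fun _ => conj c2 c2)))))))).
have cc : (cos th * cos ph) ^+ 2 + (sin th * cos ph) ^+ 2 + sin ph ^+ 2 = 1.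
  by rewrite !exprMn -mulrDl CS mul1r KZ.
have [xi [g [inv cw [xiE gE]]]] := realizes_exists cc a0 a0 rl.
by exists xi, g, (Num.sqrt c), (Num.sqrt c).
Qed.

End OccursAngle.

End Classification.

Theorem theorem5p3 (R : realType) (n : nat) (r : R)
    (hn : (1 <= n)%N) (hr : 0 < r) :
  (* the equivalences *)
  (forall (xi : ambient n -> ambient n)
          (g : ambient n -> ambient n -> ambient n -> R) (a b : R),
     invariant_pair r xi g a b ->
     [/\ (type_AI r xi g <->
            exists s k q q' al : R,
              [/\ s = 1 \/ s = -1, 0 < k, 0 < q, 0 < q' &
                  cond_AI r xi g a b s k q q' al]),
         (type_AII r xi g <->
            exists s k q q' al : R,
              [/\ s = 1 \/ s = -1, 0 < k, 0 < q, 0 < q' &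
                  cond_AII r xi g a b s k q q' al]) &
         (type_AIII r xi g <->
            exists s k q al : R,
              [/\ s = 1 \/ s = -1, 0 < k, 0 < q &
                  cond_AIII r xi g a b s k q al])] /\
     (forall th : R, generic_angle th ->
        [/\ (type_BI r xi g th <->
               exists k q q' al : R,
                 [/\ 0 < k, 0 < q', 0 < q < 1 / sin th ^+ 2 &
                     cond_BI r xi g a b th k q q' al]),
            (type_BII r xi g th <->
               exists k q al : R,
                 [/\ 0 < k, 0 < q & cond_BII r xi g a b th k q al]) &
            (type_BIII r xi g th <->
               exists k q al : R,
                 [/\ 0 < k, 0 < q & cond_BIII r xi g a b th k q al])]) /\
     (forall th ph : R, generic_angle th -> generic_angle2 ph ->
        (type_C r xi g th ph <->
           exists k q al be de : R,
             [/\ 0 < k, 0 < q,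
                 rho_C th ph q al * cos th ^+ 2 * cos ph ^+ 2 <= k ^+ 2,
                 root_C th ph k q al be de &
                 cond_C r xi g a b th ph k q al be de]))) /\
  (* all admissible values of the parameters occur *)
  [/\ (forall s k q q' al : R,
         s = 1 \/ s = -1 -> 0 < k -> 0 < q -> 0 < q' ->
         exists (xi : ambient n -> ambient n)
                (g : ambient n -> ambient n -> ambient n -> R) (a b : R),
           [/\ invariant_pair r xi g a b, type_AI r xi g &
               cond_AI r xi g a b s k q q' al]),
      (forall s k q q' al : R,
         s = 1 \/ s = -1 -> 0 < k -> 0 < q -> 0 < q' ->
         exists (xi : ambient n -> ambient n)
                (g : ambient n -> ambient n -> ambient n -> R) (a b : R),
           [/\ invariant_pair r xi g a b, type_AII r xi g &
               cond_AII r xi g a b s k q q' al]) &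
      (forall s k q al : R,
         s = 1 \/ s = -1 -> 0 < k -> 0 < q ->
         exists (xi : ambient n -> ambient n)
                (g : ambient n -> ambient n -> ambient n -> R) (a b : R),
           [/\ invariant_pair r xi g a b, type_AIII r xi g &
               cond_AIII r xi g a b s k q al])] /\
  (forall th : R, generic_angle th ->
     [/\ (forall k q q' al : R, 0 < k -> 0 < q' -> 0 < q < 1 / sin th ^+ 2 ->
            exists (xi : ambient n -> ambient n)
                   (g : ambient n -> ambient n -> ambient n -> R) (a b : R),
              [/\ invariant_pair r xi g a b, type_BI r xi g th &
                  cond_BI r xi g a b th k q q' al]),
         (forall k q al : R, 0 < k -> 0 < q ->
            exists (xi : ambient n -> ambient n)
                   (g : ambient n -> ambient n -> ambient n -> R) (a b : R),
              [/\ invariant_pair r xi g a b, type_BII r xi g th &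
                  cond_BII r xi g a b th k q al]) &
         (forall k q al : R, 0 < k -> 0 < q ->
            exists (xi : ambient n -> ambient n)
                   (g : ambient n -> ambient n -> ambient n -> R) (a b : R),
              [/\ invariant_pair r xi g a b, type_BIII r xi g th &
                  cond_BIII r xi g a b th k q al])]) /\
  (forall th ph : R, generic_angle th -> generic_angle2 ph ->
     forall k q al : R, 0 < k -> 0 < q ->
       rho_C th ph q al * cos th ^+ 2 * cos ph ^+ 2 <= k ^+ 2 ->
       (exists be de : R, root_C th ph k q al be de) /\
       (forall be de : R, root_C th ph k q al be de ->
          exists (xi : ambient n -> ambient n)
                 (g : ambient n -> ambient n -> ambient n -> R) (a b : R),
            [/\ invariant_pair r xi g a b, type_C r xi g th ph &
                cond_C r xi g a b th ph k q al be de])).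
Proof.
case: n hn => // m _; have r0 : r != 0 := lt0r_neq0 hr.
split; [|split; [|split]].
- move=> xi g a b inv; split.
    exact (And3 (classify_AI r0 inv) (classify_AII r0 inv) (classify_AIII r0 inv)).
  split=> [th gth|th ph gth gph]; last exact (classify_C r0 inv gth gph).
  exact (And3 (classify_BI r0 inv gth) (classify_BII r0 inv gth) (classify_BIII r0 inv gth)).
- by split=> *; [exact: occurs_AI|exact: occurs_AII|exact: occurs_AIII].
- by move=> th gth; split=> *; [exact: occurs_BI|exact: occurs_BII|exact: occurs_BIII].
- by move=> th ph gth gph k q al; exact: occurs_C.
Qed.
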